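(* Let $n\ge 1$ and $m\ge 5$ be integers. If $\Gamma$ is a graph with $(n,m)$--branching, then the right-angled Coxeter group $W_\Gamma$ is hyperbolic and $$\operatorname{Confdim}(\partial W_\Gamma)\;\ge\; 1+\frac{\log n}{\log(3m-7)}.$$
   Context: Graphs are simplicial (no loops or multiple edges) and have at least one vertex. For a vertex $x$ of a graph, $\operatorname{Lk}(x)$ denotes the set of neighbors of $x$. A subgraph is induced if it contains every edge of the ambient graph joining two of its vertices. Definition ($(n,m)$--branching). For $n\ge 1$ and $m\ge 5$, a finite simplicial graph $\Gamma$ has $(n,m)$--branching if every vertex has valence at least $n+1$ and for every induced path $P$ of length 1 or 2 with endpoints $u$ and $v$ the following holds: for every set $\{u_1,\dots,u_n\}$ of distinct vertices in $\operatorname{Lk}(u)\setminus P$ there exist a set $\{v_1,\dots,v_n\}$ of distinct vertices in $\operatorname{Lk}(v)\setminus P$ and cycle subgraphs $H_1,\dots,H_n$ of $\Gamma$ such that for all $i\ne j$: (i) $5\le |H_i|\le m$, where $|H_i|$ is the length of the cycle; (ii) $H_i$ contains $\{u_i,v_i\}\cup P$; (iii) $H_i\cap H_j=P$; and (iv) $\bigcup_i H_i$ is an induced subgraph of $\Gamma$. For a finite simplicial graph $\Gamma$ with vertex set $V\Gamma$, the right-angled Coxeter group $W_\Gamma$ is the group generated by $V\Gamma$ with defining relations $v^2=1$ for every vertex $v$, and $[v,w]=1$ for every pair of adjacent vertices $v,w$. Hyperbolic means Gromov hyperbolic. For a hyperbolic group $W$, $\partial W$ is its Gromov (visual) boundary,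 equipped with a visual metric. A homeomorphism $f\colon (Z,d)\to(Z',d')$ of metric spaces is a quasisymmetry if there is a homeomorphism $\phi\colon[0,\infty)\to[0,\infty)$ such that for all distinct $x,y,z\in Z$, $\frac{d'(f(x),f(y))}{d'(f(x),f(z))}\le \phi\left(\frac{d(x,y)}{d(x,z)}\right)$. The conformal dimension $\operatorname{Confdim}(Z)$ is the infimum of the Hausdorff dimensions of all metric spaces quasisymmetric to $Z$. *)

(* Defs.v *)
From HB Require Import structures.
From mathcomp Require Import all_boot all_order all_algebra generic_quotient.
From mathcomp Require Import all_classical all_reals all_analysis.
Set Implicit Arguments.
Unset Strict Implicit.
Unset Printing Implicit Defensive.
Import Order.TTheory GRing.Theory Num.Theory.
Import numFieldNormedType.Exports.
Local Open Scope classical_set_scope.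
Local Open Scope ring_scope.


Record sgraph := SGraph {
  vertex :> finType;
  adj : rel vertex;
  adj_sym : symmetric adj;
  adj_irr : irreflexive adj;
  vertex_nonempty : (0 < #|vertex|)%N }.

Section Graphs.
Variable G : sgraph.
Local Open Scope nat_scope.

Definition Lk (x : G) : {set G} := [set y | adj x y].

(* The edge joining x and y is represented by the unordered pair [set x; y]. *)
Record subgraph := Subgraph {
  verts : {set G};
  edges : {set {set G}} }.

Definition subgraph_le (H K : subgraph) : Prop :=
  verts H \subset verts K /\ edges H \subset edges K.

Definition subgraph_cap (H K : subgraph) : subgraph :=
  Subgraph (verts H :&: verts K) (edges H :&: edges K).

Definition subgraph_bigcup n (H : 'I_n -> subgraph) : subgraph :=
  Subgraph (\bigcup_(i < n) verts (H i))%SET (\bigcup_(i < n) edges (H i))%SET.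

Definition induced (H : subgraph) : Prop :=
  forall x y, x \in verts H -> y \in verts H -> adj x y ->
    [set x; y]%SET \in edges H.

Definition path_subgraph (u : G) (p : seq G) : subgraph :=
  Subgraph [set x in u :: p]%SET
           [set [set z.1; z.2] | z in zip (u :: p) p]%SET.

Definition cycle_subgraph (c : seq G) : subgraph :=
  Subgraph [set x in c]%SET [set [set x; next c x] | x in c]%SET.

Definition is_cycle_of_length (H : subgraph) (k : nat) : Prop :=
  exists c : seq G,
    [/\ uniq c, size c = k, 2 < k, cycle (@adj G) c & H = cycle_subgraph c].

(* The two orientations (u, v) and (v, u) of an induced path are both covered,
   being given by distinct vertex sequences u :: p. *)
Definition branching (n m : nat) : Prop :=
  (forall x : G, n.+1 <= #|Lk x|) /\
  forall (u : G) (p : seq G),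
    let v := last u p in
    let P := path_subgraph u p in
    path (@adj G) u p -> uniq (u :: p) -> (size p = 1 \/ size p = 2) ->
    induced P ->
    forall us : 'I_n -> G,
      injective us -> (forall i, us i \in Lk u :\: verts P) ->
      exists (vs : 'I_n -> G) (H : 'I_n -> subgraph),
        [/\ injective vs,
            forall i, vs i \in Lk v :\: verts P,
            forall i, [/\ exists2 k, is_cycle_of_length (H i) k & 5 <= k <= m,
                          us i \in verts (H i), vs i \in verts (H i) &
                          subgraph_le P (H i)],
            forall i j, i != j -> subgraph_cap (H i) (H j) = P &
            induced (subgraph_bigcup H)].

End Graphs.


Section Presentation.
Variables (X : choiceType).

(* The letter (x, true) stands for x and (x, false) for its inverse. *)
Definition word := seq (X * bool).

Definition flip (a : X * bool) : X * bool := (a.1, ~~ a.2).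

Definition word_inv (s : word) : word := rev (map flip s).

Inductive word_eq (rels : set word) : word -> word -> Prop :=
| word_eq_refl s : word_eq rels s s
| word_eq_sym s t : word_eq rels s t -> word_eq rels t s
| word_eq_trans s t r : word_eq rels s t -> word_eq rels t r -> word_eq rels s r
| word_eq_free s a t : word_eq rels (s ++ [:: a; flip a] ++ t) (s ++ t)
| word_eq_rel s r t : rels r -> word_eq rels (s ++ r ++ t) (s ++ t).

Variable rels : set word.

Definition word_eqb : rel word := fun s t => `[< word_eq rels s t >].

Lemma word_eqb_refl : reflexive word_eqb.
Proof. by move=> s; apply/asboolP; exact: word_eq_refl. Qed.

Lemma word_eqb_sym : symmetric word_eqb.
Proof.
by move=> s t; apply/asboolP/asboolP => h; exact: word_eq_sym.
Qed.

Lemma word_eqb_trans : transitive word_eqb.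
Proof.
move=> t s r /asboolP h1 /asboolP h2; apply/asboolP.
exact: word_eq_trans h1 h2.
Qed.

Definition word_equiv := EquivRel word_eqb word_eqb_refl word_eqb_sym word_eqb_trans.

Definition presented_group := {eq_quot word_equiv}%qT.

HB.instance Definition _ := Choice.on presented_group.

Local Notation pi := (\pi_presented_group)%qT.

Lemma presented_eqP s t : pi s = pi t <-> word_eq rels s t.
Proof.
split=> [/eqP|h]; first by rewrite eqmodE => /asboolP.
by apply/eqP; rewrite eqmodE; apply/asboolP.
Qed.

Lemma word_eq_ctx p q s t : word_eq rels s t ->
  word_eq rels (p ++ s ++ q) (p ++ t ++ q).
Proof.
elim=> {s t} [s|s t _|s t r _ h1 _ h2|s a t|s r t hr].
- exact: word_eq_refl.
- exact: word_eq_sym.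
- exact: word_eq_trans h1 h2.
- by have := word_eq_free rels (p ++ s) a (t ++ q); rewrite -!catA.
- by have := word_eq_rel (p ++ s) (t ++ q) hr; rewrite -!catA.
Qed.

Lemma flipK : involutive flip.
Proof. by case=> x b; rewrite /flip /= negbK. Qed.

Lemma word_invK : involutive word_inv.
Proof.
by move=> s; rewrite /word_inv map_rev revK -map_comp map_id_in // => a _; rewrite /= flipK.
Qed.

Lemma word_inv_cat s t : word_inv (s ++ t) = word_inv t ++ word_inv s.
Proof. by rewrite /word_inv map_cat rev_cat. Qed.

Lemma word_mulV s : word_eq rels (s ++ word_inv s) [::].
Proof.
elim: s => [|a s ih]; first exact: word_eq_refl.
rewrite -cat1s word_inv_cat /=.
have := word_eq_ctx [:: a] [:: flip a] ih.
rewrite /= -!catA => h; apply: word_eq_trans h _.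
exact: (word_eq_free rels [::] a [::]).
Qed.

Lemma word_mulVl s : word_eq rels (word_inv s ++ s) [::].
Proof. by rewrite -{2}(word_invK s); exact: word_mulV. Qed.

Lemma word_eq_inv s t : word_eq rels s t ->
  word_eq rels (word_inv s) (word_inv t).
Proof.
move=> h.
have h1 : word_eq rels (word_inv s) (word_inv s ++ t ++ word_inv t).
  apply: word_eq_sym; have := word_eq_ctx (word_inv s) [::] (word_mulV t).
  by rewrite !cats0.
apply: word_eq_trans h1 _.
have h2 := word_eq_ctx (word_inv s) (word_inv t) (word_eq_sym h).
apply: word_eq_trans h2 _.
by have := word_eq_ctx [::] (word_inv t) (word_mulVl s); rewrite /= -catA.
Qed.

Definition presented_one : presented_group := pi [::].
Definition presented_mul (g h : presented_group) : presented_group :=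
  pi (repr g ++ repr h).
Definition presented_inv (g : presented_group) : presented_group :=
  pi (word_inv (repr g)).

Lemma repr_word_eq s : word_eq rels (repr (pi s)) s.
Proof. by apply/presented_eqP; rewrite reprK. Qed.

Lemma presented_mulE s t : presented_mul (pi s) (pi t) = pi (s ++ t).
Proof.
apply/presented_eqP.
apply: (word_eq_trans (t := s ++ repr (pi t))).
  exact: (word_eq_ctx [::] _ (repr_word_eq s)).
by have := word_eq_ctx s [::] (repr_word_eq t); rewrite !cats0.
Qed.

Lemma presented_invE s : presented_inv (pi s) = pi (word_inv s).
Proof. by apply/presented_eqP/word_eq_inv/repr_word_eq. Qed.

Lemma presented_surj g : exists s, g = pi s.
Proof. by exists (repr g); rewrite reprK. Qed.

Lemma presented_mulA : associative presented_mul.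
Proof.
move=> g h k; have [s ->] := presented_surj g; have [t ->] := presented_surj h.
by have [r ->] := presented_surj k; rewrite !presented_mulE catA.
Qed.

Lemma presented_mul1 : left_id presented_one presented_mul.
Proof. by move=> g; have [s ->] := presented_surj g; rewrite presented_mulE. Qed.

Lemma presented_mulr1 : right_id presented_one presented_mul.
Proof.
by move=> g; have [s ->] := presented_surj g; rewrite presented_mulE cats0.
Qed.

Lemma presented_mulV : left_inverse presented_one presented_inv presented_mul.
Proof.
move=> g; have [s ->] := presented_surj g; rewrite presented_invE presented_mulE.
exact/presented_eqP/word_mulVl.
Qed.

Lemma presented_mulVr : right_inverse presented_one presented_inv presented_mul.
Proof.
move=> g; have [s ->] := presented_surj g; rewrite presented_invE presented_mulE.
exact/presented_eqP/word_mulV.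
Qed.

HB.instance Definition _ := isGroup.Build presented_group
  presented_mulA presented_mul1 presented_mulr1 presented_mulV presented_mulVr.

Definition presented_gen (x : X) : presented_group := pi [:: (x, true)].

End Presentation.

Section RACG.
Variable G : sgraph.

Definition racg_rels : set (word G) :=
  [set r | (exists v : G, r = [:: (v, true); (v, true)]) \/
           (exists v w : G, adj v w /\
              r = [:: (v, true); (w, true); (v, false); (w, false)])].

Definition racg := presented_group racg_rels.

HB.instance Definition _ := Group.on racg.

Definition racg_gens : seq racg :=
  [seq presented_gen racg_rels v | v <- enum G].

End RACG.


Section WordMetric.
Variables (R : realType) (W : groupType) (S : seq W).

Definition words_for (g : W) : set (seq W) :=
  [set s | all [in S ++ [seq (x^-1)%g | x <- S]] s /\ (\prod_(x <- s) x)%g = g].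

Definition generates : Prop := forall g, words_for g !=set0.

Definition word_dist (g h : W) : R :=
  inf [set (size s)%:R | s in words_for (g^-1 * h)%g].

End WordMetric.

Section Hyperbolic.
Variables (R : realType) (X : choiceType) (d : X -> X -> R).

Definition gromov_product (o x y : X) : R := (d x o + d y o - d x y) / 2.

Definition gromov_hyperbolic : Prop :=
  exists delta : R, forall o x y z,
    Num.min (gromov_product o x y) (gromov_product o y z) - delta
      <= gromov_product o x z.

Definition geodesic_ray (c : nat -> X) : Prop :=
  forall i j, d (c i) (c j) = `|i%:R - j%:R|.

Definition asymptotic (c c' : nat -> X) : Prop :=
  exists K : R, forall i, d (c i) (c' i) <= K.

(* The points are the classes of asymptotic geodesic rays.  For the word metric
   of a group, rays are parametrised by nat: a geodesic ray of the Cayley graph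
   stays at bounded distance from one which runs through vertices. *)
Definition gromov_boundary : set (set (nat -> X)) :=
  [set [set c' | geodesic_ray c' /\ asymptotic c c'] | c in geodesic_ray].

Definition boundary_product (o : X) (xi eta : gromov_boundary) : \bar R :=
  ereal_sup [set l | exists c c', set_val xi c /\ set_val eta c' /\
    l = limf_einf (fun ij : nat * nat =>
          (gromov_product o (c ij.1) (c' ij.2))%:E) (filter_prod \oo \oo)].

Definition is_metric (T : Type) (rho : T -> T -> R) : Prop :=
  [/\ forall x, rho x x = 0,
      forall x y, rho x y = 0 -> x = y,
      forall x y, rho x y = rho y x &
      forall y x z, rho x z <= rho x y + rho y z].

(* In a hyperbolic space the product of two distinct boundary points is finite,
   so that [fine] loses no information. *)
Definition is_visual (o : X) (rho : gromov_boundary -> gromov_boundary -> R) :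
    Prop :=
  exists a C : R, [/\ 1 < a, 0 < C & forall xi eta, xi <> eta ->
    C^-1 * a `^ (- fine (boundary_product o xi eta)) <= rho xi eta
      <= C * a `^ (- fine (boundary_product o xi eta))].

End Hyperbolic.

Definition hyperbolic_group (R : realType) (W : groupType) : Prop :=
  exists S : seq W, generates S /\ gromov_hyperbolic (word_dist R S).

Section Metrized.
Variables (R : realType) (T : choiceType) (rho : T -> T -> R).

Definition metrized (rho_metric : is_metric rho) : Type := T.

Variable rho_metric : is_metric rho.

HB.instance Definition _ := Choice.copy (metrized rho_metric) T.

Let rhoxx x : rho x x = 0. Proof. by case: rho_metric. Qed.
Let rho_pos x y : rho x y = 0 -> x = y. Proof. by case: rho_metric => _ + _ _; apply. Qed.
Let rho_sym x y : rho x y = rho y x. Proof. by case: rho_metric. Qed.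
Let rho_tri y x z : rho x z <= rho x y + rho y z. Proof. by case: rho_metric. Qed.

HB.instance Definition _ := @isMetric.Build R (metrized rho_metric)
  rho rhoxx rho_pos rho_sym rho_tri.

End Metrized.


Section Hausdorff.
Variables (R : realType) (T : metricType R).
Local Open Scope ereal_scope.

(* The added 0 makes the diameter of the empty set equal to 0. *)
Definition diam (A : set T) : \bar R :=
  ereal_sup (0 |` [set (mdist z.1 z.2)%:E | z in A `*` A]).

Definition hausdorff_premeasure (s delta : R) (A : set T) : \bar R :=
  ereal_inf [set \sum_(0 <= i <oo) (diam (U i)) `^ s |
    U in [set U : nat -> set T |
      A `<=` \bigcup_i U i /\ forall i, diam (U i) <= delta%:E]].

Definition hausdorff_measure (s : R) (A : set T) : \bar R :=
  ereal_sup [set hausdorff_premeasure s delta A | delta in [set e : R | (0 < e)%R]].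

(* Only exponents s > 0 are used, since 0 `^ 0 = 1 would count empty sets of
   the cover; omitting s = 0 does not change the infimum. *)
Definition hausdorff_dim : \bar R :=
  ereal_inf [set s%:E | s in
    [set s : R | (0 < s)%R /\ hausdorff_measure s [set: T] = 0]].

End Hausdorff.

Section Conformal.
Variable R : realType.

Definition half_line_homeo (phi : R -> R) : Prop :=
  exists psi : R -> R,
    [/\ set_fun `[0, +oo[ `[0, +oo[ phi, set_fun `[0, +oo[ `[0, +oo[ psi,
        {in `[0, +oo[, cancel phi psi}, {in `[0, +oo[, cancel psi phi} &
        {within `[0, +oo[, continuous phi} /\
        {within `[0, +oo[, continuous psi}].

Definition homeo (Z Y : topologicalType) (f : Z -> Y) : Prop :=
  exists g : Y -> Z,
    [/\ continuous f, continuous g, cancel f g & cancel g f].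

Definition quasisymmetry (Z Y : metricType R) (f : Z -> Y) : Prop :=
  homeo f /\ exists phi : R -> R, half_line_homeo phi /\
    forall x y z : Z, x <> y -> x <> z -> y <> z ->
      mdist (f x) (f y) / mdist (f x) (f z) <= phi (mdist x y / mdist x z).

Definition confdim (Z : metricType R) : \bar R :=
  ereal_inf [set D | exists (Y : metricType R) (f : Z -> Y),
                       quasisymmetry f /\ D = hausdorff_dim Y].

End Conformal.

(* Main.v *)
(** Branching excludes triangles and 4-cycles, so two prefixes of an element of
    [W] without a common initial letter commute letterwise, and one of them has
    length at most 1; this is the four-point condition with constant 1.

    For the dimension, glue polygons (the cycles [H_i]) layer by layer.  An
    outer side of a polygon carries one new chamber, an outer corner another
    one, and the chambers of a layer are completed from left to right by
    branching, in [n] disjoint ways.  So each vertical word over [n] letters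
    gives a chain of chambers in which consecutive ones are adjacent, and every
    chamber has at most [2m - 5 <= 3m - 7] successors in each of the [n]
    directions.  The cliques of letters along a path of the tree form a Foata
    normal form: paths are geodesic, the group element determines the path, and
    the layer is 1-Lipschitz.  By hyperbolicity, two paths whose chambers on some
    layer are far apart have separated before that layer, up to a bounded error.

    Let [H = 3m - 7] and let [f] be a quasisymmetry from the boundary to [Y].
    Replace each set of a cover of [Y] by a chamber on some layer [k] whose shadow
    has an image of comparable diameter [e].  Every one of the [n^N] chains is
    covered by shadows, so the diameters along it add up to a constant at least,
    whereas a shadow on layer [k] meets only [O(n^(N - k))] chains; hence
    [sum n^-k e >= const].  The outermost selected chambers satisfy Kraft's
    inequality [sum (n H)^-k <= 1].  For [H^b = n] either [e <= d H^-k] or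
    [n^-k e <= d^-b e^(1 + b)], so [sum e^(1 + b)] is bounded below. *)

Require Import Defs.
From HB Require Import structures.
From mathcomp Require Import all_boot all_order all_algebra zify ring lra.
From mathcomp Require Import all_classical all_reals all_analysis.
Set Implicit Arguments.
Unset Strict Implicit.
Unset Printing Implicit Defensive.

(** * Trace words *)

(** The mirrors of a chamber that face earlier layers or its two neighbours form a path with two
    vertices at a corner and three at a side: exactly the paths P of the branching condition.
    Neighbouring chambers of a layer share a mirror, and their polygons fit together only if the arc
    of outer sides ending there and the arc beginning there have a common vertex. This is where the
    freedom to prescribe the [u_i] enters: the ends of the [n] disjoint arcs at one chamber are the
    prescribed beginnings at the next. Word length cannot measure depth in the tree, since a side
    adds one letter and a corner two. The number of cliques can: it is the height of a heap of
    pieces, hence an invariant of the group element. A set of the cover is replaced by a node, and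
    this node by its topmost selected ancestor; closeness has to survive both steps and the passage
    to a neighbour in the chain, so two closeness constants are carried along. *)

Section TraceWords.
Variables (V : eqType) (adj : rel V).
Hypotheses (adjC : symmetric adj) (adjI : irreflexive adj).
Implicit Types (s t : V) (u v w : seq V).

(** The left descent test of a right-angled Coxeter group: an occurrence of [s] can be moved to the
    front by commutations. *)
Fixpoint pull s w :=
  if w is t :: w' then (t == s) || adj s t && pull s w' else false.

Inductive sim : seq V -> seq V -> Prop :=
| sim_nil : sim [::] [::]
| sim_skip s u v : sim u v -> sim (s :: u) (s :: v)
| sim_swap s t u : adj s t -> sim (s :: t :: u) (t :: s :: u)
| sim_trans v u w : sim u v -> sim v w -> sim u w.

Fixpoint reduced w := if w is s :: w' then ~~ pull s w' && reduced w' else true.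

(** Left multiplication by a generator on reduced words, with cancellation exactly at a left
    descent. [actK] and [actC] verify the Coxeter relations up to [sim], so the group acts on
    reduced words modulo [sim]. *)
Definition act s w := if pull s w then rem s w else s :: w.

Definition normal_form w := foldr act [::] w.

Lemma sim_refl w : sim w w.
Proof. by elim: w => [|s w ih]; [exact: sim_nil|exact: sim_skip]. Qed.

Lemma sim_sym u v : sim u v -> sim v u.
Proof.
elim=> [|s u' v' _ ih|s t u' st|v' u' w' _ h1 _ h2].
- exact: sim_nil.
- exact: sim_skip.
- by apply: sim_swap; rewrite adjC.
- exact: sim_trans h2 h1.
Qed.

Lemma sim_size u v : sim u v -> size u = size v.
Proof. by elim=> //= [s u' v' _ ->|v' u' w' _ -> _ ->]. Qed.

Lemma adj_neq s t : adj s t -> (s == t) = false.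
Proof. by apply: contraTF => /eqP ->; rewrite adjI. Qed.

Lemma pull_sim a u v : sim u v -> pull a u = pull a v.
Proof.
elim=> //= [s u' v' _ -> //|s t u' st|v' u' w' _ -> _ -> //].
case: (eqVneq s a) st => [->|_] st /=; first by rewrite st orbT.
by case: (eqVneq t a) st => [->|_] st /=; [rewrite adjC st | rewrite andbCA].
Qed.

Lemma pull_sim_cons s w : pull s w -> sim w (s :: rem s w).
Proof.
elim: w => //= t w ih; case: (eqVneq t s) => [->|ts] /=.
  by move=> _; exact: sim_refl.
case/andP=> st /ih h; apply: (sim_trans (v := t :: s :: rem s w)).
  exact: sim_skip.
by apply: sim_swap; rewrite adjC.
Qed.

Lemma rem_sim a u v : sim u v -> pull a u -> sim (rem a u) (rem a v).
Proof.
elim=> //= [s u' v' uv ih|s t u' st|v' u' w' uv h1 vw h2].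
- by case: (eqVneq s a) => //= sa /andP[_ h]; apply/sim_skip/ih.
- have := adj_neq st; case: (eqVneq s a) => [->|sa] /=.
    by rewrite (eq_sym a t) => -> _; exact: sim_refl.
  case: (eqVneq t a) => [->|ta] _ _; first exact: sim_refl.
  exact: sim_swap.
- by move=> h; apply: sim_trans (h1 h) (h2 _); rewrite -(pull_sim _ uv).
Qed.

Lemma reduced_sim u v : sim u v -> reduced u = reduced v.
Proof.
elim=> //= [s u' v' uv ->|s t u' st|v' u' w' _ -> _ -> //].
  by rewrite (pull_sim _ uv).
rewrite st (adjC t s) st /= (adj_neq st) eq_sym (adj_neq st) /=.
by rewrite andbCA.
Qed.

Lemma reduced_rem s w : pull s w -> reduced w -> ~~ pull s (rem s w) && reduced (rem s w).
Proof. by move=> h; rewrite (reduced_sim (pull_sim_cons h)). Qed.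

Lemma act_reduced s w : reduced w -> reduced (act s w).
Proof.
rewrite /act; case: ifP => [h /(reduced_rem h)/andP[] //|h rw /=].
by rewrite h.
Qed.

Lemma act_sim s u v : sim u v -> sim (act s u) (act s v).
Proof.
move=> uv; rewrite /act (pull_sim _ uv); case: ifP => h.
  by apply: rem_sim => //; rewrite (pull_sim _ uv).
exact: sim_skip.
Qed.

Lemma actK s w : reduced w -> sim (act s (act s w)) w.
Proof.
move=> rw; rewrite {2}/act; case: ifP => h.
  have /andP[/negbTE h1 _] := reduced_rem h rw.
  by rewrite /act h1; apply/sim_sym/pull_sim_cons.
by rewrite /act /= eqxx; exact: sim_refl.
Qed.

Lemma pull_act s t w : adj s t -> pull s (act t w) = pull s w.
Proof.
move=> st; rewrite /act; have ts := adj_neq st.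
case: ifP => h /=; last by rewrite eq_sym ts st.
by rewrite [RHS](pull_sim s (pull_sim_cons h)) /= eq_sym ts st.
Qed.

Lemma actC s t w : adj s t -> sim (act s (act t w)) (act t (act s w)).
Proof.
move=> st; have ts : adj t s by rewrite adjC.
have n1 := adj_neq st; have n2 := adj_neq ts.
have E a u : act a u = if pull a u then rem a u else a :: u by [].
rewrite (E s (act t w)) (E t (act s w)) (pull_act _ st) (pull_act _ ts).
rewrite /act; case hs: (pull s w); case ht: (pull t w) => /=.
- have h1 : pull s (rem t w) by rewrite -(pull_act w st) /act ht in hs.
  have := rem_sim (pull_sim_cons ht) hs; rewrite /= n2 => h2.
  have h3 : pull t (rem s w) by rewrite -(pull_act w ts) /act hs in ht.
  by have := rem_sim h2 h3; rewrite /= eqxx; exact: sim_sym.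
- by rewrite n2; exact: sim_refl.
- by rewrite n1; exact: sim_refl.
- exact: sim_swap.
Qed.

Lemma nf_reduced w : reduced (normal_form w).
Proof. by elim: w => //= s w ih; exact: act_reduced. Qed.

Lemma act_foldr_sim p u v : sim u v -> sim (foldr act u p) (foldr act v p).
Proof. by move=> uv; elim: p => //= s p ih; exact: act_sim. Qed.

Lemma nf_ctx p q u v : sim (foldr act (normal_form q) u) (foldr act (normal_form q) v) ->
  sim (normal_form (p ++ u ++ q)) (normal_form (p ++ v ++ q)).
Proof. by move=> h; rewrite /normal_form !foldr_cat; exact: act_foldr_sim. Qed.

Lemma nf_id w : reduced w -> normal_form w = w.
Proof. by elim: w => //= s w ih /andP[h /ih ->]; rewrite /act (negbTE h). Qed.

Lemma size_act s w : size (act s w) <= (size w).+1.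
Proof. rewrite /act; case: ifP => h //=; rewrite (sim_size (pull_sim_cons h)) /=; lia. Qed.

Lemma size_nf w : size (normal_form w) <= size w.
Proof. by elim: w => //= s w ih; apply: leq_trans (size_act _ _) _. Qed.

(** Each letter changes the length by one, so a single cancellation already makes the normal form
    shorter than the word. *)
Lemma nf_size_eq w : size (normal_form w) = size w -> reduced w.
Proof.
elim: w => //= s w ih; rewrite /act; case: ifP => h.
  have := sim_size (pull_sim_cons h); have := size_nf w => /=; lia.
move=> /= [e]; have rw := ih e; by rewrite -(nf_id rw) h nf_reduced.
Qed.

Lemma pull_mem s w : pull s w -> s \in w.
Proof.
elim: w => //= t w ih; rewrite inE; case: (eqVneq t s) => [->|ts] //=.
by case/andP=> _ /ih ->.
Qed.

Lemma pull_cat s u v : pull s (u ++ v) = pull s u || all (adj s) u && pull s v.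
Proof.
elim: u => //= t u ->; case: (t == s) => //=.
by case: (adj s t) => //=.
Qed.

Lemma reduced_catr u v : reduced (u ++ v) -> reduced v.
Proof. by elim: u => //= s u ih /andP[_ /ih]. Qed.

Lemma reduced_catl u v : reduced (u ++ v) -> reduced u.
Proof.
elim: u => //= s u ih /andP[h /ih ->]; rewrite andbT.
by apply: contra h; rewrite pull_cat => ->.
Qed.

Lemma sim_cat u u' v v' : sim u u' -> sim v v' -> sim (u ++ v) (u' ++ v').
Proof.
move=> h; elim: h v v' => //= [s x y _ ih v v' /ih|s t x st v v' vv|y x z _ h1 _ h2 v v' vv].
- exact: sim_skip.
- apply: (sim_trans (v := t :: s :: x ++ v)); first exact: sim_swap.
  by do 2!apply: sim_skip; elim: (x) => //= *; exact: sim_skip.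
- apply: sim_trans (h1 _ _ vv) (h2 _ _ (sim_refl _)).
Qed.

(** * Common prefixes of traces *)

Definition no_common_pull u v := forall s, pull s u -> pull s v -> False.

(** The letters of [u] are moved in front of [v] one at a time; a cancellation would produce a
    letter initial in both words. *)
Lemma reduced_rev_cat u v : reduced u -> reduced v -> no_common_pull u v ->
  reduced (rev u ++ v).
Proof.
elim: u v => //= s u ih v /andP[nsu ru] rv nc.
rewrite rev_cons cat_rcons; apply: ih => //=.
  rewrite rv andbT; by apply/negP => h; apply: (nc s) => //=; rewrite ?eqxx.
move=> t tu /=; case: (eqVneq s t) => [e|st] /=.
  by move: nsu; rewrite e tu.
by case/andP=> ts tv; apply: (nc t) => //=; rewrite ts tu orbT.
Qed.

(** Letters initial in both words are split off one after the other; the first word gets shorter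
    each time. *)
Lemma meet_ex u v : reduced u -> reduced v ->
  exists p a b, [/\ sim u (p ++ a), sim v (p ++ b) & no_common_pull a b].
Proof.
move: {2}(size u) (leqnn (size u)) => N; elim: N u v => [|N ih] u v.
  rewrite leqn0 size_eq0 => /eqP -> _ rv; exists [::], [::], v.
  by split=> //; exact: sim_refl.
move=> lu ru rv.
case: (boolP (has (fun s => pull s v && pull s u) u)) => [/hasP[s su /andP[sv us]]|hn]; last first.
  exists [::], u, v; split; [exact: sim_refl|exact: sim_refl|].
  by move=> s h1 h2; move/hasP: hn; apply; exists s; [exact: pull_mem|rewrite h1 h2].
have su' := pull_sim_cons us; have sv' := pull_sim_cons sv.
have /andP[_ r1] := reduced_rem us ru; have /andP[_ r2] := reduced_rem sv rv.
have [|p [a [b [h1 h2 h3]]]] := ih _ _ _ r1 r2.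
  by have := sim_size su' => /=; lia.
exists (s :: p), a, b; split=> //=.
  by apply: sim_trans su' _; exact: sim_skip.
by apply: sim_trans sv' _; exact: sim_skip.
Qed.

(** The first letter [s] of [a] is initial in [b ++ d] but not in [b], so it commutes with all of
    [b] and is taken from [d]; it can then be removed on both sides. *)
Lemma cross_adj a b c d : reduced (a ++ c) -> sim (a ++ c) (b ++ d) -> no_common_pull a b ->
  forall s t, s \in a -> t \in b -> adj s t.
Proof.
elim: a c b d => //= s a ih c b d /andP[ns rac] sm nc s' t.
have ps : pull s (b ++ d) by rewrite -(pull_sim s sm) /= eqxx.
have nsb : pull s b = false.
  by apply/negP => h; apply: (nc s) => //=; rewrite ?eqxx.
move: (ps); rewrite pull_cat nsb /= => /andP[sb sd].
rewrite inE; case/orP=> [/eqP -> tb|s'a tb]; first exact: (allP sb).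
apply: (ih c b (rem s d)) s'a tb => //.
- have := rem_sim (a := s) sm; rewrite /= eqxx => /(_ isT).
  have snb : s \notin b by apply/negP => /(allP sb); rewrite adjI.
  suff -> : rem s (b ++ d) = b ++ rem s d by [].
  elim: (b) snb => //= x b' ihb; rewrite inE negb_or => /andP[sx /ihb ->].
  by rewrite eq_sym (negbTE sx).
- move=> x xa xb; apply: (nc x) => //=.
  by rewrite xa andbT adjC (allP sb _ (pull_mem xb)) orbT.
Qed.

(** * Heaps of pieces and Foata normal forms *)

Fixpoint height w (v : V) :=
  if w is s :: w' then
    if adj v s then height w' v else maxn (height w' v) (height w' s).+1
  else 0.

(** Dropping the letters of the word from the last to the first, each resting on those it does not
    commute with, builds a heap of pieces; [height w v] is the layer, counted from 0, on which a
    further piece [v] would land. Swapping commuting letters does not change the heap. *)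
Lemma height_sim (v : V) u w : sim u w -> height u v = height w v.
Proof.
move=> h; elim: h v => //= [s x y _ ih v|s t x st v|y x z _ h1 _ h2 v].
- by rewrite !ih.
- rewrite st (adjC t s) st; case: (adj v s) => //; case: (adj v t) => //; lia.
- by rewrite h1 h2.
Qed.

Lemma height_cons_le s w (v : V) : height w v <= height (s :: w) v.
Proof. by rewrite /=; case: ifP => // _; exact: leq_maxl. Qed.

Lemma height_cons_ub k s w : (forall v : V, height w v <= k) ->
  forall v : V, height (s :: w) v <= k.+1.
Proof. by move=> h v /=; have := h v; have := h s; case: ifP => _; lia. Qed.

Lemma height_act_ub k s w : (forall v : V, height w v <= k) ->
  forall v : V, height (act s w) v <= k.+1.
Proof.
move=> h; rewrite /act; case: ifP => ps; last exact: height_cons_ub.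
move=> v; apply: leq_trans (height_cons_le s _ v) _.
by rewrite -(height_sim v (pull_sim_cons ps)); apply: leq_trans (h v) _.
Qed.

(* Lists of cliques are read from the last letters to the first ones, so that
   right multiplication of a group element by a clique is [cons]. *)
Definition clique (c : seq V) :=
  match c with [:: _] => true | [:: s; t] => adj s t | _ => false end.

Definition blocked (c c' : seq V) :=
  all (fun s => (s \notin c') && has (fun t => ~~ adj s t) c') c.

Fixpoint foata (cs : seq (seq V)) :=
  if cs is c :: cs' then
    [&& clique c, (if cs' is c' :: _ then blocked c c' else true) & foata cs']
  else true.

Lemma foata_catr e h : foata (e ++ h) -> foata h.
Proof. by elim: e => //= c e ih /and3P[_ _ /ih]. Qed.

Lemma foata_catl e h : foata (e ++ h) -> foata e.
Proof. by elim: e => //= c [|c' e] ih /and3P[-> bl /ih fe] //=; rewrite bl. Qed.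

Lemma clique_ex c : clique c -> exists s, s \in c.
Proof. by case: c => // s c _; exists s; rewrite inE eqxx. Qed.

Lemma foata_height_ub cs (v : V) : foata cs -> height (flatten cs) v <= size cs.
Proof.
elim: cs v => //= c cs ih v /and3P[cc _ /ih {}ih].
case: c cc => // s [|t [|//]] /= h.
  by have := ih v; have := ih s; case: ifP; lia.
by rewrite h; have := ih v; have := ih s; have := ih t; case: ifP; case: ifP; lia.
Qed.

(** The letter of the next clique that blocks [s] is at maximal height by induction, and [s] lands
    on top of it. *)
Lemma foata_height c cs s : foata (c :: cs) -> s \in c ->
  height (flatten cs) s = size cs.
Proof.
elim: cs c s => //= c' cs ih c s /and4P[_ /allP bl cc' /= /andP[bl' fo]] sc.
apply/eqP; rewrite eqn_leq; apply/andP; split.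
  by apply: (@foata_height_ub (c' :: cs)) => /=; rewrite cc' bl' fo.
have /andP[_ /hasP[t tc' nst]] := bl _ sc.
have := ih c' t; rewrite /= cc' bl' fo => /(_ isT tc') {}ih.
case: c' cc' tc' {bl bl'} => // x [|y [|//]] /=; rewrite !inE.
  by move=> _ /eqP e; move: ih nst; rewrite e => ih /negbTE ->; lia.
move=> xy /orP[] /eqP e; move: ih nst; rewrite e xy => ih /negbTE ->; first lia.
case: ifP; lia.
Qed.

Lemma foata_reach cs : foata cs -> cs != [::] -> exists v : V, height (flatten cs) v = size cs.
Proof.
case: cs => // c cs fo _; move: (fo) => /= /and3P[cc _ fo'].
have [s sc] := clique_ex cc; exists s; have h := foata_height fo sc.
apply/eqP; rewrite eqn_leq (foata_height_ub s fo) /=.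
case: c cc sc {fo} => // x [|y [|//]] /=; rewrite !inE.
  by move=> _ /eqP e; move: h; rewrite e adjI => h; lia.
by move=> xy /orP[] /eqP e; move: h; rewrite e ?xy ?adjI => h; [|rewrite adjC xy]; lia.
Qed.

Lemma pull_blocked s c' c cs : foata (c' :: cs) -> blocked c c' -> s \in c ->
  ~~ pull s (flatten (c' :: cs)).
Proof.
move=> /= /and3P[cc' _ _] /allP bl sc; have /andP[sc' /hasP[t tc' nst]] := bl _ sc.
rewrite pull_cat negb_or; apply/andP; split; first by apply: contra sc'; exact: pull_mem.
by rewrite negb_and; apply/orP; left; apply/allPn; exists t.
Qed.

Lemma foata_reduced cs : foata cs -> reduced (flatten cs).
Proof.
elim: cs => //= c cs ih /and3P[cc bl fo].
have ns s : s \in c -> ~~ pull s (flatten cs).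
  by case: cs {ih} bl fo => //= c' cs bl fo sc; exact: (pull_blocked fo bl sc).
case: c cc {bl} ns => // s [|t [|//]] /= h ns; rewrite (ih fo) ?andbT.
  by apply: ns; rewrite inE.
rewrite (ns t) ?inE ?eqxx ?orbT // andbT negb_or eq_sym (adj_neq h) /=.
by rewrite negb_and (ns s) ?orbT // inE eqxx.
Qed.

(** The reversed word starts with the lowest clique. A letter of any other clique is blocked by a
    letter of the clique below it, so it is not initial. *)
Lemma pull_first e c s : foata (e ++ [:: c]) -> pull s (rev (flatten (e ++ [:: c]))) -> s \in c.
Proof.
elim: e s => /= [|c' e ih] s.
  by rewrite cats0 => _ /pull_mem; rewrite mem_rev.
case/and3P=> _ bl fo; rewrite rev_cat pull_cat => /orP[|/andP[al ps]].
  exact: ih.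
have sc' : s \in c' by rewrite -mem_rev; exact: pull_mem.
exfalso; case: e ih bl fo al => [|c2 e] ih /= /allP /(_ _ sc') /andP[_ /hasP[t tc nst]] _ /allP al.
  by move: nst; rewrite al // mem_rev cats0.
by move: nst; rewrite al // mem_rev mem_cat tc.
Qed.

Lemma size_foata cs : foata cs -> size cs <= size (flatten cs) <= (size cs).*2.
Proof.
elim: cs => //= c cs ih /and3P[cc _ /ih].
by rewrite size_cat; case: c cc => // s [|t [|//]] /= _; lia.
Qed.

Lemma height_nonmem_rem s u v : {in u, forall t, adj s t} -> height (u ++ v) s = height v s.
Proof.
elim: u => //= t u ih h; rewrite h ?inE ?eqxx //; apply: ih => x xu.
by apply: h; rewrite inE xu orbT.
Qed.

Lemma height_rem_top cs c s : foata (c :: cs) -> s \in c ->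
  pull s (flatten (c :: cs)) /\ height (rem s (flatten (c :: cs))) s = size cs.
Proof.
move=> fo sc; have h := foata_height fo sc; move: fo => /= /and3P[cc _ _].
case: c cc sc => // x [|y [|//]] /=; rewrite !inE.
  by move=> _ /eqP e; rewrite -e eqxx.
move=> xy; case: (eqVneq x s) => [e|xs] /=.
  by move: xy; rewrite e => -> _; rewrite h.
move=> /eqP e; subst s.
by rewrite adjC xy eqxx /= h.
Qed.

(** The heap alone determines the top clique: its letters can be pulled and have height [size cs]
    over the rest, whereas a letter pulled from a lower clique has smaller height. *)
Lemma foata_top_sub c cs c' cs' : foata (c :: cs) -> foata (c' :: cs') ->
  size cs = size cs' -> sim (flatten (c :: cs)) (flatten (c' :: cs')) ->
  {subset c <= c'}.
Proof.
move=> fo fo' es sm s sc.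
have [ps hs] := height_rem_top fo sc.
have hs' : height (rem s (flatten (c' :: cs'))) s = size cs'.
  by rewrite -es -hs; apply/esym/height_sim/rem_sim.
move: ps; rewrite (pull_sim s sm) /= pull_cat => /orP[/pull_mem //|/andP[al ps']].
case: (boolP (s \in c')) => // nc; exfalso.
move: hs' => /=; have -> : rem s (c' ++ flatten cs') = c' ++ rem s (flatten cs').
  elim: (c') nc => //= x b' ihb; rewrite inE negb_or => /andP[sx /ihb ->].
  by rewrite eq_sym (negbTE sx).
rewrite (height_nonmem_rem _ (allP al)) => hh.
have := foata_height_ub s (foata_catr (e := [:: c']) fo').
rewrite (height_sim s (pull_sim_cons ps')) /= adjI hh; lia.
Qed.

Lemma sim_cancel s u v : sim (s :: u) (s :: v) -> sim u v.
Proof. by move=> h; have := rem_sim (a := s) h; rewrite /= eqxx; exact. Qed.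

Lemma sim_catI p u v : sim (p ++ u) (p ++ v) -> sim u v.
Proof. by elim: p => //= s p ih /sim_cancel. Qed.

(** Equality as sets, since the two commuting letters of a clique may be listed in either order. *)
Definition same_clique (c c' : seq V) := all (mem c') c && all (mem c) c'.

Lemma same_clique_sim c c' : clique c -> clique c' -> same_clique c c' -> sim c c'.
Proof.
case: c => // x [|y [|//]]; case: c' => // x' [|y' [|//]] /=; rewrite /same_clique /= !inE !andbT.
- by move=> _ _ /andP[/eqP -> _]; exact: sim_refl.
- by move=> _ h /and3P[_ /eqP e1 /eqP e2]; rewrite e1 e2 adjI in h.
- by move=> h _ /andP[/andP[/eqP e1 /eqP e2] _]; rewrite e1 e2 adjI in h.
- move=> h h' /andP[/andP[/orP[] /eqP e1 /orP[] /eqP e2] _]; subst.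
  + by rewrite adjI in h.
  + exact: sim_refl.
  + exact: sim_swap.
  + by rewrite adjI in h.
Qed.

Lemma foata_uniq cs cs' : foata cs -> foata cs' -> size cs = size cs' ->
  sim (flatten cs) (flatten cs') -> all2 same_clique cs cs'.
Proof.
elim: cs cs' => [|c cs ih] [|c' cs'] //= fo fo' [es] sm.
have h1 : same_clique c c'.
  by apply/andP; split; apply/allP => s sc; [exact: (foata_top_sub fo fo' es sm)|exact: (foata_top_sub fo' fo (esym es) (sim_sym sm))].
rewrite h1; apply: ih => //.
- by have /and3P[] := fo.
- by have /and3P[] := fo'.
apply: (@sim_catI c); apply: sim_trans sm _; apply: sim_cat (sim_refl _).
apply/sim_sym/same_clique_sim => //; first by have /and3P[] := fo.
by have /and3P[] := fo'.
Qed.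

End TraceWords.

(** * Right-angled Coxeter groups *)

Section RacgWords.
Variable G : sgraph.
Local Notation W := (racg G).
Local Notation RR := (@racg_rels G).
Local Notation nf := (normal_form (@adj G)).
Local Notation sim := (sim (@adj G)).
Local Notation red := (reduced (@adj G)).
Local Notation lift w := [seq (x, true) | x <- w].
Local Open Scope group_scope.
Implicit Types (u v w p q b c d r : seq G) (g h x y z : W).

Let symG : symmetric (@adj G) := @adj_sym G.
Let irrG : irreflexive (@adj G) := @adj_irr G.

Ltac slia := change (Equality.sort (vertex G)) with (Finite.sort (vertex G)) in *; lia.

Definition gen (v : G) : W := presented_gen RR v.

Definition el w : W := \prod_(v <- w) gen v.

(** Signs of letters may be dropped because the generators are involutions. *)
Definition nfg g : seq G := nf [seq a.1 | a <- repr g].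

Definition len g := size (nfg g).

Definition dn g h := len (g^-1 * h).

Lemma el_cat u v : el (u ++ v) = el u * el v.
Proof. by rewrite /el big_cat. Qed.

Lemma el_nil : el [::] = 1.
Proof. by rewrite /el big_nil. Qed.

Lemma el_cons s w : el (s :: w) = gen s * el w.
Proof. by rewrite /el big_cons. Qed.

Lemma el_pi w : el w = (\pi_(presented_group RR) (lift w))%qT.
Proof.
elim: w => [|s w ih]; first by rewrite el_nil.
by rewrite el_cons ih; exact: presented_mulE.
Qed.

Lemma gen2 s : gen s * gen s = 1.
Proof.
have -> : gen s * gen s = el [:: s; s] by rewrite !el_cons el_nil mulg1.
rewrite el_pi; apply/presented_eqP => /=.
have := word_eq_rel (rels := RR) [::] [::] (r := [:: (s, true); (s, true)]).
by rewrite /=; apply; left; exists s.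
Qed.

Lemma genV s : (gen s)^-1 = gen s.
Proof. by apply: (mulgI (gen s)); rewrite mulgV gen2. Qed.

Lemma genC s t : adj s t -> gen s * gen t = gen t * gen s.
Proof.
move=> st; have h : gen s * gen t * (gen s)^-1 * (gen t)^-1 = 1.
  rewrite !genV.
  have -> : gen s * gen t * gen s * gen t = el [:: s; t; s; t].
    by rewrite !el_cons el_nil mulg1 !mulgA.
  have e (x : G) (p q : seq G) : el (p ++ [:: x] ++ q) =
      (\pi_(presented_group RR) (lift p ++ [:: (x, false)] ++ lift q))%qT.
    have -> : (\pi_(presented_group RR) (lift p ++ [:: (x, false)] ++ lift q))%qT
       = el p * (gen x)^-1 * el q :> W.
      rewrite -mulgA !el_pi /gen /presented_gen.
      have -> : ((\pi_(presented_group RR) [:: (x, true)])%qT : W)^-1 =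
          (\pi_(presented_group RR) [:: (x, false)])%qT by exact: presented_invE.
      symmetry; etransitivity; last exact: presented_mulE.
      congr presented_mul; exact: presented_mulE.
    by rewrite genV -mulgA !el_cat el_cons el_nil mulg1.
  rewrite el_pi; apply/presented_eqP.
  (* The commutation relator is written with formal inverses, so the positive word [s t s t] must
     first be rewritten by means of [x = x^-1]. *)
  have sq (x : G) : word_eq RR [:: (x, true)] [:: (x, false)].
    apply: (word_eq_trans (t := [:: (x, true); (x, true); (x, false)])).
      by apply: word_eq_sym; exact: (word_eq_free RR [:: (x, true)] (x, true) [::]).
    have := word_eq_rel (rels := RR) [::] [:: (x, false)] (r := [:: (x, true); (x, true)]).
    by rewrite /=; apply; left; exists x.
  apply: (word_eq_trans (t := [:: (s, true); (t, true); (s, false); (t, false)])).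
    apply: (word_eq_trans (t := [:: (s, true); (t, true); (s, false); (t, true)])).
      exact: (word_eq_ctx [:: (s, true); (t, true)] [:: (t, true)] (sq s)).
    exact: (word_eq_ctx [:: (s, true); (t, true); (s, false)] [::] (sq t)).
  have := word_eq_rel (rels := RR) [::] [::]
     (r := [:: (s, true); (t, true); (s, false); (t, false)]).
  by rewrite /=; apply; right; exists s, t.
by move: h; rewrite -mulgA -invgM => /divg1_eq.
Qed.

Lemma el_sim u v : sim u v -> el u = el v.
Proof.
elim=> // [s u' v' _ ih|s t u' st|v' u' w' _ -> _ -> //].
  by rewrite !el_cons ih.
by rewrite !el_cons !mulgA genC.
Qed.

Lemma el_act s w : el (act (@adj G) s w) = gen s * el w.
Proof.
rewrite /act; case: ifP => h; last by rewrite el_cons.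
by rewrite (el_sim (pull_sim_cons symG h)) el_cons mulgA gen2 mul1g.
Qed.

Lemma el_nf w : el (nf w) = el w.
Proof. by elim: w => // s w ih; rewrite /= el_act ih el_cons. Qed.

(** All defining relations act trivially on reduced words modulo [sim]. This is the solution of the
    word problem: equal group elements have equivalent normal forms. *)
Lemma nf_word_eq s t : word_eq RR s t ->
  sim (nf [seq a.1 | a <- s]) (nf [seq a.1 | a <- t]).
Proof.
elim=> {s t} [s|s t _ h|s t r _ h1 _ h2|s a t|s r t hr].
- exact: sim_refl.
- exact: sim_sym.
- exact: sim_trans h1 h2.
- rewrite !map_cat; apply: (@nf_ctx _ _ symG irrG _ _ _ [::]) => /=.
  exact/actK/nf_reduced.
- rewrite !map_cat; apply: (@nf_ctx _ _ symG irrG _ _ _ [::]).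
  case: hr => [[v ->]|[v [w [vw ->]]]] /=.
    exact/actK/nf_reduced.
  set q := nf _; have rq : red q by exact: nf_reduced.
  apply: (sim_trans (v := act (@adj G) v (act (@adj G) v (act (@adj G) w (act (@adj G) w q))))).
    by apply: act_sim => //; apply: actC => //; rewrite symG.
  apply: sim_trans (actK _ _ _ _) _ => //.
    by do 2!apply: act_reduced => //.
  exact: actK.
Qed.

Lemma el_eq_sim u v : el u = el v -> sim (nf u) (nf v).
Proof.
rewrite !el_pi => /presented_eqP /nf_word_eq; rewrite -!map_comp.
have e (w : seq G) : map (fst \o (fun x : G => (x, true))) w = w by rewrite map_id_in.
by rewrite !e.
Qed.

Lemma elK g : el (nfg g) = g.
Proof.
rewrite /nfg el_nf; have [s ->] : exists s, g = el s.
  have e : exists w, (\pi_(presented_group RR) (repr g))%qT = el w.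
    elim: (repr g) => [|a w [w' e]]; first by exists [::]; rewrite el_nil.
    exists (a.1 :: w'); rewrite el_cons -e; case: a => v [] /=.
      by symmetry; exact: presented_mulE.
    rewrite -genV; symmetry.
    have -> : (gen v)^-1 = (\pi_(presented_group RR) [:: (v, false)])%qT :> W.
      exact: presented_invE.
    exact: presented_mulE.
  by case: e => w e; exists w; rewrite -e reprK.
have h : word_eq RR (repr (el s)) (lift s) by rewrite el_pi; exact: repr_word_eq.
have := el_sim (nf_word_eq h); rewrite !el_nf => ->.
by congr el; rewrite -map_comp map_id_in.
Qed.

Lemma nfg_red g : red (nfg g).
Proof. exact: nf_reduced. Qed.

Lemma nfg_el w : sim (nfg (el w)) (nf w).
Proof.
have := el_eq_sim (elK (el w)); rewrite nf_id //; exact: nfg_red.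
Qed.

Lemma len_el w : len (el w) = size (nf w).
Proof. exact: sim_size (nfg_el w). Qed.

Lemma len_el_red w : red w -> len (el w) = size w.
Proof. by move=> h; rewrite len_el nf_id. Qed.

Lemma len_el_le w : len (el w) <= size w.
Proof. by rewrite len_el; exact: size_nf. Qed.

Lemma el_rev w : el (rev w) = (el w)^-1.
Proof.
elim: w => [|s w ih]; first by rewrite el_nil invg1.
by rewrite rev_cons -cats1 el_cat ih el_cons el_cons el_nil mulg1 invgM genV.
Qed.

Lemma len_inv_le g : len g^-1 <= len g.
Proof.
by rewrite -{1}(elK g) -el_rev; apply: leq_trans (len_el_le _) _; rewrite size_rev.
Qed.

Lemma len_inv g : len g^-1 = len g.
Proof. by apply/eqP; rewrite eqn_leq len_inv_le /= -{1}(invgK g) len_inv_le. Qed.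

(** Being reduced means being of minimal length, which inversion preserves. *)
Lemma red_rev w : red w -> red (rev w).
Proof.
move=> h; apply: (nf_size_eq symG irrG); rewrite -len_el el_rev len_inv size_rev.
exact: len_el_red.
Qed.

Lemma len_mul g h : len (g * h) <= len g + len h.
Proof.
by rewrite -{1}(elK g) -{1}(elK h) -el_cat; apply: leq_trans (len_el_le _) _; rewrite size_cat.
Qed.

Lemma len1 : len 1 = 0.
Proof. by rewrite -el_nil len_el. Qed.

Lemma dnC g h : dn g h = dn h g.
Proof. by rewrite /dn -len_inv invgM invgK. Qed.

Lemma dn_tri y x z : dn x z <= dn x y + dn y z.
Proof.
rewrite /dn; have -> : x^-1 * z = (x^-1 * y) * (y^-1 * z).
  by rewrite -mulgA mulVKg.
exact: len_mul.
Qed.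

Lemma dn1 g : dn 1 g = len g.
Proof. by rewrite /dn invg1 mul1g. Qed.

Lemma dn_mul k g h : dn (k * g) (k * h) = dn g h.
Proof. by rewrite /dn invgM -mulgA mulKg. Qed.

Lemma dngg g : dn g g = 0.
Proof. by rewrite /dn mulVg len1. Qed.

(** The halving is exact by [gpE]: both elements consist of a common prefix and tails that do not
    cancel against each other. *)
Definition gp x y := (len x + len y - dn x y)./2.

Lemma meet_group x y : exists p a b,
  [/\ red (p ++ a), red (p ++ b), x = el (p ++ a), y = el (p ++ b) &
      no_common_pull (@adj G) a b].
Proof.
have [p [a [b [h1 h2 h3]]]] := meet_ex symG irrG (nfg_red x) (nfg_red y).
exists p, a, b; split=> //; try by rewrite -(el_sim h1) elK.
- by rewrite -(reduced_sim symG irrG h1) nfg_red.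
- by rewrite -(reduced_sim symG irrG h2) nfg_red.
- by rewrite -(el_sim h2) elK.
Qed.

Lemma dn_meet p (a : seq G) b : red (p ++ a) -> red (p ++ b) -> no_common_pull (@adj G) a b ->
  dn (el (p ++ a)) (el (p ++ b)) = size a + size b.
Proof.
move=> ra rb nc; rewrite !el_cat dn_mul /dn -el_rev -el_cat len_el_red ?size_cat ?size_rev //.
by apply: reduced_rev_cat => //; [exact: reduced_catr ra|exact: reduced_catr rb].
Qed.

Lemma gp_meet p (a : seq G) b : red (p ++ a) -> red (p ++ b) -> no_common_pull (@adj G) a b ->
  gp (el (p ++ a)) (el (p ++ b)) = size p.
Proof.
move=> ra rb nc; rewrite /gp dn_meet // !len_el_red // !size_cat.
by rewrite -[RHS]doubleK; congr _./2; slia.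
Qed.

Lemma gpE x y : len x + len y = dn x y + (gp x y).*2.
Proof.
have [p [a [b [ra rb -> -> nc]]]] := meet_group x y.
by rewrite gp_meet // dn_meet // !len_el_red // !size_cat; slia.
Qed.

Lemma gpC x y : gp x y = gp y x.
Proof. by rewrite /gp dnC addnC. Qed.

Lemma gp_prefix p (a : seq G) b : red (p ++ a) -> red (p ++ b) ->
  size p <= gp (el (p ++ a)) (el (p ++ b)).
Proof.
move=> ra rb; have := gpE (el (p ++ a)) (el (p ++ b)).
rewrite !len_el_red // !size_cat !el_cat dn_mul.
have := dn_tri 1 (el a) (el b); rewrite (dnC (el a) 1) !dn1 !len_el_red; first by slia.
  exact: reduced_catr rb.
exact: reduced_catr ra.
Qed.

(** * The four-point condition *)

Definition girth_ge5 :=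
  (forall x y z : G, adj x y -> adj y z -> adj x z -> False) /\
  (forall x y z t : G, x != z -> y != t -> adj x y -> adj y z -> adj z t -> adj t x -> False).

Hypothesis g5 : girth_ge5.

(** The first two letters of a reduced word differ, so two letters from each word would span a
    4-cycle. *)
Lemma no_big_cross (a : seq G) b : red a -> red b -> (forall s t, s \in a -> t \in b -> adj s t) ->
  size a <= 1 \/ size b <= 1.
Proof.
case: a => [|s1 [|s2 a]]; try by left.
case: b => [|t1 [|t2 b]]; try by right.
move=> /= /andP[/norP[ns _] _] /andP[/norP[nt _] _] h; exfalso.
apply: (g5.2 s1 t1 s2 t2); rewrite 1?eq_sym //.
- by rewrite h // !inE eqxx ?orbT.
- by rewrite symG h // !inE eqxx ?orbT.
- by rewrite h // !inE eqxx ?orbT.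
- by rewrite symG h // !inE eqxx ?orbT.
Qed.

Lemma gp_hyp x y z : minn (gp x y) (gp y z) <= (gp x z).+1.
Proof.
have [p [a [b [ra rb ex ey nc]]]] := meet_group x y.
have [q [c [d [rc rd ey' ez nc']]]] := meet_group y z.
have -> : gp x y = size p by rewrite ex ey gp_meet.
have -> : gp y z = size q by rewrite ey' ez gp_meet.
(* The common part [r] of the prefixes [p] and [q] of [y] is a prefix of both [x] and [z], and it
   lacks at most one letter of one of [p] and [q]. *)
have [r [a' [b' [h1 h2 nc2]]]] := meet_ex symG irrG (reduced_catl ra) (reduced_catl rc).
have s1 := sim_cat h1 (sim_refl (@adj G) a); have s2 := sim_cat h2 (sim_refl (@adj G) d).
have rra : red (r ++ (a' ++ a)) by rewrite catA -(reduced_sim symG irrG s1).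
have rrd : red (r ++ (b' ++ d)) by rewrite catA -(reduced_sim symG irrG s2).
have : size r <= gp x z.
  rewrite ex ez (el_sim s1) (el_sim s2) -!catA; exact: gp_prefix.
have : size a' <= 1 \/ size b' <= 1.
  have s3 := sim_cat h1 (sim_refl (@adj G) b); have s4 := sim_cat h2 (sim_refl (@adj G) c).
  have rab : red (r ++ (a' ++ b)) by rewrite catA -(reduced_sim symG irrG s3).
  have rbc : red (r ++ (b' ++ c)) by rewrite catA -(reduced_sim symG irrG s4).
  apply: no_big_cross.
  - exact: reduced_catl (reduced_catr rab).
  - exact: reduced_catl (reduced_catr rbc).
  - have sm : sim (r ++ (a' ++ b)) (r ++ (b' ++ c)).
      rewrite !catA; apply: sim_trans (sim_sym symG s3) _; apply: sim_trans _ s4.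
      have := el_eq_sim (etrans (esym ey) ey'); rewrite !nf_id //.
    exact: (cross_adj symG irrG (reduced_catr rab) (sim_catI symG irrG sm) nc2).
have := sim_size h1; have := sim_size h2; rewrite !size_cat; slia.
Qed.

(** The inverse lists the last letters first, which is the order in which [height] reads a heap from
    the top. *)
Definition level_le g k := forall v : G, height (@adj G) (nfg g^-1) v <= k.

Lemma level_gen g s k : level_le g k -> level_le (g * gen s) k.+1.
Proof.
move=> h v; have e : sim (nfg (g * gen s)^-1) (act (@adj G) s (nfg g^-1)).
  have -> : (g * gen s)^-1 = el (s :: nfg g^-1) by rewrite el_cons elK invgM genV.
  by have := nfg_el (s :: nfg g^-1); rewrite /= (nf_id (nfg_red _)).
by rewrite (height_sim symG v e); apply: height_act_ub.
Qed.

Lemma level_dn g h k : level_le g k -> level_le h (k + dn g h).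
Proof.
have -> : h = g * el (nfg (g^-1 * h)) by rewrite elK mulVKg.
rewrite /dn mulKg /len; move: (nfg (g^-1 * h)) => w.
have -> : size (nfg (el w)) = size (nf w) by exact: len_el.
rewrite -(el_nf w); move: (nf w) (nf_reduced symG irrG w) => {h}w _.
elim: w g k => [|s w ih] g k hk; first by rewrite el_nil mulg1 addn0.
by rewrite el_cons mulgA -addSnnS; apply/ih/level_gen.
Qed.

Definition gof (cs : seq (seq G)) : W := el (rev (flatten cs)).

Local Notation foata := (foata (@adj G)).

Lemma gof_cat (e h : seq (seq G)) : gof (e ++ h) = gof h * gof e.
Proof. by rewrite /gof flatten_cat rev_cat el_cat. Qed.

Lemma len_gof cs : foata cs -> len (gof cs) = size (flatten cs).
Proof.
by move=> h; rewrite len_el_red ?size_rev //; apply/red_rev/foata_reduced.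
Qed.

Lemma nfg_gofV cs : foata cs -> sim (nfg (gof cs)^-1) (flatten cs).
Proof.
move=> h; rewrite /gof -el_rev revK; have := nfg_el (flatten cs).
by rewrite nf_id //; exact: foata_reduced.
Qed.

Lemma level_gof cs : foata cs -> level_le (gof cs) (size cs).
Proof.
by move=> h v; rewrite (height_sim symG v (nfg_gofV h)); exact: foata_height_ub.
Qed.

Lemma level_gof_ge cs k : foata cs -> level_le (gof cs) k -> size cs <= k.
Proof.
move=> h; case: (eqVneq cs [::]) => [-> //|ne] hk.
have [v hv] := foata_reach symG irrG h ne.
by have := hk v; rewrite (height_sim symG v (nfg_gofV h)) hv.
Qed.

Lemma foata_level_dist cs cs' : foata cs -> foata cs' ->
  size cs <= size cs' + dn (gof cs) (gof cs').
Proof.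
by move=> h h'; apply: level_gof_ge => //; rewrite dnC; apply/level_dn/level_gof.
Qed.

Lemma gof_inj cs cs' : foata cs -> foata cs' -> size cs = size cs' ->
  gof cs = gof cs' -> all2 (@same_clique G) cs cs'.
Proof.
move=> h h' es e; apply: (foata_uniq symG irrG) => //.
apply: sim_trans (nfg_gofV h'); rewrite -e; exact/sim_sym/nfg_gofV.
Qed.

Lemma dn_gof_anc (e h : seq (seq G)) : foata (e ++ h) -> dn (gof h) (gof (e ++ h)) = size (flatten e).
Proof.
move=> fo; rewrite gof_cat -{1}(mulg1 (gof h)) dn_mul dn1 /gof len_el_red ?size_rev //.
apply: red_rev; have := foata_reduced irrG fo; rewrite flatten_cat; exact: reduced_catl.
Qed.

Lemma gp_anc (e h : seq (seq G)) : foata (e ++ h) -> gp (gof h) (gof (e ++ h)) = len (gof h).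
Proof.
move=> fo; have := gpE (gof h) (gof (e ++ h)); rewrite dn_gof_anc //.
rewrite !len_gof // ?flatten_cat ?size_cat; first by slia.
exact: foata_catr fo.
Qed.

(** The argument below yields three times [2 * C + 5]; the remainder is slack. *)
Definition fellow_const C := 6 * C + 30.

(** Some ancestor [p] of [h'] has nearly the word length of [h], and hyperbolicity makes [h] and [p]
    close. As the layer is 1-Lipschitz and [h], [h'] lie on the same layer, only few cliques
    separate [p] from [h']. *)
Lemma foata_fellow_aux C (e h e' h' : seq (seq G)) : foata (e ++ h) -> foata (e' ++ h') -> size h = size h' ->
  len (gof h) <= len (gof h') ->
  len (gof h) <= gp (gof (e ++ h)) (gof (e' ++ h')) + C ->
  dn (gof h) (gof h') <= fellow_const C.
Proof.
move=> fo fo' sz le hgp.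
have fh := foata_catr fo; have fh' := foata_catr fo'.
(* A clique has at most two letters, so the lengths of the ancestors of [h'] cannot jump past that
   of [h] by more than one letter. *)
have [q [p [ehp lp lp']]] : exists q p : seq (seq G), [/\ h' = q ++ p, len (gof p) <= len (gof h) &
    len (gof h) <= (len (gof p)).+1].
  move: le; rewrite !len_gof //; move: (size (flatten h)) => L.
  elim: (h') fh' => [|c r ih] fr lL.
    by exists [::], [::]; split=> //; rewrite /gof el_nil len1; move: lL => /=; slia.
  case: (leqP L (size (flatten r))) => [lr|lr].
    have [q [p [-> h1 h2]]] := ih (foata_catr (e := [:: c]) fr) lr.
    by exists (c :: q), p.
  case: (leqP (size (flatten (c :: r))) L) => lL'.
    exists [::], (c :: r); split=> //; rewrite len_gof //; slia.
  exists [:: c], r; have fr' := foata_catr (e := [:: c]) fr; split=> //; rewrite len_gof //; first slia.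
  move: lL'; rewrite /= size_cat; case/and3P: fr; case: (c) => // s [|t [|//]] /= _ _ _; slia.
have fp : foata p by rewrite ehp in fh'; exact: foata_catr fh'.
have h1 : len (gof h) <= (gp (gof h) (gof (e' ++ h')) + C).+1.
  by have := gp_hyp (gof h) (gof (e ++ h)) (gof (e' ++ h')); rewrite gp_anc //; slia.
have h2 : len (gof p) <= (gp (gof h) (gof p) + C).+2.
  have := gp_hyp (gof h) (gof (e' ++ h')) (gof p).
  have := @gp_anc (e' ++ q) p; rewrite -catA -ehp => /(_ fo'); rewrite gpC => ->; slia.
have h3 : dn (gof h) (gof p) <= 2 * C + 5 by have := gpE (gof h) (gof p); slia.
have h4 := foata_level_dist fh fp; rewrite sz ehp size_cat in h4.
have h5 : dn (gof p) (gof h') <= 2 * (2 * C + 5).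
  rewrite ehp dn_gof_anc -?ehp //.
  have : foata q by apply: (foata_catl (h := p)); rewrite -ehp.
  by move=> /size_foata/andP[_]; slia.
have := dn_tri (gof p) (gof h) (gof h'); rewrite /fellow_const; slia.
Qed.

Lemma foata_fellow C (e h e' h' : seq (seq G)) :
  foata (e ++ h) -> foata (e' ++ h') -> size h = size h' ->
  minn (len (gof h)) (len (gof h')) <= gp (gof (e ++ h)) (gof (e' ++ h')) + C ->
  dn (gof h) (gof h') <= fellow_const C.
Proof.
move=> fo fo' sz hm; case: (leqP (len (gof h)) (len (gof h'))) => le.
  by apply: (foata_fellow_aux fo fo' sz le); move: hm; rewrite (minn_idPl le).
rewrite dnC; apply: (foata_fellow_aux fo' fo (esym sz) (ltnW le)).
by rewrite gpC; move: hm; rewrite (minn_idPr (ltnW le)).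
Qed.

(** By [pull_first] the letters initial in the two words above [h] lie in [c] and in [c']; these are
    disjoint, so [h] is the whole common prefix. *)
Lemma gp_diverge (e : seq (seq G)) c (e' : seq (seq G)) c' (h : seq (seq G)) :
  foata (e ++ c :: h) -> foata (e' ++ c' :: h) -> (forall s, s \in c -> s \in c' -> False) ->
  gp (gof (e ++ c :: h)) (gof (e' ++ c' :: h)) = len (gof h).
Proof.
rewrite -!cat_rcons -!cats1 => fo fo' dis.
have rr (k : seq (seq G)) : foata (k ++ h) -> red (rev (flatten h) ++ rev (flatten k)).
  by move=> fk; rewrite -rev_cat -flatten_cat; apply/red_rev/foata_reduced.
have fh := foata_catr fo.
rewrite /gof !flatten_cat !(rev_cat _ (flatten h)) gp_meet -?flatten_cat; try exact: rr.
  by rewrite len_el_red //; exact/red_rev/foata_reduced.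
move=> s h1 h2; apply: (dis s).
  exact: pull_first (foata_catl fo) h1.
exact: pull_first (foata_catl fo') h2.
Qed.

End RacgWords.

(** * The word metric in terms of reduced words *)

Section RacgMetric.
Import Order.TTheory GRing.Theory Num.Theory.
Variables (R : realType) (G : sgraph).
Local Notation W := (racg G).
Local Notation d := (word_dist R (racg_gens G)).
Implicit Types (g h x y z o : W).
Local Open Scope classical_set_scope.
Local Open Scope ring_scope.

Lemma racg_gens_word (s : seq W) :
  all [in racg_gens G ++ [seq (x^-1)%g | x <- racg_gens G]] s ->
  exists w : seq G, s = [seq gen v | v <- w].
Proof.
elim: s => [|x s ih] /=; first by exists [::].
case/andP=> hx /ih[w ->].
suff [v ->] : exists v : G, x = gen v by exists (v :: w).
move: hx => /=; rewrite mem_cat => /orP[/mapP[v _ ->]|/mapP[y /mapP[v _ ->] ->]]; first by exists v.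
by exists v; exact: genV.
Qed.

Lemma words_for_el g (w : seq G) : el w = g ->
  words_for (racg_gens G) g [seq gen v | v <- w].
Proof.
move=> e; split; last by rewrite big_map.
apply/allP => x /mapP[v _ ->]; rewrite /= mem_cat; apply/orP; left.
by apply: map_f; rewrite mem_enum.
Qed.

Lemma racg_generates : generates (racg_gens G).
Proof. by move=> g; exists [seq gen v | v <- nfg g]; apply: words_for_el; exact: elK. Qed.

Lemma word_distE g h : d g h = (dn g h)%:R.
Proof.
rewrite /word_dist; set A := [set _ | _ in _].
have lb : lbound A (dn g h)%:R.
  move=> _ [s [hs e] <-]; have [w ew] := racg_gens_word hs.
  rewrite ler_nat ew size_map /dn -e ew big_map; exact: len_el_le.
have mem : A (dn g h)%:R.
  exists [seq gen v | v <- nfg (g^-1 * h)%g]; last by rewrite size_map.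
  by apply: words_for_el; exact: elK.
apply/eqP; rewrite eq_le; apply/andP; split.
  by apply: inf_lbound mem; exists (dn g h)%:R.
by apply: lb_le_inf lb; exists (dn g h)%:R.
Qed.

Lemma gromov_productE x y : gromov_product d 1%g x y = (gp x y)%:R.
Proof.
rewrite /gromov_product !word_distE (dnC x) (dnC y) !dn1.
have := gpE x y => /(congr1 (fun k : nat => k%:R : R)).
by rewrite !natrD -mul2n natrM; lra.
Qed.

Lemma gromov_product_translate o x y :
  gromov_product d o x y = gromov_product d 1%g (o^-1 * x)%g (o^-1 * y)%g.
Proof.
rewrite /gromov_product !word_distE dn_mul.
by rewrite (dnC x) (dnC y) (dnC _ 1%g) (dnC (o^-1 * y)%g 1%g) !dn1.
Qed.

Lemma racg_hyperbolic : girth_ge5 G -> gromov_hyperbolic d.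
Proof.
move=> g5; exists 1 => o x y z.
rewrite !(gromov_product_translate o) !gromov_productE.
have := gp_hyp g5 (o^-1 * x)%g (o^-1 * y)%g (o^-1 * z)%g.
by rewrite -(ler_nat R) -natr1 natr_min lerBlDr.
Qed.

End RacgMetric.

(** * Cycles of a branching graph *)

Section Branching.
Variable G : sgraph.
Implicit Types (u v w x y z : G) (c p O : seq G).
Ltac slia := change (Equality.sort (vertex G)) with (Finite.sort (vertex G)) in *; lia.

Lemma cycle_edgeP c x y : [set x; y]%SET \in edges (cycle_subgraph c) ->
  x \in c /\ y = next c x \/ y \in c /\ x = next c y.
Proof.
case/imsetP => z zc e.
have hx : x \in [set z; next c z]%SET by rewrite -e !inE eqxx.
have hy : y \in [set z; next c z]%SET by rewrite -e !inE eqxx orbT.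
have hz : z \in [set x; y]%SET by rewrite e !inE eqxx.
have hn : next c z \in [set x; y]%SET by rewrite e !inE eqxx orbT.
move: hx hy hz hn; rewrite !inE.
case/orP=> /eqP ex hy hz hn.
  left; rewrite ex; split=> //; case/orP: hn => /eqP hn; last by rewrite hn.
  by case/orP: hy => /eqP hy; rewrite hy // hn.
right; case/orP: hz => /eqP hz; last by rewrite -hz.
have -> : y = z by case/orP: hy => /eqP ->; rewrite // -ex.
by split.
Qed.

Lemma edge_verts c x y : [set x; y]%SET \in edges (cycle_subgraph c) ->
  x \in verts (cycle_subgraph c).
Proof.
case/imsetP => z zc e; have : x \in [set z; next c z]%SET by rewrite -e !inE eqxx.
by rewrite !inE => /orP[] /eqP ->; rewrite ?mem_next // inE.
Qed.

Lemma cycle_subgraph_ext c c' : c =i c' -> next c =1 next c' \/ next c =1 prev c' -> uniq c' ->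
  cycle_subgraph c = cycle_subgraph c'.
Proof.
move=> ec hn uc; rewrite /cycle_subgraph; congr Subgraph.
  by apply/setP => x; rewrite !inE ec.
apply/setP => e; apply/imsetP/imsetP => -[z zc ->].
  case: hn => hn; first by exists z; rewrite ?hn // -?ec.
  exists (next c z); first by rewrite /= -ec mem_next.
  by rewrite hn next_prev // finset.setUC.
case: hn => hn; first by exists z; rewrite ?hn ?ec //.
exists (next c' z); first by rewrite /= ec mem_next.
by rewrite hn prev_next // finset.setUC.
Qed.

Lemma next_at2 u w c : next (u :: w :: c) u = w.
Proof. by rewrite /= eqxx. Qed.

Lemma next_last u c : uniq (u :: c) -> next (u :: c) (last u c) = u.
Proof.
by move=> uc; rewrite next_nth mem_last index_last // nth_default.
Qed.

(** A cycle made of two arcs leaves the first one only at its last vertex; [next_cross'] is the same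
    for entering it. *)
Lemma next_cross u p c x y : uniq ((u :: p) ++ c) -> y \in u :: p -> x \notin u :: p ->
  x = next ((u :: p) ++ c) y -> y = last u p /\ x = head u c.
Proof.
move=> uc yp nx; rewrite next_nth mem_cat yp index_cat yp.
have nk := nth_index u yp; have : index y (u :: p) < size (u :: p) by rewrite index_mem.
move: (index y (u :: p)) nk => k nk; rewrite /= nth_cat ltnS leq_eqVlt => /orP[/eqP e|lt]; last first.
  by rewrite lt => ex; move: nx; rewrite ex inE mem_nth ?orbT.
rewrite e ltnn subnn nth0 => ->; split=> //.
by rewrite -nk e (last_nth u).
Qed.

Lemma next_cross' u p c x y : uniq ((u :: p) ++ c) -> y \in u :: p -> x \in c ->
  y = next ((u :: p) ++ c) x -> y = u /\ x = last u (p ++ c).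
Proof.
move=> uc yp xc ey.
suff yu : y = u.
  split=> //; apply: (can_inj (prev_next uc)); rewrite -ey yu.
  by rewrite cat_cons next_nth mem_last index_last // nth_default.
have /hasPn nc : ~~ has [in u :: p] c by move: uc; rewrite cat_uniq => /and3P[].
move: ey; rewrite next_nth mem_cat xc orbT index_cat (negbTE (nc x xc)).
move: (index x c) => k; rewrite cat_cons nth_cat.
have -> : size (u :: p) + k < size p = false by rewrite /=; lia.
have -> : size (u :: p) + k - size p = k.+1 by rewrite /=; lia.
case: (ltnP k.+1 (size c)) => h ey; last by rewrite ey nth_default.
by have := nc y; rewrite ey mem_nth // => /(_ isT); rewrite -ey yp.
Qed.

Lemma next_inj c : uniq c -> injective (next c).
Proof. by move=> uc; exact: can_inj (prev_next uc). Qed.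

(** Rotate [u] to the front, and if [w] is its predecessor instead of its successor, reverse the
    cycle as well. *)
Lemma cycle_normalize H k u w : is_cycle_of_length H k -> u != w ->
  [set u; w]%SET \in edges H ->
  exists c, let c' := u :: w :: c in
    [/\ uniq c', size c' = k, cycle (@adj G) c' & H = cycle_subgraph c'].
Proof.
case=> c [uc sc k2 cc ->] uw huw.
have uin : u \in c by have := edge_verts huw; rewrite inE.
have [i s es] := rot_to uin.
have e1 : cycle_subgraph c = cycle_subgraph (u :: s).
  rewrite -es; apply/esym/cycle_subgraph_ext => //; first exact: mem_rot.
  by left; exact: next_rot.
have us : uniq (u :: s) by rewrite -es rot_uniq.
have ss : size (u :: s) = k by rewrite -es size_rot.
have cs : cycle (@adj G) (u :: s) by rewrite -es rot_cycle.
rewrite e1 in huw *.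
case: (cycle_edgeP huw) => -[_ e].
  move: e us ss cs uw; case: s {es e1 huw} => [|w' s] /=.
    by rewrite eqxx => ->; rewrite eqxx.
  by rewrite eqxx => -> ? ? ? _; exists s.
have ew : w = last u s by apply: (next_inj us); rewrite -e next_last.
have er : u :: rev s = rotr 1 (rev (u :: s)) by rewrite rev_cons -rotr1_rcons.
have e2 : cycle_subgraph (u :: s) = cycle_subgraph (u :: rev s).
  apply/esym/cycle_subgraph_ext => //.
    by move=> x; rewrite er mem_rotr mem_rev.
  by right=> x; rewrite er next_rotr ?rev_uniq // next_rev.
have : uniq (u :: rev s) /\ size (u :: rev s) = k by rewrite er rotr_uniq rev_uniq size_rotr size_rev.
have : cycle (@adj G) (u :: rev s).
  rewrite er rotr_cycle rev_cycle; have -> // : cycle (fun x y => adj y x) (u :: s) = cycle (@adj G) (u :: s).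
  by apply: eq_cycle => x y; rewrite adj_sym.
rewrite e2; case/lastP: s ew {es e1 huw us ss cs e er e2} => [/= ew|s w'].
  by rewrite ew eqxx in uw.
by rewrite last_rcons rev_rcons => -> ? [? ?]; exists (rev s).
Qed.

(** [O] is the arc that completes the path [u :: p] to a polygon, listed from the neighbour of [u]
    to that of [last u p]. The last clause excludes chords between arc and path. *)
Definition outer (m : nat) u p O :=
  [/\ uniq ((u :: p) ++ O), path (@adj G) u (rcons O (last u p)),
      5 <= size (u :: p) + size O <= m &
      {in O & u :: p, forall x y, adj x y ->
        y = u /\ x = head u O \/ y = last u p /\ x = last u O}].

Lemma path_edge u v : [set u; v]%SET \in edges (path_subgraph u [:: v]).
Proof. by apply/imsetP; exists (u, v) => //=; rewrite inE. Qed.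

Lemma path_edge2 u w v : [set u; w]%SET \in edges (path_subgraph u [:: w; v]) /\
  [set w; v]%SET \in edges (path_subgraph u [:: w; v]).
Proof.
split; apply/imsetP; first by exists (u, w) => //=; rewrite inE eqxx.
by exists (w, v) => //=; rewrite !inE eqxx orbT.
Qed.

Lemma induced_edge x y : Defs.induced (path_subgraph x [:: y]).
Proof.
move=> a b; rewrite !inE => ha hb ab.
have -> : [set a; b]%SET = [set x; y]%SET; last exact: path_edge.
move: ha hb ab => /orP[] /eqP -> /orP[] /eqP ->; rewrite ?adj_irr //.
by rewrite finset.setUC.
Qed.

Lemma induced_path2 x y z : ~~ adj x z -> Defs.induced (path_subgraph x [:: y; z]).
Proof.
move=> nxz a b; rewrite !inE => ha hb ab; have [e1 e2] := path_edge2 x y z.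
have : [set a; b]%SET = [set x; y]%SET \/ [set a; b]%SET = [set y; z]%SET.
  move: ha hb ab => /or3P[] /eqP -> /or3P[] /eqP ->; rewrite ?adj_irr // => h.
  - by left.
  - by rewrite h in nxz.
  - by left; rewrite finset.setUC.
  - by right.
  - by rewrite adj_sym h in nxz.
  - by right; rewrite finset.setUC.
by case=> ->.
Qed.

(** The edges of the path force the cycle to run along it. The vertex [a] is then the predecessor of
    [u] and closes the cycle, whence the reversed list. *)
Lemma cycle_extract H k u p a : is_cycle_of_length H k -> size p = 1 \/ size p = 2 ->
  uniq (u :: p) -> subgraph_le (path_subgraph u p) H -> a \notin u :: p ->
  [set u; a]%SET \in edges H ->
  exists O, let c := (u :: p) ++ rev (a :: O) in
    [/\ uniq c, size c = k, cycle (@adj G) c & H = cycle_subgraph c].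
Proof.
move=> cH sp up [_ /fintype.subsetP leE] na ea.
have : exists c, [/\ uniq ((u :: p) ++ c), size ((u :: p) ++ c) = k,
    cycle (@adj G) ((u :: p) ++ c) & H = cycle_subgraph ((u :: p) ++ c)].
  case: p sp up leE {na} => [|w [|v [|a0 l]]] /=; try by case.
    rewrite inE andbT => _ uw leE.
    exact: (cycle_normalize cH uw (leE _ (path_edge u w))).
  rewrite !inE negb_or => _ /and3P[/andP[uw uv] wv _] leE.
  have [e1 e2] := path_edge2 u w v.
  have [c [uc sc cc eH]] := cycle_normalize cH uw (leE _ e1).
  have := leE _ e2; rewrite eH => /cycle_edgeP.
  case: c uc sc cc eH => [|v' c] uc sc cc eH.
    by case: cH => ? [_ _ k2 _ _]; rewrite -sc in k2.
  case=> -[vin e].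
    have -> : v = v' by move: e; rewrite /= eq_sym (negbTE uw) eqxx.
    by exists c.
  exfalso; have : v = u by apply: (next_inj uc); rewrite -e next_at2.
  by move=> e3; rewrite e3 eqxx in uv.
case=> c [uc sc cc eH]; move: ea; rewrite eH => /cycle_edgeP h.
have {h} ea : a = last u (p ++ c).
  case: h => -[_ e].
    case: p na e {up leE uc sc cc eH} sp => [|w p] na e; first by case.
    by move: na; rewrite e /= eqxx !inE eqxx orbT.
  by apply: (next_inj uc); rewrite -e next_last.
case/lastP: c ea uc sc cc eH => [|c0 a'].
  by rewrite cats0 => ea; move: na; rewrite ea mem_last.
rewrite last_cat last_rcons => <- uc sc cc eH.
by exists (rev c0); rewrite /= rev_cons revK.
Qed.

Variables (n m : nat).
Hypotheses (n0 : 0 < n) (hG : branching G n m).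

(** The branching condition in terms of arcs. By (iv) an edge of the graph between arc [i] and the
    path belongs to some [H j]; its end off the path lies on one cycle only, so [j = i] and the edge
    is an edge of that cycle. *)
Lemma branch_outer u p us : path (@adj G) u p -> uniq (u :: p) -> size p = 1 \/ size p = 2 ->
  Defs.induced (path_subgraph u p) -> injective us ->
  (forall i, us i \in Lk u :\: verts (path_subgraph u p)) ->
  exists O : 'I_n -> seq G,
    (forall i, outer m u p (O i) /\ head u (O i) = us i /\ O i != [::]) /\
    (forall i j x, x \in O i -> x \in O j -> i = j).
Proof.
move=> pp up sp ip ius hus.
have [vs [H [_ _ hH hI hU]]] := hG.2 u p pp up sp ip us ius hus.
have vP x : (x \in verts (path_subgraph u p)) = (x \in u :: p) by rewrite inE.
have na i : us i \notin u :: p by have := hus i; rewrite inE vP => /andP[].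
have adju i : adj u (us i) by have := hus i; rewrite !inE => /andP[].
have dis i j x : x \notin u :: p -> x \in verts (H i) -> x \in verts (H j) -> i = j.
  move=> nx xi xj; apply/eqP; case: (eqVneq i j) => // ij.
  have := congr1 (@verts G) (hI i j ij) => /setP/(_ x).
  by rewrite inE xi xj vP (negbTE nx).
have cycH i : exists2 k, is_cycle_of_length (H i) k & 5 <= k <= m by case: (hH i).
have edgeU i x y : x \in verts (H i) -> y \in verts (H i) -> x \notin u :: p -> adj x y ->
    [set x; y]%SET \in edges (H i).
  move=> xi yi nx xy.
  have : [set x; y]%SET \in edges (subgraph_bigcup H).
    by apply: hU => //; apply/bigcupP; exists i.
  case/bigcupP=> j _ ej.
  suff eij : i = j by rewrite eij.
  apply: (dis i j x nx xi); have [k [c [_ _ _ _ eH]] _] := cycH j.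
  by rewrite eH in ej *; exact: edge_verts ej.
have uH i : u \in verts (H i).
  by case: (hH i) => _ _ _ [/fintype.subsetP h _]; apply: h; rewrite vP inE eqxx.
have /fin_all_exists[Os hO] : forall i : 'I_n, exists Oi : seq G, exists k,
    let c := (u :: p) ++ rev (us i :: Oi) in
    [/\ 5 <= k <= m, uniq c, size c = k, cycle (@adj G) c & H i = cycle_subgraph c].
  move=> i; have [k ck hk] := cycH i; have [_ ui _ le] := hH i.
  have [|O [h1 h2 h3 h4]] := cycle_extract ck sp up le (na i).
    by rewrite finset.setUC; apply: edgeU => //; rewrite adj_sym.
  by exists O, k.
exists (fun i => us i :: Os i); split; last first.
  move=> i j x xi xj; have [k [_ uc _ _ eH]] := hO i; have [k' [_ _ _ _ eH']] := hO j.
  apply: (dis i j x).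
  - move: uc; rewrite cat_uniq => /and3P[_ /hasPn h _]; apply: h; by rewrite mem_rev.
  - by rewrite eH inE mem_cat mem_rev xi orbT.
  - by rewrite eH' inE mem_cat mem_rev xj orbT.
move=> i; split=> //; have [k [hk uc sc cc eH]] := hO i; split.
- have pe : perm_eq ((u :: p) ++ rev (us i :: Os i)) ((u :: p) ++ us i :: Os i).
    by rewrite perm_cat2l perm_rev.
  by rewrite -(perm_uniq pe).
- move: cc; rewrite /= rcons_cat cat_path => /andP[_].
  rewrite -rev_path last_rcons belast_rcons rev_cons revK.
  by rewrite (eq_path (e' := @adj G)) // => x y; rewrite adj_sym.
- by move: hk; rewrite -sc size_cat size_rev.
- move=> x y xO yP xy.
  have nx : x \notin u :: p.
    by move: uc; rewrite cat_uniq => /and3P[_ /hasPn h _]; apply: h; rewrite mem_rev.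
  have xi : x \in verts (H i) by rewrite eH inE mem_cat mem_rev xO orbT.
  have yi : y \in verts (H i) by rewrite eH inE mem_cat yP.
  have := edgeU i x y xi yi nx xy; rewrite eH => /cycle_edgeP.
  case=> -[_ e].
    have [-> ->] := next_cross' uc yP (etrans (mem_rev _ _) xO) e.
    by left; rewrite last_cat rev_cons last_rcons.
  have [-> ->] := next_cross uc yP nx e.
  by right; split=> //; case/lastP: (us i :: Os i) => // s z; rewrite rev_rcons last_rcons.
Qed.

Lemma inj_family (A : {set G}) x : n <= #|A| -> x \in A ->
  exists us : 'I_n -> G, [/\ injective us, forall i, us i \in A & exists i, us i = x].
Proof.
move=> nA xA; pose s := x :: enum (A :\ x).
have us : uniq s by rewrite /= mem_enum !inE eqxx enum_uniq.
have ss : n <= size s by rewrite /= -cardE (leq_trans nA) // (cardsD1 x A) xA.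
exists (fun i => nth x s i); split.
- move=> i j /eqP; rewrite nth_uniq // ?(leq_trans (ltn_ord _)) // => /eqP.
  exact: val_inj.
- move=> i; have := mem_nth x (leq_trans (ltn_ord i) ss).
  by rewrite inE mem_enum !inE => /orP[/eqP -> //|/andP[]].
- by exists (Ordinal n0).
Qed.

(** Prescribe [z] as the first vertex of an arc for the path [x y]. Its edge to [y] makes it the
    last vertex too, so the cycle would have length 3. *)
Lemma branch_triangle x y z : adj x y -> adj y z -> adj x z -> False.
Proof.
move=> xy yz xz.
have neq a b : adj a b -> a != b by apply: contraTneq => ->; rewrite adj_irr.
have zA : z \in Lk x :\: verts (path_subgraph x [:: y]).
  by rewrite !inE xz andbT negb_or (eq_sym z x) neq //= (eq_sym z) neq.
have nA : n <= #|Lk x :\: verts (path_subgraph x [:: y])|.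
  have := hG.1 x; rewrite (cardsD1 y) inE xy ltnS => h; apply: leq_trans h _.
  apply/subset_leq_card/fintype.subsetP => t; rewrite !inE => /andP[ty xt].
  by rewrite (negbTE ty) xt orbF andbT eq_sym neq.
have [us [ius hus [i ei]]] := inj_family nA zA.
have [||||Os [hO _]] := branch_outer (u := x) (p := [:: y]) _ _ _ _ ius hus.
- by rewrite /= xy.
- by rewrite /= inE neq.
- by left.
- exact: induced_edge.
have [[uO _ hs hl] [hh ne]] := hO i.
case: (Os i) uO hs hl hh ne => // o O uO hs hl; rewrite /= ei => oz _.
case: (hl z y); rewrite ?inE ?oz ?eqxx ?orbT // 1?adj_sym // => -[].
  by move=> yx; rewrite yx adj_irr in xy.
move=> _ /=; case: O uO hs {hl} => [|o2 O] uO hs // ez.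
have : z \in o2 :: O by rewrite ez /= mem_last.
by move: uO; rewrite cat_uniq oz /= => /and3P[_ _ /andP[/negP]].
Qed.

(** The same with the path [x y z], which is induced because there are no triangles: [t] would be a
    whole arc and the cycle would have length 4. *)
Lemma branch_square x y z t : x != z -> adj x y -> adj y z -> adj z t -> adj t x -> y = t.
Proof.
move=> xz xy yz zt tx; apply/eqP; apply: contraT => yt.
have neq a b : adj a b -> a != b by apply: contraTneq => ->; rewrite adj_irr.
have nxz : ~~ adj x z by apply/negP => h; exact: (branch_triangle xy yz h).
have tA : t \in Lk x :\: verts (path_subgraph x [:: y; z]).
  by rewrite !inE adj_sym tx andbT !negb_or neq // (eq_sym t y) yt (eq_sym t z) neq.
have nA : n <= #|Lk x :\: verts (path_subgraph x [:: y; z])|.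
  have := hG.1 x; rewrite (cardsD1 y) inE xy ltnS => h; apply: leq_trans h _.
  apply/subset_leq_card/fintype.subsetP => s; rewrite !inE => /andP[sy xs].
  rewrite (negbTE sy) xs orFb andbT negb_or eq_sym neq //=.
  by apply: contraNneq nxz => <-.
have [us [ius hus [i ei]]] := inj_family nA tA.
have [||||Os [hO _]] := branch_outer (u := x) (p := [:: y; z]) _ _ _ _ ius hus.
- by rewrite /= xy yz.
- by rewrite /= !inE negb_or (neq _ _ _ xy) (neq _ _ _ yz) xz.
- by right.
- exact: induced_path2.
have [[uO _ hs hl] [hh ne]] := hO i.
case: (Os i) uO hs hl hh ne => // o O uO hs hl; rewrite /= ei => oz _.
case: (hl t z); rewrite ?inE ?oz ?eqxx ?orbT // 1?adj_sym // => -[].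
  by move=> zx; rewrite zx eqxx in xz.
move=> _ /=; case: O uO hs {hl} => [|o2 O] uO hs // ez.
have : t \in o2 :: O by rewrite ez /= mem_last.
by move: uO; rewrite cat_uniq oz /= => /and3P[_ _ /andP[/negP]].
Qed.

Lemma branch_girth : girth_ge5 G.
Proof.
split; first exact: branch_triangle.
by move=> x y z t xz /eqP yt xy yz zt tx; apply: yt; exact: branch_square xy yz zt tx.
Qed.

End Branching.

(** * The layered tree of chambers *)

Section RoundTree.
Variables (G : sgraph) (n m : nat).
Hypotheses (n0 : 0 < n) (hG : branching G n m).
Ltac slia := first [change (Equality.sort (vertex G)) with (Finite.sort (vertex G)) in *; lia | lia].

Local Notation T := (seq ('I_n * nat)).
(* A state [(cs, (u, p))] is the chamber [gof cs] together with the path [u :: p]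
   of its mirrors which lie on earlier layers or on the two neighbouring chambers
   of the same layer; [u] is the mirror shared with the left neighbour and
   [last u p] the one shared with the right neighbour. *)
Local Notation state := ((seq (seq G)) * (G * seq G))%type.
Implicit Types (s : state) (u v : G) (w : seq (ordinal n)) (p O : seq G) (pi : T).

Let symG : symmetric (@adj G) := @adj_sym G.
Let g5 : girth_ge5 G := branch_girth n0 hG.

(** The letters by which the chamber is entered: both vertices of the path at a corner, the middle
    one at a side. *)
Definition core u p := if p is [:: w; v] then [:: w] else u :: p.

Definition good_state s := let: (cs, (u, p)) := s in
  [/\ size p = 1 \/ size p = 2, uniq (u :: p), path (@adj G) u p, foata (@adj G) cs &
      if cs is c :: _ then c = core u p else True].

(** The second chamber lies to the right of the first, across the mirror [last u p]; the last edge
    of the left path, reversed, is the first edge of the right one. *)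
Definition link s s' := let: (cs, (u, p)) := s in let: (cs', (u', p')) := s' in
  [/\ u' = last u p, head u' p' = nth u (u :: p) (size p).-1 &
      gof cs' = (gof cs * gen (last u p))%g].

(** Even [a] is the chamber across the side [E 1], odd [a] the one across the corner of [E 1] and
    [E 2], from left to right. A corner path starts at its left mirror and thus runs against the
    arc. An arc with [r] vertices has [r] sides and [r - 1] corners, which gives the range of
    [a]. *)
Definition child s O (a : nat) : state := let: (cs, (u, p)) := s in
  let E k := nth u (u :: rcons O (last u p)) (a./2 + k) in
  let: (u', p') := if odd a then (E 2, [:: E 1]) else (E 0, [:: E 1; E 2]) in
  (core u' p' :: cs, (u', p')).

Definition good_outer s O := outer m s.2.1 s.2.2 O /\ O != [::].

(** The path has two or three vertices: it leaves at most [m - 2] outer sides, hence at most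
    [2m - 5] children, and at least two outer sides. *)
Lemma good_outer_size s O : good_state s -> good_outer s O ->
  2 <= size O /\ (size O).*2.-1 <= 3 * m - 7.
Proof.
case: s => cs [u p] [sp _ _ _ _] [[_ _ /= h _] _].
by case: sp => sp; rewrite sp in h; split; lia.
Qed.

Lemma half_bound a r : a < r.*2.-1 -> a./2 + 2 < r.+2.
Proof. by lia. Qed.

Lemma odd_half_bound a r : odd a -> a < r.*2.-1 -> a./2 + 2 < r.+1.
Proof. by lia. Qed.

Lemma nth_inner u v O k : 0 < k -> k < (size O).+1 -> nth u (u :: rcons O v) k \in O.
Proof. by case: k => // k _ h; rewrite /= nth_rcons (_ : k < size O) // mem_nth. Qed.

Lemma core_child_sub s O a x : a < (size O).*2.-1 -> x \in head [::] (child s O a).1 -> x \in O.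
Proof.
case: s => cs [u p] la; have lb := half_bound la.
rewrite /child; case: ifP => oa /=; rewrite !inE.
  have lo := odd_half_bound oa la.
  by move=> /orP[] /eqP ->; apply: nth_inner; clear -lo; slia.
by move=> /eqP ->; apply: nth_inner; clear -lb; slia.
Qed.

Lemma outer_uniqE u p O : size p = 1 \/ size p = 2 -> uniq ((u :: p) ++ O) ->
  uniq (u :: rcons O (last u p)).
Proof.
move=> sp uO.
have vp : last u p \in p by case: sp; case: (p) => // *; rewrite /= mem_last.
move: uO; rewrite cat_uniq /= rcons_uniq mem_rcons inE => /and3P[/andP[up _] hO ->].
have hh x : x \in u :: p -> x \notin O.
  by move=> xp; apply: contra hO => xO; apply/hasP; exists x.
rewrite negb_or hh ?inE ?eqxx // hh ?mem_last // !andbT.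
by apply: contraNneq up => ->.
Qed.

(** The point is the Foata condition. An outer side commuting with both letters of a corner would
    give a triangle; one commuting with the middle letter of a side would be a chord. *)
Lemma good_child s O a : good_state s -> good_outer s O -> a < (size O).*2.-1 ->
  good_state (child s O a).
Proof.
move=> gs go la; have sub := @core_child_sub s O a.
have [r2 _] := good_outer_size gs go.
case: s gs go sub => cs [u p] [sp up pp fo hc] [[/= uO pO szO nO] _] sub.
have {}uO : uniq ((u :: p) ++ O) := uO.
have bl c' : {in c', forall x, x \in O} -> cs != [::] -> blocked (@adj G) c' (core u p).
  move=> hc' _; apply/allP => x xc; have xO := hc' x xc.
  have nx : x \notin u :: p.
    by move: uO; rewrite cat_uniq => /and3P[_ /hasPn h _]; apply: h.
  case: sp up pp nx nO {uO pO szO hc sub} => {}sp.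
    case: p sp => [|y [|//]] //= _; rewrite inE => /andP[uy _] /andP[uy' _] nx nO.
    rewrite nx /= orbF; apply/orP; apply: contrapT => /not_orP[/negP h1 /negP h2].
    rewrite !negbK in h1 h2; exact: (g5.1 x u y).
  case: p sp => [|y [|z [|//]]] //= _; rewrite !inE !negb_or.
  move=> /and3P[/andP[uy uz] yz _] _ /and3P[xu xy xz] nO; rewrite xy /= orbF.
  apply/negP => h; have := nO x y xO; rewrite !inE eqxx orbT => /(_ isT h).
  by case=> -[e _]; [rewrite e eqxx in uy | rewrite e eqxx in yz].
set v := last u p in pO nO *.
pose E k := nth u (u :: rcons O v) k.
have Eadj k : k < (size O).+1 -> adj (E k) (E k.+1).
  by move=> hk; apply: (pathP u pO); rewrite size_rcons.
have uE : uniq (u :: rcons O v) by exact: outer_uniqE uO.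
have Eneq k l : k < (size O).+2 -> l < (size O).+2 -> k != l -> E k != E l.
  by move=> hk hl kl; rewrite /E nth_uniq //= size_rcons.
have lb := half_bound la.
have a01 : adj (E (a./2 + 0)) (E (a./2 + 1)) by rewrite addnS; apply: Eadj; clear -lb; slia.
have a12 : adj (E (a./2 + 1)) (E (a./2 + 2)) by rewrite !addnS; apply: Eadj; clear -lb; slia.
have n01 : E (a./2 + 0) != E (a./2 + 1) by apply: Eneq; clear -lb; slia.
have n12 : E (a./2 + 1) != E (a./2 + 2) by apply: Eneq; clear -lb; slia.
have n02 : E (a./2 + 0) != E (a./2 + 2) by apply: Eneq; clear -lb; slia.
have {}bl c' : {in c', forall x, x \in O} ->
    if cs is c :: _ then blocked (@adj G) c' c else true.
  by case: cs hc bl {fo sub} => // c cs -> bl h; exact: bl.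
move: sub; rewrite /child -/v; move: a01 a12 n01 n12 n02; rewrite /E.
move: (nth _ _ (a./2 + 0)) (nth _ _ (a./2 + 1)) (nth _ _ (a./2 + 2)) => e0 e1 e2.
move=> a01 a12 n01 n12 n02; case: ifP => _ sub; split=> //.
- by left.
- by rewrite /= inE eq_sym n12.
- by rewrite /= symG a12.
- by apply/and3P; split=> //; [rewrite /= symG|apply: bl => x xc; exact: sub].
- by right.
- by rewrite /= !inE negb_or n01 n02 n12.
- by rewrite /= a01 a12.
- by apply/and3P; split=> //; apply: bl => x xc; exact: sub.
Qed.

Lemma same_clique_child s O a b : good_state s -> good_outer s O ->
  a < (size O).*2.-1 -> b < (size O).*2.-1 ->
  same_clique (head [::] (child s O a).1) (head [::] (child s O b).1) -> a = b.
Proof.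
case: s => cs [u p] [sp _ _ _ _] [[/(outer_uniqE sp) uE _ _ _] _] la lb.
have inj k l : k < (size O).+2 -> l < (size O).+2 ->
    nth u (u :: rcons O (last u p)) k = nth u (u :: rcons O (last u p)) l -> k = l.
  by move=> hk hl /eqP; rewrite nth_uniq //= ?size_rcons // => /eqP.
have ha := half_bound la; have hb := half_bound lb.
have key k l : (k <= 2) -> (l <= 2) ->
  nth u (u :: rcons O (last u p)) (a./2 + k) == nth u (u :: rcons O (last u p)) (b./2 + l) ->
  a./2 + k = b./2 + l.
  by move=> hk hl /eqP; apply: inj; clear -ha hb hk hl; slia.
have keya : nth u (u :: rcons O (last u p)) (a./2 + 1) = nth u (u :: rcons O (last u p)) (a./2 + 2) -> False.
  by move/inj => h; have : a./2 + 1 = a./2 + 2; [apply: h; clear -ha; slia|clear; slia].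
have keyb : nth u (u :: rcons O (last u p)) (b./2 + 1) = nth u (u :: rcons O (last u p)) (b./2 + 2) -> False.
  by move/inj => h; have : b./2 + 1 = b./2 + 2; [apply: h; clear -hb; slia|clear; slia].
rewrite /child /same_clique; case: ifP => oa; case: ifP => ob /=; rewrite !inE !andbT.
- case/andP=> /andP[/orP[] /(key _ _) e1 /orP[] /(key _ _) e2] _.
  + have := e1 isT isT; clear -oa ob; slia.
  + have := e1 isT isT; clear -oa ob; slia.
  + have := e1 isT isT; have := e2 isT isT; clear; slia.
  + have := e2 isT isT; clear -oa ob; slia.
- by case/and3P=> _ /eqP e1 /eqP e2; case: keyb; rewrite e1 e2.
- by case/andP=> /andP[/eqP e1 /eqP e2] _; case: keya; rewrite e1 e2.
- by case/andP=> /(key _ _) e1 _; have := e1 isT isT; clear -oa ob; slia.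
Qed.

Lemma gof_cons c cs : gof (c :: cs) = (gof cs * el (rev c))%g :> racg G.
Proof. by rewrite -cat1s gof_cat; congr (_ * _)%g; rewrite /gof /= cats0. Qed.

Lemma child_link s O a : good_state s -> good_outer s O -> a.+1 < (size O).*2.-1 ->
  link (child s O a) (child s O a.+1).
Proof.
case: s => cs [u p] [sp up pp fo hc] [[uO pO _ _] _] la.
have Eadj k : k < (size O).+1 -> adj (nth u (u :: rcons O (last u p)) k)
   (nth u (u :: rcons O (last u p)) k.+1).
  by move=> hk; apply: (pathP u pO); rewrite size_rcons.
rewrite /child [odd a.+1]/=; case: ifP => oa /=.
  have -> : uphalf a = (a./2).+1 by clear -oa; slia.
  have -> : (a./2).+1 + 0 = a./2 + 1 by rewrite addn0 addn1.
  have -> : (a./2).+1 + 1 = a./2 + 2 by rewrite addSnnS.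
  split=> //.
  rewrite !gof_cons /= /rev /= !el_cons el_nil !mulg1 -!mulgA; congr (_ * _)%g.
  have e : adj (nth u (u :: rcons O (last u p)) (a./2 + 1)) (nth u (u :: rcons O (last u p)) (a./2 + 2)).
    by have := Eadj (a./2 + 1); rewrite -addnS; apply; have := half_bound (ltnW la); clear; slia.
  by rewrite -[in RHS](genC e) mulgA gen2 mul1g.
have -> : uphalf a = a./2 by clear -oa; slia.
split=> //.
rewrite !gof_cons /= /rev /= !el_cons el_nil !mulg1 -!mulgA; congr (_ * _)%g.
Qed.

(** Both arcs have the same vertex next to the shared mirror. It commutes with this mirror, so the
    two can be crossed in either order. *)
Lemma child_link_next s s' O O' : good_state s -> good_outer s O ->
  good_state s' -> good_outer s' O' -> link s s' -> last s.2.1 O = head s.2.1 O' ->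
  link (child s O (size O).*2.-2) (child s' O' 0).
Proof.
move=> gs go gs' go'; have [r2 _] := good_outer_size gs go; have [r2' _] := good_outer_size gs' go'.
case: s gs go => cs [u p] [sp up pp fo hc] [[uO pO _ _] nO].
case: s' gs' go' => cs' [u' p'] [sp' up' pp' fo' hc'] [[uO' pO' _ _] nO'].
case=> eu ep eg /= eO.
have oe : odd (size O).*2.-2 = false by clear -r2; slia.
have eh : (size O).*2.-2./2 = (size O).-1 by clear -r2; slia.
case: O' {uO' pO' r2'} nO' eO => // o' O' _ /= eO.
rewrite /child oe eh addn0 /=.
have e1 : nth u (u :: rcons O (last u p)) ((size O).-1 + 1) = o'.
  have -> : (size O).-1 + 1 = size O by clear -r2; slia.
  by rewrite -rcons_cons nth_rcons /= ltnSn -last_nth.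
have e2 : nth u (u :: rcons O (last u p)) ((size O).-1 + 2) = last u p.
  have -> : (size O).-1 + 2 = (size O).+1 by clear -r2; slia.
  by rewrite /= nth_rcons ltnn eqxx.
rewrite e1 e2; split=> //=.
rewrite !gof_cons eg /= /rev /= !el_cons el_nil !mulg1 -!mulgA; congr (_ * _)%g.
by apply: genC; move: pO; rewrite rcons_path eO symG => /andP[_].
Qed.

Lemma good_induced s : good_state s -> Defs.induced (path_subgraph s.2.1 s.2.2).
Proof.
case: s => cs [u p] [sp _ pp _ _] /=; case: p sp pp => [|w [|v [|? ?]]] /=; try by case.
  by move=> _ _; exact: induced_edge.
move=> _ /and3P[uw wv _]; apply: induced_path2.
apply/negP => uv; exact: (g5.1 u w v).
Qed.

Definition link_rel (st : T -> state) : rel T := fun pi pi' => `[< link (st pi) (st pi') >].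

Definition good_family (L : seq T) (st : T -> state) (O : 'I_n -> T -> seq G) :=
  [/\ forall i pi, pi \in L -> good_outer (st pi) (O i pi),
      forall pi i j x, pi \in L -> x \in O i pi -> x \in O j pi -> i = j &
      forall i, sorted (fun pi pi' => last (st pi).2.1 (O i pi) == head (st pi).2.1 (O i pi')) L].

(** The last vertices of the arcs at one chamber are distinct neighbours of the mirror shared with
    the next chamber, where they are prescribed as first vertices. *)
Lemma good_family_path pi L st (us : 'I_n -> G) : uniq (pi :: L) ->
  (forall pi', pi' \in pi :: L -> good_state (st pi')) -> path (link_rel st) pi L ->
  injective us ->
  (forall i, us i \in Lk (st pi).2.1 :\: verts (path_subgraph (st pi).2.1 (st pi).2.2)) ->
  exists F : 'I_n -> T -> seq G, good_family (pi :: L) st F /\ forall i x, head x (F i pi) = us i.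
Proof.
elim: L pi us => [|pi' L ih] pi us uL gL pL ius hus.
all: have gp := gL pi (mem_head _ _).
all: have [sp up pp] : [/\ size (st pi).2.2 = 1 \/ size (st pi).2.2 = 2,
   uniq ((st pi).2.1 :: (st pi).2.2) & path (@adj G) (st pi).2.1 (st pi).2.2]
  by move: gp; case: (st pi) => cs [u p] [].
all: have [Os [hO dO]] := branch_outer hG pp up sp (good_induced gp) ius hus.
all: have hh i x : head x (Os i) = us i by have [_ [<- ]] := hO i; case: (Os i).
  exists (fun i _ => Os i); split=> //; split=> //.
    by move=> i pi'; rewrite inE => /eqP ->; have [h1 [_ h2]] := hO i.
  by move=> pi' i j x _; exact: dO.
pose us' i := last (st pi).2.1 (Os i).
have lin i : us' i \in Os i by rewrite /us'; have [_ [_]] := hO i; case: (Os i) => // o O _; rewrite /= mem_last.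
have ius' : injective us' by move=> i j e; apply: (dO i j (us' i)) => //; rewrite e.
have gp' : good_state (st pi') by apply: gL; rewrite !inE eqxx orbT.
move: (pL) => /= /andP[/asboolP lk pL'].
(* The first edge of the next path lies on the old path, which the arc avoids; meeting the third
   vertex would close a triangle. *)
have hus' i : us' i \in Lk (st pi').2.1 :\: verts (path_subgraph (st pi').2.1 (st pi').2.2).
  have [[uO pO _ _] _] := hO i.
  have nl : us' i \notin (st pi).2.1 :: (st pi).2.2.
    by move: uO; rewrite cat_uniq => /and3P[_ /hasPn h _]; apply: h.
  have al : adj (us' i) (last (st pi).2.1 (st pi).2.2).
    by move: pO; rewrite rcons_path => /andP[].
  move: lk gp' nl al sp pp; case: (st pi) => cs [u p]; case: (st pi') => cs' [u' p'] /=.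
  case=> -> hp' _ [sp' _ pp' _ _] nl al sp pp; rewrite !inE adj_sym al andbT.
  have lp : last u p \in u :: p by exact: mem_last.
  rewrite negb_or; apply/andP; split; first by apply: contraNneq nl => ->.
  have qp : nth u (u :: p) (size p).-1 \in u :: p by apply: mem_nth => /=; clear; slia.
  case: p' sp' hp' pp' => [|q p'] sp' /= hq; first by case: sp'.
  case/andP=> _; rewrite inE negb_or hq; move: qp; set q' := nth _ _ _ => qp pp'.
  apply/andP; split; first by apply: contraNneq nl => ->.
  have aq : adj q' (last u p).
    rewrite /q'; move: pp sp; case: (p) => [_ []//|x [|y [|? ?]]] /=; last by move=> _ [].
      by case/andP.
    by case/and3P.
  case: p' {hq} pp' sp' => // z [|? ?] /=; last by move=> _ [].
  move=> /andP[qz _] _; rewrite inE; apply/negP => /eqP e.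
  by apply: (g5.1 q' z (last u p)); rewrite // -e.
have uL' : uniq (pi' :: L) by move: uL => /= /andP[].
have [|O' [[h1 h2 h3] h4]] := ih pi' us' uL' _ pL' ius' hus'.
  by move=> x xL; apply: gL; rewrite inE xL orbT.
pose O i rho := if rho == pi then Os i else O' i rho.
have ne rho : rho \in pi' :: L -> rho == pi = false.
  by move=> hr; apply/negP => /eqP e; move: uL => /= /andP[/negP]; rewrite -e.
have npi' : pi' == pi = false by apply: ne; exact: mem_head.
exists O; split; last by move=> i x; rewrite /O eqxx.
split.
- move=> i rho; rewrite inE /O => /orP[/eqP ->|hr]; last by rewrite ne //; exact: h1.
  by rewrite eqxx; have [q1 [_ q2]] := hO i.
- move=> rho i j x; rewrite inE /O => /orP[/eqP ->|hr]; last by rewrite ne //; exact: h2.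
  by rewrite eqxx; exact: dO.
- move=> i; have hs := h3 i.
  have sub : all [pred rho | rho != pi] (pi' :: L) by apply/allP => rho hr; rewrite inE ne.
  rewrite [sorted _ _]/=; apply/andP; split.
    by rewrite /O eqxx npi' h4 eqxx.
  apply: etrans hs; apply: (eq_in_path _ sub) => x y; rewrite !inE /O.
  by move=> /negbTE -> /negbTE ->.
Qed.

(** In the absence of triangles the only neighbour of [u] on the path is the second vertex, and the
    valence is at least [n + 1]. *)
Lemma card_free s : good_state s -> n <= #|Lk s.2.1 :\: verts (path_subgraph s.2.1 s.2.2)|.
Proof.
case: s => cs [u p] [sp _ pp _ _] /=.
have [y yp ay] : exists2 y, [\/ p = [:: y] | exists z, p = [:: y; z] /\ adj y z] & adj u y.
  case: p sp pp => [|y [|z [|? ?]]] /=; try by case.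
    by move=> _ /andP[uy _]; exists y => //; left.
  by move=> _ /and3P[uy yz _]; exists y => //; right; exists z.
have := hG.1 u; rewrite (cardsD1 y) inE ay ltnS => h; apply: leq_trans h _.
apply/subset_leq_card/fintype.subsetP => t; rewrite !inE => /andP[ty ut].
have tu : t == u = false by apply/negP => /eqP e; rewrite e adj_irr in ut.
case: yp => [->|[z [-> yz]]]; rewrite !inE ut andbT (negbTE ty) tu //=.
by apply/negP => /eqP e; apply: (g5.1 u y z); rewrite // -e.
Qed.

Lemma good_family_ex (L : seq T) st : L != [::] -> uniq L ->
  (forall pi, pi \in L -> good_state (st pi)) -> sorted (link_rel st) L ->
  exists F : 'I_n -> T -> seq G, good_family L st F.
Proof.
case: L => // pi L _ uL gL pL; have gp := gL pi (mem_head _ _).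
have hc := card_free gp.
have [z zA] : exists z, z \in Lk (st pi).2.1 :\: verts (path_subgraph (st pi).2.1 (st pi).2.2).
  by apply/set0Pn; rewrite -card_gt0; exact: leq_trans hc.
have [us [ius hus _]] := inj_family n0 hc zA.
by have [F [h _]] := good_family_path uL gL pL ius hus; exists F.
Qed.

(** The empty arcs are a default; [strip_inv] shows that every strip has a good family. *)
Definition pick_family (L : seq T) st : 'I_n -> T -> seq G :=
  if pselect (exists F : 'I_n -> T -> seq G, good_family L st F) is left h then projT1 (cid h)
  else fun _ _ => [::].

Lemma pick_familyP L st : (exists F : 'I_n -> T -> seq G, good_family L st F) -> good_family L st (pick_family L st).
Proof. by rewrite /pick_family; case: pselect => // h _; case: cid. Qed.

(** * Strips over vertical words *)

Variable st0 : state.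
Hypothesis good0 : good_state st0.

(** The recursion runs over vertical words, latest letter first, since the arcs of all chambers of a
    strip must be chosen together. One family serves all [n] continuations of the strip, which keeps
    their arcs disjoint. A node is the list of its steps, each a direction and a child index. *)
Fixpoint tree (w : seq 'I_n) : seq T * (T -> state) :=
  if w is i :: w' then
    let: (L, st) := tree w' in
    let O := pick_family L st in
    (flatten [seq [seq (i, a) :: pi | a <- iota 0 (size (O i pi)).*2.-1] | pi <- L],
     fun pi => if pi is (j, a) :: pi' then child (st pi') (O j pi') a else st0)
  else ([:: [::]], fun _ => st0).

Definition strip w := (tree w).1.
Definition node_state pi := (tree (unzip1 pi)).2 pi.
Definition outer_side i pi := pick_family (strip (unzip1 pi)) (tree (unzip1 pi)).2 i pi.
Definition arity i pi := (size (outer_side i pi)).*2.-1.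
Definition kids i pi : seq T := [seq (i, a) :: pi | a <- iota 0 (arity i pi)].

Lemma node_state_cons i a pi : node_state ((i, a) :: pi) =
  child (node_state pi) (outer_side i pi) a.
Proof. by rewrite /node_state /outer_side /strip /=; case: (tree _). Qed.

Lemma strip_cons_raw i w : strip (i :: w) =
  flatten [seq [seq (i, a) :: pi |
    a <- iota 0 (size (pick_family (strip w) (tree w).2 i pi)).*2.-1] | pi <- strip w].
Proof. by rewrite /strip /=; case: (tree w). Qed.

Lemma strip_unzip w pi : pi \in strip w -> unzip1 pi = w.
Proof.
elim: w pi => [|i w ih] pi; first by rewrite inE => /eqP ->.
rewrite strip_cons_raw => /flattenP[k /mapP[pi' hp ->] /mapP[a _ ->]] /=.
by rewrite ih.
Qed.

Lemma strip_cons i w : strip (i :: w) = flatten [seq kids i pi | pi <- strip w].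
Proof.
rewrite strip_cons_raw; congr flatten; apply/eq_in_map => pi hp.
by rewrite /kids /arity /outer_side (strip_unzip hp).
Qed.

Lemma strip_consP i w pi' : reflect (exists pi a, [/\ pi' = (i, a) :: pi, pi \in strip w & a < arity i pi])
   (pi' \in strip (i :: w)).
Proof.
rewrite strip_cons; apply: (iffP flattenP).
  case=> k /mapP[pi hp ->] /mapP[a]; rewrite mem_iota => ha ->.
  by exists pi, a.
case=> pi [a [-> hp ha]]; exists (kids i pi); first exact: map_f.
by apply: map_f; rewrite mem_iota.
Qed.

Lemma node_state_strip w pi : pi \in strip w -> node_state pi = (tree w).2 pi.
Proof. by move=> hp; rewrite /node_state (strip_unzip hp). Qed.

Lemma outer_side_strip w i pi : pi \in strip w ->
  outer_side i pi = pick_family (strip w) (tree w).2 i pi.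
Proof. by move=> hp; rewrite /outer_side (strip_unzip hp). Qed.

Lemma kids_uniq i L : uniq L -> uniq (flatten [seq kids i pi | pi <- L]).
Proof.
elim: L => //= pi L ih /andP[nL uL]; rewrite cat_uniq ih // andbT; apply/andP; split.
  by rewrite map_inj_uniq ?iota_uniq // => a b [].
apply/hasPn => x /flattenP[k /mapP[pi' hp ->] /mapP[a _ ->]].
apply/negP => /mapP[b _ [_ e]]; by rewrite -e hp in nL.
Qed.

Lemma link_rel_sorted i L (st := node_state) : good_family L st outer_side -> sorted (link_rel st) L ->
  (forall pi, pi \in L -> good_state (st pi)) ->
  sorted (link_rel st) (flatten [seq kids i pi | pi <- L]).
Proof.
case=> hO _ /(_ i) so; elim: L hO so => //= pi L ih hO so sl gL.
have goi rho : rho \in pi :: L -> good_outer (st rho) (outer_side i rho) by exact: hO.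
have gp := gL pi (mem_head _ _); have [r2 _] := good_outer_size gp (goi pi (mem_head _ _)).
have ea : exists k, arity i pi = k.+1 by exists (arity i pi).-1; rewrite /arity; clear -r2; slia.
have {ea} [k ek] := ea.
have kk : k = (size (outer_side i pi)).*2.-2 by rewrite /arity in ek; clear -r2 ek; slia.
rewrite {1}/kids ek /= cat_path; apply/andP; split.
  rewrite path_map; apply/(pathP 0) => j; rewrite size_iota => hj /=.
  rewrite -[0 :: iota 1 k]/(iota 0 k.+1) !nth_iota ?(leqW hj) // add0n.
  rewrite /relpre /link_rel; apply/asboolP; rewrite /st !node_state_cons add1n.
  by apply: child_link => //; [exact/goi/mem_head|rewrite -/(arity i pi) ek ltnS].
case: L ih hO so sl gL goi => // pi' L ih hO /= /andP[/eqP so1 so2] /andP[/asboolP sl1 sl2] gL goi.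
have hp' : pi' \in [:: pi, pi' & L] by rewrite !inE eqxx orbT.
have := ih _ so2 sl2; rewrite /= {1 3}/kids.
have [r2' _] := good_outer_size (gL _ hp') (goi _ hp').
have ea' : exists k, arity i pi' = k.+1 by exists (arity i pi').-1; rewrite /arity; clear -r2'; slia.
have {ea'} [k' ek'] := ea'.
rewrite ek' /= => -> //; last 2 first.
- by move=> i' rho hr; apply: hO; rewrite inE hr orbT.
- by move=> rho hr; apply: gL; rewrite inE hr orbT.
rewrite andbT last_map /link_rel; apply/asboolP.
have -> : last 0 (iota 1 k) = k by case: (k) => // j; rewrite -nth_last size_iota nth_iota.
rewrite /st !node_state_cons kk; apply: child_link_next => //.
- exact/goi/mem_head.
- exact: gL.
- exact: goi.
Qed.

Lemma eq_sorted_in (L : seq T) (e e' : rel T) : {in L &, e =2 e'} -> sorted e L = sorted e' L.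
Proof. by case: L => //= x L h; apply: (eq_in_path h); apply/allP. Qed.

Lemma good_family_eq L st st' (O O' : 'I_n -> T -> seq G) : (forall pi, pi \in L -> st pi = st' pi) ->
  (forall i pi, pi \in L -> O i pi = O' i pi) -> good_family L st O -> good_family L st' O'.
Proof.
move=> es eO [h1 h2 h3]; split.
- by move=> i pi hp; rewrite -es // -eO //; exact: h1.
- by move=> pi i j x hp; rewrite -!eO //; exact: h2.
- move=> i; rewrite -(eq_sorted_in (e := (fun pi pi' => last (st pi).2.1 (O i pi) == head (st pi).2.1 (O i pi')))) //.
  by move=> x y hx hy; rewrite es // !eO.
Qed.

(** Linked good states permit the choice of arcs, and the arcs make the next strip linked and good;
    hence the joint induction. *)
Lemma strip_inv w : [/\ strip w != [::], uniq (strip w),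
   forall pi, pi \in strip w -> good_state (node_state pi) &
   sorted (link_rel node_state) (strip w)] /\ good_family (strip w) node_state outer_side.
Proof.
have fam w' : strip w' != [::] -> uniq (strip w') ->
    (forall pi, pi \in strip w' -> good_state (node_state pi)) ->
    sorted (link_rel node_state) (strip w') -> good_family (strip w') node_state outer_side.
  move=> h1 h2 h3 h4.
  apply: (@good_family_eq _ (tree w').2 _ (pick_family (strip w') (tree w').2)).
  - by move=> pi hp; rewrite (node_state_strip hp).
  - by move=> i pi hp; rewrite (outer_side_strip i hp).
  - apply/pick_familyP/good_family_ex => //.
      by move=> pi hp; rewrite -(node_state_strip hp); exact: h3.
    rewrite -(eq_sorted_in (e := link_rel node_state)) // => x y hx hy.
    by rewrite /link_rel (node_state_strip hx) (node_state_strip hy).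
elim: w => [|i w [[h1 h2 h3 h4] h5]].
  have h : [/\ strip [::] != [::], uniq (strip [::]),
   forall pi, pi \in strip [::] -> good_state (node_state pi) &
   sorted (link_rel node_state) (strip [::])].
    by split=> // pi; rewrite inE => /eqP ->.
  by split=> //; case: h => *; exact: fam.
have [hO _ _] := h5.
have h : [/\ strip (i :: w) != [::], uniq (strip (i :: w)),
   forall pi, pi \in strip (i :: w) -> good_state (node_state pi) &
   sorted (link_rel node_state) (strip (i :: w))].
  split.
  - case e : (strip w) h1 => [//|pi L] _; have hp : pi \in strip w by rewrite e mem_head.
    have [r2 _] := good_outer_size (h3 _ hp) (hO i _ hp).
    rewrite strip_cons e /= /kids /arity; case: (size _) r2 => [|[|k]] //.
  - by rewrite strip_cons; exact: kids_uniq.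
  - move=> pi' /strip_consP[pi [a [-> hp ha]]]; rewrite node_state_cons.
    by apply: good_child => //; [exact: h3|exact: hO].
  - by rewrite strip_cons; exact: link_rel_sorted.
by split=> //; case: h => *; exact: fam.
Qed.

Definition cliques pi := (node_state pi).1.
Definition valid pi := pi \in strip (unzip1 pi).

Lemma strip_valid w pi : pi \in strip w -> valid pi.
Proof. by move=> hp; rewrite /valid (strip_unzip hp). Qed.

Lemma valid_good pi : valid pi -> good_state (node_state pi).
Proof. by have [[_ _ h _] _] := strip_inv (unzip1 pi); exact: h. Qed.

Lemma valid_outer i pi : valid pi -> good_outer (node_state pi) (outer_side i pi).
Proof. by have [_ [h _ _]] := strip_inv (unzip1 pi); exact: h. Qed.

Lemma valid_cons i a pi : valid ((i, a) :: pi) = valid pi && (a < arity i pi).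
Proof.
apply/idP/andP => [/strip_consP[pi' [a' [[-> ->] hp ha]]]|[hp ha]].
  by split=> //; exact: strip_valid hp.
by apply/strip_consP; exists pi, a.
Qed.

Lemma arity_bound i pi : valid pi -> 2 < arity i pi <= 3 * m - 7.
Proof.
move=> vp; have [] := good_outer_size (valid_good vp) (valid_outer i vp); rewrite /arity.
by clear; slia.
Qed.

Lemma cliques_cons i a pi :
  cliques ((i, a) :: pi) = head [::] (child (node_state pi) (outer_side i pi) a).1 :: cliques pi.
Proof.
rewrite /cliques node_state_cons /child; case: (node_state pi) => cs [u p].
by case: ifP.
Qed.

Lemma cliques_foata pi : valid pi -> foata (@adj G) (cliques pi).
Proof. by move=> /valid_good; rewrite /cliques; case: (node_state pi) => cs [u p] []. Qed.

Lemma clique_outer i a pi x : a < arity i pi ->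
  x \in head [::] (cliques ((i, a) :: pi)) -> x \in outer_side i pi.
Proof. by rewrite cliques_cons => la; exact: core_child_sub. Qed.

Lemma outer_side_disj pi i j x : valid pi -> x \in outer_side i pi -> x \in outer_side j pi -> i = j.
Proof. by have [_ [_ h _]] := strip_inv (unzip1 pi); exact: h. Qed.

Lemma child_clique_disj pi i i' a a' x : valid ((i, a) :: pi) -> valid ((i', a') :: pi) ->
  x \in head [::] (cliques ((i, a) :: pi)) -> x \in head [::] (cliques ((i', a') :: pi)) ->
  i = i'.
Proof.
rewrite !valid_cons => /andP[vp la] /andP[_ la'] h1 h2.
exact: outer_side_disj vp (clique_outer la h1) (clique_outer la' h2).
Qed.

(** By induction the parents agree. Cliques in different directions are disjoint, and within one
    direction the clique determines the child. *)
Lemma cliques_inj pi pi' : valid pi -> valid pi' -> size pi = size pi' ->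
  all2 (@same_clique G) (cliques pi) (cliques pi') -> pi = pi'.
Proof.
elim: pi pi' => [|[i a] pi ih] [|[i' a'] pi'] // v1 v2 /= [es].
rewrite (cliques_cons i a pi) (cliques_cons i' a' pi') /= => /andP[sc al].
have vp : valid pi by move: v1; rewrite valid_cons => /andP[].
have vp' : valid pi' by move: v2; rewrite valid_cons => /andP[].
have epi := ih _ vp vp' es al; subst pi'.
have fo := cliques_foata v1; have [x xc] : exists x, x \in head [::] (cliques ((i, a) :: pi)).
  by move: fo; rewrite cliques_cons /= => /and3P[/clique_ex[x xc] _ _]; exists x.
have ei : i = i'.
  apply: (child_clique_disj v1 v2 xc).
  move: sc xc; rewrite !cliques_cons /= => /andP[/allP h _]; exact: h.
subst i'; congr ((_, _) :: _).
move: v1 v2; rewrite !valid_cons => /andP[_ la] /andP[_ la'].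
exact: same_clique_child (valid_good vp) (valid_outer i vp) la la' sc.
Qed.

Lemma strip_near w :
  sorted (fun pi pi' => dn (gof (cliques pi)) (gof (cliques pi')) <= 1) (strip w).
Proof.
have [[_ _ _ h] _] := strip_inv w; apply: sub_sorted h => pi pi' /asboolP.
rewrite /link /cliques; case: (node_state pi) => cs [u p]; case: (node_state pi') => cs' [u' p'] /=.
case=> _ _ ->; rewrite /dn mulKg.
have := len_el_le [:: last u p]; by rewrite el_cons el_nil mulg1.
Qed.

Lemma strip_neq0 w : strip w != [::].
Proof. by have [[]] := strip_inv w. Qed.

Lemma head_strip i w : head [::] (strip (i :: w)) = (i, 0) :: head [::] (strip w).
Proof.
rewrite strip_cons; case e : (strip w) (strip_neq0 w) => [//|pi L] _ /=.
have vp : valid pi by apply: (@strip_valid w); rewrite e mem_head.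
by have := arity_bound i vp; rewrite /kids; case: (arity i pi).
Qed.

Lemma last_strip i w : last [::] (strip (i :: w)) =
  (i, (arity i (last [::] (strip w))).-1) :: last [::] (strip w).
Proof.
rewrite strip_cons; case/lastP e : (strip w) (strip_neq0 w) => [//|L pi] _.
have vp : valid pi by apply: (@strip_valid w); rewrite e mem_rcons mem_head.
rewrite map_rcons flatten_rcons last_cat last_rcons.
have := arity_bound i vp; rewrite /kids; case: (arity i pi) => // k _.
by rewrite /= last_map; congr ((i, _) :: _); case: (k) => // j; rewrite -nth_last size_iota nth_iota.
Qed.

Lemma cliques_cat e pi : exists ec, size ec = size e /\ cliques (e ++ pi) = ec ++ cliques pi.
Proof.
elim: e => [|[i a] e [ec [se h]]]; first by exists [::].
exists (head [::] (cliques ((i, a) :: e ++ pi)) :: ec); split; first by rewrite /= se.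
by rewrite cat_cons [LHS]cliques_cons h cliques_cons.
Qed.

(** These cliques are the first and the last vertex of an arc, and an arc has at least two vertices.
    This separates branches inside one shadow. *)
Lemma extreme_disj i pi x : valid pi ->
  x \in head [::] (cliques ((i, 0) :: pi)) ->
  x \in head [::] (cliques ((i, (arity i pi).-1) :: pi)) -> False.
Proof.
move=> vp; rewrite !cliques_cons; have vo := valid_outer i vp.
have [r2 _] := good_outer_size (valid_good vp) vo.
have [[uO _ _ _] _] := vo; have := outer_uniqE _ uO.
have ea : (arity i pi).-1 = (size (outer_side i pi)).*2.-2 by rewrite /arity; clear -r2; slia.
rewrite ea; move: (valid_good vp); rewrite /child; case: (node_state pi) => cs [u p] [sp _ _ _ _] /=.
move=> /(_ sp) uE; have -> : odd (size (outer_side i pi)).*2.-2 = false by clear -r2; slia.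
have -> : (size (outer_side i pi)).*2.-2./2 = (size (outer_side i pi)).-1 by clear -r2; slia.
rewrite /core /= !inE => /eqP -> /eqP/esym/eqP.
rewrite addn1 prednK; last by clear -r2; slia.
rewrite -[nth u (rcons _ _) 0]/(nth u (u :: rcons (outer_side i pi) (last u p)) 1).
rewrite nth_uniq //= ?size_rcons; try by clear -r2; slia.
Qed.

End RoundTree.

(** * Counting and chains *)

Import Order.TTheory GRing.Theory Num.Theory.
Import numFieldNormedType.Exports.

Section Counting.
Local Open Scope nat_scope.

Lemma card_drop_tuple (A : finType) (N : nat) (v : seq A) : size v <= N ->
  #|[set t : N.-tuple A | drop (N - size v) t == v]| = #|A| ^ (N - size v).
Proof.
move=> le; set k := N - size v.
have sz (u : k.-tuple A) : size (u ++ v) == N by rewrite size_cat size_tuple subnK.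
pose g u : N.-tuple A := Tuple (sz u).
rewrite -(card_tuple k A) -cardsT -(card_imset _ (f := g)).
  congr #|pred_of_set _|; apply/setP => t; rewrite inE; apply/eqP/imsetP.
    move=> e; have st : size (take k t) == k by rewrite size_takel // size_tuple leq_subr.
    by exists (Tuple st) => //; apply: val_inj; rewrite /= -[LHS](cat_take_drop k) e.
  by move=> [u _ ->] /=; rewrite drop_size_cat // size_tuple.
move=> u u' /(congr1 val) /= /eqP; rewrite eqseq_cat ?size_tuple // => /andP[/eqP e _].
exact: val_inj.
Qed.

Definition suffix_free (T : eqType) (L : seq (seq T)) :=
  forall x y, x \in L -> y \in L -> forall j, drop j y = x -> x = y.

Lemma sub_telescope a b c : a <= b -> b <= c -> b - a + (c - b) = c - a.
Proof. lia. Qed.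

(** A word of length [N] has at most one suffix in a suffix-free list. Suffixes appear because nodes
    store the latest step first, so that ancestors are suffixes. *)
Lemma kraft (A : finType) (N : nat) (L : seq (seq A)) : uniq L -> suffix_free L ->
  (forall x, x \in L -> size x <= N) ->
  \sum_(x <- L) #|A| ^ (N - size x) <= #|A| ^ N.
Proof.
move=> uL sf sL.
have -> : \sum_(x <- L) #|A| ^ (N - size x) =
    \sum_(x <- L) \sum_(t : N.-tuple A) (drop (N - size x) t == x :> seq A).
  apply: eq_big_seq => x /sL le; rewrite -card_drop_tuple // -sum1dep_card.
  by rewrite big_mkcond; apply: eq_bigr => t _; case: ifP.
rewrite exchange_big /= -[#|A| ^ N](card_tuple N A) -sum1_card; apply: leq_sum => t _.
case: (boolP (has (fun x => drop (N - size x) t == x :> seq A) L)) => [/hasP[x xL /eqP ex]|hn].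
  rewrite (bigD1_seq x) //= ex eqxx big_seq_cond big1 // => y /andP[yL yx].
  apply/eqP; rewrite eqb0; apply: contra yx => /eqP ey; apply/eqP.
  have [le|le] := leqP (size x) (size y).
    have : drop (size y - size x) (drop (N - size y) t) = x.
      by rewrite drop_drop; apply: etrans ex; congr (drop _ _); apply: sub_telescope; rewrite ?le ?(ltnW le) ?sL.
    by rewrite ey => /(sf x y xL yL).
  have : drop (size x - size y) (drop (N - size x) t) = y.
    by rewrite drop_drop; apply: etrans ey; congr (drop _ _); apply: sub_telescope; rewrite ?le ?(ltnW le) ?sL.
  by rewrite ex => /(sf y x yL xL).
by rewrite big1_seq // => x /= xL; apply/eqP; rewrite eqb0; move/hasPn: hn => /(_ _ xL).
Qed.

Lemma last_occurrence (Y : Type) (e : rel Y) (P : pred Y) x s : P x -> path e x s ->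
  exists z s', [/\ P z, last z s' = last x s, path e z s' & all (predC P) s'].
Proof.
move=> Px; elim/last_ind: s => [|s y ih] ps; first by exists x, [::].
move: ps; rewrite rcons_path => /andP[/ih[z [s' [Pz e1 ps' al]]] ey].
case: (boolP (P y)) => Py; first by exists y, [::]; rewrite last_rcons.
exists z, (rcons s' y); rewrite !last_rcons rcons_path ps' e1 ey all_rcons al.
by rewrite /= Py.
Qed.

End Counting.

(** * Chains of sets and quasisymmetric ratios *)

Section Metric.
Variable R : realType.
Local Open Scope classical_set_scope.
Local Open Scope ring_scope.

(** Each set is paid for once: jump from [x] to the last point of the chain in the set of [j], after
    which that set is not met again. *)
Lemma chain_bound (Y : metricType R) (J : eqType) (I : seq J) (E : J -> Y -> Prop) (D : J -> R) :
  uniq I -> (forall j, j \in I -> 0 <= D j) ->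
  (forall j y y', j \in I -> E j y -> E j y' -> mdist y y' <= D j) ->
  forall x s, path (fun y y' => `[< exists j, [/\ j \in I, E j y & E j y'] >]) x s ->
  mdist x (last x s) <= \sum_(j <- I) D j.
Proof.
move: {2}(size I) (leqnn (size I)) => N; elim: N I => [|N ih] I sI uI D0 hD x s ps.
  have -> : I = [::] by apply: size0nil; apply/eqP; rewrite -leqn0.
  move: ps sI; rewrite leqn0 => ps /eqP/size0nil eI.
  case: s ps => [|y s] /=; first by rewrite mdistxx big_nil.
  by rewrite eI => /andP[/asboolP[j []]].
case: s ps => [|y s] ps.
  rewrite /= mdistxx big_seq_cond; apply: sumr_ge0 => j; rewrite andbT; exact: D0.
have [j [jI jx _]] : exists j, [/\ j \in I, E j x & E j y].
  by move: ps => /= /andP[/asboolP].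
pose P y := `[< E j y >].
have [z [s' [/asboolP Pz ez pz al]]] := last_occurrence (P := P) (asboolT jx) ps.
rewrite (bigD1_seq j) // -ez.
apply: le_trans (metric_triangle x z _) _; apply: lerD; first exact: hD.
rewrite -big_filter; apply: ih.
- by rewrite -ltnS (leq_trans _ sI) // -(count_predC (pred1 j) I) size_filter (count_uniq_mem _ uI) jI.
- exact: filter_uniq.
- by move=> k; rewrite mem_filter => /andP[_]; exact: D0.
- by move=> k y1 y2; rewrite mem_filter => /andP[_]; exact: hD.
elim: s' z al pz {Pz ez} => //= a s' ih' z /andP[na al] /andP[/asboolP[k [kI kz ka]] pa].
apply/andP; split; last exact: ih'.
apply/asboolP; exists k; split=> //; rewrite mem_filter kI andbT.
by apply: contra na => /eqP e; apply/asboolP; rewrite -e.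
Qed.

(** The control function is bounded on [[0, M]] by compactness. Quasisymmetry speaks of three
    distinct points, so [x = y] and [y = w] are treated apart. *)
Lemma qs_bound (Z Y : metricType R) (f : Z -> Y) : quasisymmetry f ->
  forall M : R, exists K : R, 1 <= K /\ forall x y w : Z, x <> w ->
    mdist x y <= M * mdist x w -> mdist (f x) (f y) <= K * mdist (f x) (f w).
Proof.
move=> [[g [_ _ fK _]] [phi [[psi [_ _ _ _ [cphi _]]] hphi]]] M.
have [M0|M0] := leP 0 M; last first.
  exists 1; split=> // x y w xw h; exfalso.
  have d0 : 0 < mdist x w by rewrite mdist_gt0; exact/eqP.
  have := le_trans (mdist_ge0 x y) h; rewrite pmulr_lge0 //; lra.
have cM : {within `[0, M], continuous phi}.
  apply: continuous_subspaceW cphi => t /=; rewrite !in_itv /= andbT => /andP[] //.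
have [c _ hc] := EVT_max M0 cM.
exists (Num.max 1 (phi c)); split; first by rewrite le_max lexx.
move=> x y w xw h.
have d0 : 0 < mdist x w by rewrite mdist_gt0; exact/eqP.
have f0 : 0 < mdist (f x) (f w).
  by rewrite mdist_gt0; apply/eqP => e; apply: xw; rewrite -(fK x) e fK.
have [exy|/eqP nxy] := eqVneq x y.
  by rewrite exy mdistxx mulr_ge0 ?mdist_ge0 // le_max ler01.
have [eyw|/eqP nyw] := eqVneq y w.
  by rewrite eyw ler_peMl ?mdist_ge0 // le_max lexx.
rewrite -ler_pdivrMr //; apply: le_trans (hphi x y w nxy xw nyw) _.
rewrite le_max; apply/orP; right; apply: hc; rewrite in_itv /=.
by rewrite divr_ge0 ?mdist_ge0 //= ler_pdivrMr.
Qed.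

End Metric.

(** * Abstract layered trees *)

Section LayeredTree.
Variables (n : nat).
Local Notation T := (seq ('I_n * nat)).
Local Notation branch := (nat -> 'I_n * nat).
Implicit Types (pi rho : T) (b : branch) (w : seq 'I_n).

Fixpoint bnode b k : T := if k is k'.+1 then b k' :: bnode b k' else [::].

Definition anc k pi : T := drop (size pi - k) pi.

Lemma size_bnode b k : size (bnode b k) = k.
Proof. by elim: k => //= k ->. Qed.

Lemma size_anc k pi : k <= size pi -> size (anc k pi) = k.
Proof. by move=> h; rewrite size_drop subKn. Qed.

Lemma anc_size pi : anc (size pi) pi = pi.
Proof. by rewrite /anc subnn drop0. Qed.

Lemma anc_cat e pi k : k <= size pi -> anc k (e ++ pi) = anc k pi.
Proof.
move=> h; rewrite /anc size_cat drop_cat; case: ltnP => h2; first by lia.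
by congr (drop _ _); lia.
Qed.

Lemma anc_anc j k pi : j <= k -> k <= size pi -> anc j (anc k pi) = anc j pi.
Proof.
move=> jk ks; rewrite -[in RHS](cat_take_drop (size pi - k) pi) anc_cat //.
by rewrite size_drop subKn.
Qed.

Lemma bnode_cat b j k : j <= k -> exists e, bnode b k = e ++ bnode b j.
Proof.
elim: k => [|k ih]; first by rewrite leqn0 => /eqP ->; exists [::].
rewrite leq_eqVlt => /orP[/eqP ->|/ih[e /= ->]]; first by exists [::].
by exists (b k :: e).
Qed.

Lemma anc_bnode b j k : j <= k -> anc j (bnode b k) = bnode b j.
Proof.
by move=> /(bnode_cat b)[e ->]; rewrite anc_cat ?size_bnode // -{1}(size_bnode b j) anc_size.
Qed.

Variables (arity : 'I_n -> T -> nat) (strip : seq 'I_n -> seq T).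

Definition layered (H : nat) := [/\ strip [::] = [:: [::]],
  forall i w, strip (i :: w) = flatten [seq [seq (i, a) :: pi | a <- iota 0 (arity i pi)] | pi <- strip w] &
  forall w i pi, pi \in strip w -> 0 < arity i pi <= H].

Definition tvalid pi := pi \in strip (unzip1 pi).

Definition bvalid b := forall k, tvalid (bnode b k).

Variable H : nat.
Hypothesis lay : layered H.

Lemma lay_unzip w pi : pi \in strip w -> unzip1 pi = w.
Proof.
case: lay => s0 sS _; elim: w pi => [|i w ih] pi; first by rewrite s0 inE => /eqP ->.
by rewrite sS => /flattenP[k /mapP[pi' hp ->] /mapP[a _ ->]] /=; rewrite ih.
Qed.

Lemma lay_valid w pi : pi \in strip w -> tvalid pi.
Proof. by move=> h; rewrite /tvalid (lay_unzip h). Qed.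

Lemma tvalid0 : tvalid [::].
Proof. by case: lay => s0 _ _; rewrite /tvalid s0 inE. Qed.

Lemma tvalid_cons i a pi : tvalid ((i, a) :: pi) = tvalid pi && (a < arity i pi).
Proof.
case: lay => _ sS _; rewrite {1}/tvalid /= sS; apply/flattenP/andP.
  case=> k /mapP[pi' hp ->] /mapP[a']; rewrite mem_iota => ha [-> ->].
  by split=> //; exact: lay_valid hp.
case=> hp ha; exists [seq (i, x) :: pi | x <- iota 0 (arity i pi)]; first exact: map_f.
by apply: map_f; rewrite mem_iota.
Qed.

Lemma tvalid_catr e pi : tvalid (e ++ pi) -> tvalid pi.
Proof. by elim: e => // -[i a] e ih; rewrite cat_cons tvalid_cons => /andP[/ih]. Qed.

Lemma tvalid_anc k pi : tvalid pi -> tvalid (anc k pi).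
Proof. by rewrite -{1}(cat_take_drop (size pi - k) pi); exact: tvalid_catr. Qed.

Lemma tvalid_arity i pi : tvalid pi -> 0 < arity i pi <= H.
Proof. by case: lay => _ _; apply. Qed.

Lemma tvalid_lt x pi : tvalid (x :: pi) -> x.2 < H.
Proof.
case: x => i a; rewrite tvalid_cons => /andP[/(tvalid_arity i)/andP[_ h1] h2].
exact: leq_trans h2 h1.
Qed.

Lemma size_strip w pi : pi \in strip w -> size pi = size w.
Proof. by move=> /lay_unzip <-; rewrite size_map. Qed.

Lemma branch_through (i0 : 'I_n) pi : tvalid pi -> exists2 b, bvalid b &
  bnode b (size pi) = pi /\ forall k, size pi <= k -> b k = (i0, 0).
Proof.
move=> vp; pose b k := if k < size pi then nth (i0, 0) pi (size pi - k.+1) else (i0, 0).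
have hb k : k <= size pi -> bnode b k = anc k pi.
  elim: k => [|k ih] hk; first by rewrite /anc subn0 drop_size.
  rewrite /= ih 1?ltnW // {1}/b hk /anc (drop_nth (i0, 0) (n := size pi - k.+1)); last by lia.
  by congr (_ :: drop _ _); lia.
exists b; last by split; [rewrite hb // anc_size|move=> k hk; rewrite /b ltnNge hk].
elim=> [|k ih]; first exact: tvalid0.
have [lt|ge] := ltnP k (size pi); first by rewrite hb //; exact: tvalid_anc.
rewrite /= {1}/b ltnNge ge /= tvalid_cons ih /=.
by case/andP: (tvalid_arity i0 ih).
Qed.

(** By finite branching, a node with descendants violating [C] at every depth has a child of the
    same kind; following such children gives a branch that never meets [C]. *)
Lemma konig (C : T -> Prop) :
  (forall pi e, tvalid (e ++ pi) -> C pi -> C (e ++ pi)) ->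
  (forall b, bvalid b -> exists k, C (bnode b k)) ->
  exists N, forall pi, tvalid pi -> size pi = N -> C pi.
Proof.
move=> mono hC.
pose bad pi := forall N, exists e, [/\ tvalid (e ++ pi), size e = N & ~ C (e ++ pi)].
have step pi : bad pi -> exists x, bad (x :: pi).
  move=> bp; apply: contrapT => /forallNP nb.
  have hx (x : 'I_n * 'I_H) : exists N, forall e, tvalid (e ++ (x.1, val x.2) :: pi) -> size e = N ->
      C (e ++ (x.1, val x.2) :: pi).
    have /existsNP[N hN] := nb (x.1, val x.2); exists N => e ve se.
    by apply: contrapT => nc; apply: hN; exists e.
  have [Nf hNf] := fin_all_exists hx.
  have [e [ve se nc]] := bp (\max_x Nf x).+1.
  case/lastP: e ve se nc => [//|e [i a]]; rewrite cat_rcons size_rcons => ve [se] nc.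
  have ha := tvalid_lt (tvalid_catr ve); pose x := (i, Ordinal ha).
  have hle : Nf x <= size e by rewrite se; exact: leq_bigmax.
  apply: nc; rewrite -(cat_take_drop (size e - Nf x) e) -catA; apply: mono.
    by rewrite catA cat_take_drop.
  apply: (hNf x); last by rewrite size_drop subKn.
  by apply: (@tvalid_catr (take (size e - Nf x) e)); rewrite catA cat_take_drop.
have [b0|nb] := pselect (bad [::]); last first.
  have /existsNP[N hN] := nb; exists N => pi vp sp; apply: contrapT => nc.
  by apply: hN; exists pi; rewrite cats0.
have /choice[g hg] : forall pi, exists x, bad pi -> bad (x :: pi).
  move=> pi; have [bp|nbp] := pselect (bad pi); first by have [x hx] := step pi bp; exists x.
  have [x _] := step [::] b0; by exists x.
pose s := fix s k := if k is k'.+1 then g (s k') :: s k' else [::].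
pose b k := g (s k).
have sb k : bnode b k = s k by elim: k => //= k ->.
have badb k : bad (bnode b k) by elim: k => // k ih; rewrite sb /=; apply: hg; rewrite -sb.
have nCb k : tvalid (bnode b k) /\ ~ C (bnode b k).
  by have [e [ve /size0nil ee nc]] := badb k 0; rewrite ee in ve nc.
by have [k] := hC b (fun k => (nCb k).1); case: (nCb k).
Qed.

Definition all_nodes N : seq T :=
  flatten [seq flatten [seq strip (val t) | t <- enum {: k.-tuple 'I_n}] | k <- iota 0 N.+1].

Lemma mem_all_nodes N pi : tvalid pi -> size pi <= N -> pi \in all_nodes N.
Proof.
move=> vp sp; apply/flattenP.
exists (flatten [seq strip (val t) | t <- enum {: (size pi).-tuple 'I_n}]).
  apply/mapP; exists (size pi) => //; rewrite mem_iota; lia.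
apply/flattenP; exists (strip (unzip1 pi)) => //.
have su : size (unzip1 pi) == size pi by rewrite size_map.
by apply/mapP; exists (Tuple su) => //; rewrite mem_enum.
Qed.

Lemma all_nodesP N pi : pi \in all_nodes N -> tvalid pi /\ size pi <= N.
Proof.
case/flattenP => s /mapP[k hk ->] /flattenP[s' /mapP[w _ ->]] hp; split; first exact: lay_valid hp.
by rewrite (size_strip hp) size_tuple; rewrite mem_iota in hk; lia.
Qed.

Definition topmost (S : pred T) pi := S pi && all (fun j => ~~ S (drop j.+1 pi)) (iota 0 (size pi)).

Lemma topmost_ex (S : pred T) pi : S pi -> exists2 j, j <= size pi & topmost S (anc j pi).
Proof.
move: {2}(size pi) (leqnn (size pi)) => N; elim: N pi => [|N ih] pi sp Sp.
  by exists (size pi) => //; rewrite anc_size /topmost Sp; move: sp; rewrite leqn0 => /eqP ->.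
have [tp|] := boolP (topmost S pi); first by exists (size pi); rewrite ?anc_size.
rewrite /topmost Sp /= => /allPn[j]; rewrite mem_iota add0n negbK => hj Sd.
have sd : size (drop j.+1 pi) <= N by rewrite size_drop; lia.
have [k hk tk] := ih _ sd Sd; move: hk; rewrite size_drop => hk.
exists k; first by lia.
have -> : anc k pi = anc k (drop j.+1 pi) => //.
have -> : drop j.+1 pi = anc (size pi - j.+1) pi by rewrite /anc; congr drop; lia.
by rewrite anc_anc //; lia.
Qed.

Lemma topmost_suffix_free (S : pred T) pi rho : topmost S pi -> topmost S rho ->
  forall j, drop j rho = pi -> pi = rho.
Proof.
move=> /andP[Sp _] /andP[_ /allP hr] [|j]; first by rewrite drop0.
move=> e; have [lt|ge] := ltnP j (size rho).
  by have := hr j; rewrite mem_iota add0n e Sp => /(_ lt).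
move: e; rewrite drop_oversize ?leqW // => e; case: rho ge hr => [|x r] ge hr; first by rewrite -e.
by have := hr (size r); rewrite mem_iota /= ltnSn drop_size e Sp => /(_ isT).
Qed.

(** Child indices are below [H], so nodes are words over an alphabet of [n * H] letters. *)
Lemma kraft_tree (N : nat) (L : seq T) : uniq L -> suffix_free L ->
  (forall pi, pi \in L -> tvalid pi /\ size pi <= N) ->
  \sum_(pi <- L) (n * H) ^ (N - size pi) <= (n * H) ^ N.
Proof.
move=> uL sf hL; case: (posnP H) => H0.
  have nil pi : tvalid pi -> pi = [::] by case: pi => // x pi /tvalid_lt; rewrite H0.
  have {uL} : L = [::] \/ L = [:: [::]].
    case: L uL hL {sf} => [|x [|y L]] /=; first by left.
      by move=> _ /(_ x); rewrite inE eqxx => /(_ isT)[/nil -> _]; right.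
    move=> /andP[h _] hL; have [v1 _] := hL x (mem_head _ _).
    by have [|v2 _] := hL y; rewrite ?inE ?eqxx ?orbT //; rewrite (nil _ v1) (nil _ v2) !inE eqxx in h.
  by case=> ->; rewrite ?big_nil // big_seq1 subn0.
pose h0 : 'I_H := Ordinal H0.
pose enc (x : 'I_n * nat) : 'I_n * 'I_H := (x.1, insubd h0 x.2).
have encK pi : tvalid pi -> map (fun x => (x.1, val x.2)) (map enc pi) = pi.
  move=> vp; rewrite -map_comp map_id_in // => x xp; rewrite /enc /= val_insubd.
  have -> : x.2 < H by have := xp => /splitPr q; case: q vp => p1 p2 /tvalid_catr /tvalid_lt.
  by case: x {xp}.
have enc_inj : {in L &, injective (map enc)}.
  by move=> x y /hL[vx _] /hL[vy _] e; rewrite -(encK _ vx) e encK.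
have -> : \sum_(pi <- L) (n * H) ^ (N - size pi) =
    \sum_(x <- map (map enc) L) #|{: 'I_n * 'I_H}| ^ (N - size x).
  by rewrite big_map; apply: eq_bigr => pi _; rewrite size_map card_prod !card_ord.
have := @kraft ('I_n * 'I_H)%type N (map (map enc) L).
rewrite card_prod !card_ord; apply.
- by rewrite map_inj_in_uniq.
- move=> _ _ /mapP[x xL ->] /mapP[y yL ->] j; rewrite -map_drop => e; congr map.
  apply: (sf x y xL yL j); have [vx _] := hL _ xL; have [vy _] := hL _ yL.
  rewrite -(encK _ vx) -e encK //; apply: (@tvalid_catr (take j y)); by rewrite cat_take_drop.
- by move=> _ /mapP[x xL ->]; rewrite size_map; case: (hL _ xL).
Qed.

End LayeredTree.

(** * Covers of a quasisymmetric image *)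
Local Open Scope classical_set_scope.
Local Open Scope ring_scope.

(* Either [e] is small compared with [h^-k], or [h^-k < e / d] bounds
   [n^-k = (h^-k)^b]. *)
Lemma weight_dichotomy (R : realType) (n h : R) (b e d : R) (k : nat) :
  0 < h -> 0 <= b -> n = h `^ b -> 0 < e -> 0 < d ->
  n ^- k * e <= d * (n * h) ^- k + d `^ (- b) * e `^ (1 + b).
Proof.
move=> h0 b0 en e0 d0.
have n0 : 0 < n by rewrite en powR_gt0.
have nk0 : 0 < n ^- k by rewrite invr_gt0 exprn_gt0.
have [le|lt] := leP e (d * h ^- k).
  apply: (le_trans (y := d * (n * h) ^- k)); last first.
    by rewrite lerDl mulr_ge0 ?powR_ge0.
  by rewrite exprMn invfM mulrCA ler_pM2l.
apply: (le_trans (y := d `^ (- b) * e `^ (1 + b))); last first.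
  by rewrite lerDr mulr_ge0 ?(ltW d0) // invr_ge0 exprn_ge0 // mulr_ge0 // ltW.
have -> : n ^- k = (h ^- k) `^ b.
  have -> : h ^- k = h `^ (- k%:R) by rewrite powRN powR_mulrn // ltW.
  rewrite -powRrM en -powR_mulrn ?powR_ge0 // -powRrM -powRN.
  by congr (_ `^ _); ring.
rewrite powRD; last by rewrite (gt_eqF e0) implybT.
rewrite powRr1 ?(ltW e0) // mulrCA mulrC ler_pM2l //.
have -> : d `^ (- b) * e `^ b = (e / d) `^ b.
  rewrite powRM ?(ltW e0) ?invr_ge0 ?(ltW d0) // mulrC; congr (_ * _).
  by rewrite -[d^-1]powR_inv1 ?(ltW d0) // -powRrM mulN1r.
apply: ge0_ler_powR => //; rewrite ?nnegrE ?divr_ge0 ?(ltW e0) ?(ltW d0) ?invr_ge0 ?exprn_ge0 ?(ltW h0) //.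
by rewrite ler_pdivlMr // mulrC ltW.
Qed.

Lemma sum_uniq_le (R : realType) (s : seq nat) (F : nat -> R) (M : nat) : uniq s ->
  (forall i, i \in s -> (i < M)%N) -> (forall i, 0 <= F i) ->
  \sum_(i <- s) F i <= \sum_(0 <= i < M) F i.
Proof.
move=> us hs F0; have pe : perm_eq s [seq i <- index_iota 0 M | i \in s].
  apply: uniq_perm => //; first by rewrite filter_uniq // iota_uniq.
  move=> i; rewrite mem_filter mem_index_iota /=.
  by case: (boolP (i \in s)) => //= /hs ->.
rewrite (perm_big _ pe) /= big_filter big_mkcond; apply: ler_sum => i _.
by case: ifP.
Qed.

Section ConfdimTree.
Variables (R : realType) (n H : nat).
Hypotheses (n0 : (0 < n)%N) (H1 : (1 < H)%N).
Local Notation T := (seq ('I_n * nat)).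
Local Notation branch := (nat -> 'I_n * nat).
Implicit Types (pi rho : T) (b : branch) (w : seq 'I_n).
Variables (arity : 'I_n -> T -> nat) (strip : seq 'I_n -> seq T).
Hypothesis lay : layered arity strip H.
Local Notation tvalid := (tvalid strip).
Local Notation bvalid := (bvalid strip).
Variables (Z Y : metricType R) (f : Z -> Y).
Hypothesis hf : quasisymmetry f.
(** [sz] is the size of a shadow and [nb] adjacency along a strip. Both closeness relations stand
    for bounded distance of chambers: [near0] for nodes that have not separated yet, [near1], with a
    larger bound, for what remains after passing to a neighbour and to ancestors. *)
Variables (z : branch -> Z) (sz : T -> R) (near0 near1 : T -> T -> Prop) (nb : rel T).
Variables (K : R) (B : nat).
Hypotheses (K1 : 1 <= K) (sz0 : forall pi, 0 < sz pi).
Hypothesis near1_refl : forall pi, near1 pi pi.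
Hypothesis near_upper : forall b b' k, bvalid b -> bvalid b' ->
  near1 (bnode b k) (bnode b' k) -> mdist (z b) (z b') <= K * sz (bnode b' k).
Hypothesis far_lower : forall b b' k, bvalid b -> bvalid b' ->
  ~ near0 (bnode b' k) (bnode b k) -> sz (bnode b k) <= K * mdist (z b) (z b').
Hypothesis spread : forall pi, tvalid pi -> exists b b', [/\ bvalid b, bvalid b',
  bnode b (size pi) = pi, bnode b' (size pi) = pi & sz pi <= K * mdist (z b) (z b')].
Hypothesis sz_child : forall x pi, tvalid (x :: pi) -> sz pi <= K * sz (x :: pi).
Hypothesis sz_small : forall b (e : R), bvalid b -> 0 < e ->
  exists k0, forall k, (k0 <= k)%N -> sz (bnode b k) < e.
Hypothesis strip_nb : forall w, sorted nb (strip w).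
Hypothesis near_step : forall rho rho' pi k, tvalid rho -> tvalid rho' -> tvalid pi ->
  size rho = size rho' -> rho = rho' \/ nb rho rho' -> (size pi <= size rho)%N ->
  near0 (anc (size pi) rho) pi -> (k <= size pi)%N ->
  near1 (anc k rho') (anc k pi).
Hypothesis near_count : forall pi, tvalid pi ->
  (#|[set v : (size pi).-tuple 'I_n | `[< exists2 rho, rho \in strip v & near1 rho pi >]]%SET| <= B)%N.
Hypothesis wide : forall w b b', w != [::] -> bvalid b -> bvalid b' ->
  bnode b (size w) = head [::] (strip w) -> bnode b' (size w) = last [::] (strip w) ->
  sz [::] <= K * mdist (z b) (z b').

Let K0 : 0 < K. Proof. exact: lt_le_trans K1. Qed.

(** The ratio [K ^+ 3] is what [fdist_compare] needs: [K] from its lower bound on one distance and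
    [K ^+ 2] from its upper bound on the other. *)
Lemma qs_tree : exists2 K2 : R, 1 <= K2 & forall x y t : Z, x <> t ->
  mdist x y <= K ^+ 3 * mdist x t -> mdist (f x) (f y) <= K2 * mdist (f x) (f t).
Proof. by have [K2 [h1 h2]] := qs_bound hf (K ^+ 3); exists K2. Qed.

Lemma spread_choice : exists pq : T -> branch * branch, forall pi, tvalid pi ->
  [/\ bvalid (pq pi).1, bvalid (pq pi).2, bnode (pq pi).1 (size pi) = pi,
      bnode (pq pi).2 (size pi) = pi & sz pi <= K * mdist (z (pq pi).1) (z (pq pi).2)].
Proof.
suff /choice[pq hpq] : forall pi, exists bb : branch * branch, tvalid pi ->
    [/\ bvalid bb.1, bvalid bb.2, bnode bb.1 (size pi) = pi,
        bnode bb.2 (size pi) = pi & sz pi <= K * mdist (z bb.1) (z bb.2)].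
  by exists pq.
move=> pi; have [vp|nv] := pselect (tvalid pi).
  by have [b [b' h]] := spread vp; exists (b, b').
have [b [b' _]] := spread (tvalid0 lay); by exists (b, b').
Qed.

(** * Sizes of shadows in the image *)

Section Fixed.
Variables (K2 : R) (pq : T -> branch * branch).
Hypothesis K21 : 1 <= K2.
Hypothesis qsK2 : forall x y t : Z, x <> t ->
  mdist x y <= K ^+ 3 * mdist x t -> mdist (f x) (f y) <= K2 * mdist (f x) (f t).
Hypothesis pqP : forall pi, tvalid pi ->
  [/\ bvalid (pq pi).1, bvalid (pq pi).2, bnode (pq pi).1 (size pi) = pi,
      bnode (pq pi).2 (size pi) = pi & sz pi <= K * mdist (z (pq pi).1) (z (pq pi).2)].

Definition fdist b b' := mdist (f (z b)) (f (z b')).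
(** The image distance of two branches spread over the shadow; up to constants, the diameter of the
    image of the shadow. *)
Definition fsize pi := fdist (pq pi).1 (pq pi).2.

Let K20 : 0 < K2. Proof. exact: lt_le_trans K21. Qed.

Lemma fdist_compare pi b b' b'' : sz pi <= K * mdist (z b) (z b'') ->
  mdist (z b) (z b') <= K ^+ 2 * sz pi -> fdist b b' <= K2 * fdist b b''.
Proof.
move=> h1 h2; have sp := sz0 pi; apply: qsK2.
  by move=> e; move: h1; rewrite e mdistxx mulr0; lra.
apply: le_trans h2 _; rewrite (exprSr K 2) -mulrA ler_pM2l //; exact: exprn_gt0.
Qed.

Lemma near_fdist pi b : tvalid pi -> bvalid b -> near1 (bnode b (size pi)) pi ->
  fdist (pq pi).1 b <= K2 * fsize pi.
Proof.
move=> vp vb nr; have [v1 v2 e1 e2 hs] := pqP vp.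
apply: (fdist_compare hs); rewrite metric_sym.
have := near_upper (k := size pi) vb v1; rewrite e1 => /(_ nr) h; apply: le_trans h _.
by rewrite ler_pM2r // expr2 ler_peMl // ltW.
Qed.

Lemma same_fdist pi b b' : tvalid pi -> bvalid b -> bvalid b' ->
  near1 (bnode b (size pi)) pi -> near1 (bnode b' (size pi)) pi ->
  fdist b b' <= 2 * K2 * fsize pi.
Proof.
move=> vp vb vb' h h'; apply: le_trans (metric_triangle _ (f (z (pq pi).1)) _) _.
rewrite (mulrC 2) -mulrA mulrDl mul1r mulrDr metric_sym lerD //; exact: near_fdist.
Qed.

Lemma fsize_le pi b : tvalid pi -> fsize pi <= fdist b (pq pi).1 + fdist b (pq pi).2.
Proof.
by move=> vp; apply: le_trans (metric_triangle _ (f (z b)) _) _; rewrite metric_sym.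
Qed.

Lemma sz_K2 pi : K * sz pi <= K ^+ 2 * sz pi.
Proof. by rewrite ler_pM2r // expr2 ler_peMl // ltW. Qed.

Lemma same_node pi b b' k : bvalid b -> bvalid b' -> bnode b k = pi -> bnode b' k = pi ->
  mdist (z b) (z b') <= K * sz pi.
Proof. by move=> vb vb' <- e; rewrite -e; apply: near_upper => //; rewrite e. Qed.

Lemma fsize_le_fdist pi b b' : tvalid pi -> bvalid b -> bnode b (size pi) = pi ->
  sz pi <= K * mdist (z b) (z b') -> fsize pi <= 2 * K2 * fdist b b'.
Proof.
move=> vp vb eb hs; have [v1 v2 e1 e2 _] := pqP vp.
apply: le_trans (fsize_le b vp) _; rewrite -mulrA mulrDl mul1r.
apply: lerD; apply: (fdist_compare hs); apply: le_trans (sz_K2 pi).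
  exact: same_node eb e1.
exact: same_node eb e2.
Qed.

Lemma far_fdist b b' k : bvalid b -> bvalid b' -> ~ near0 (bnode b' k) (bnode b k) ->
  fsize (bnode b k) <= 2 * K2 * fdist b b'.
Proof.
move=> vb vb' nn; apply: fsize_le_fdist => //; first by rewrite size_bnode.
exact: far_lower.
Qed.

Lemma fsize_root w b b' : w != [::] -> bvalid b -> bvalid b' ->
  bnode b (size w) = head [::] (strip w) -> bnode b' (size w) = last [::] (strip w) ->
  fsize [::] <= 2 * K2 * fdist b b'.
Proof.
move=> nw vb vb' h1 h2; apply: fsize_le_fdist => //; first exact: tvalid0 lay.
exact: wide h1 h2.
Qed.

Lemma fsize_child x pi : tvalid (x :: pi) -> fsize pi <= 2 * K2 * fsize (x :: pi).
Proof.
move=> vx; have vp : tvalid pi := tvalid_catr lay (e := [:: x]) vx.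
have [v1 v2 e1 e2 hs] := pqP vx; have [v3 v4 e3 e4 _] := pqP vp.
have e1' : bnode (pq (x :: pi)).1 (size pi) = pi by move: e1 => /= [].
apply: le_trans (fsize_le (pq (x :: pi)).1 vp) _; rewrite -mulrA mulrDl mul1r.
have hle : K * sz pi <= K ^+ 2 * sz (x :: pi) by rewrite expr2 -mulrA ler_pM2l // sz_child.
apply: lerD; apply: (fdist_compare hs); apply: le_trans hle.
  exact: same_node e1' e3.
exact: same_node e1' e4.
Qed.

Lemma fsize_gt0 pi : tvalid pi -> 0 < fsize pi.
Proof.
move=> vp; have [v1 v2 e1 e2 hs] := pqP vp; rewrite mdist_gt0; apply/eqP => e.
have [[g [_ _ fK _]] _] := hf.
have ez : z (pq pi).1 = z (pq pi).2 by rewrite -(fK (z (pq pi).1)) e fK.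
by move: hs; rewrite ez mdistxx mulr0; have := sz0 pi; lra.
Qed.

Lemma fsize_small b (e : R) : bvalid b -> 0 < e -> exists k, fsize (bnode b k) <= e.
Proof.
move=> vb e0; have [[g [cf _ _ _]] _] := hf.
have e2 : 0 < e / 2 by rewrite divr_gt0.
have := cf (z b) (ball (f (z b)) (e / 2)) (nbhsx_ballx _ _ e2).
rewrite -nbhs_ballE => -[d /= d0 hd].
have dK : 0 < d / K by rewrite divr_gt0.
have [k0 hk0] := sz_small vb dK; exists k0.
have vk := vb k0; have [v1 v2 e1 e2' _] := pqP vk; rewrite size_bnode in e1 e2'.
have hb b' : bvalid b' -> bnode b' k0 = bnode b k0 -> fdist b b' <= e / 2.
  move=> vb' eb; have : ball (z b) d (z b').
    rewrite ballEmdist /=; have h := same_node vb vb' erefl eb.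
    by apply: le_lt_trans h _; rewrite mulrC -ltr_pdivlMr //; exact: hk0.
  by move=> /hd /=; rewrite ballEmdist /= => /ltW.
apply: le_trans (fsize_le b vk) _; rewrite (splitr e); apply: lerD; exact: hb.
Qed.

(** Follow [b0] and stop just before [fsize] drops to [2 * K2 * e]. By [far_fdist] the image of a
    branch far from this node is more than [e] away, and the next node bounds its size from
    above. *)
Lemma select_node (e : R) (V : set Y) b0 : bvalid b0 -> V (f (z b0)) -> 0 < e ->
  2 * K2 * e < fsize [::] -> (forall y y', V y -> V y' -> mdist y y' <= e) ->
  exists pi, [/\ tvalid pi, fsize pi <= 2 * K2 * (2 * K2 * e) &
    forall b, bvalid b -> V (f (z b)) -> near0 (bnode b (size pi)) pi].
Proof.
move=> vb0 Vb0 e0 he hV; have K22 : 0 < 2 * K2 by rewrite mulr_gt0.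
have ex : exists k, fsize (bnode b0 k) <= 2 * K2 * e.
  by apply: fsize_small => //; rewrite mulr_gt0.
have [[|j] hk min] := ex_minnP ex; first by move: hk; rewrite leNgt he.
have hj : 2 * K2 * e < fsize (bnode b0 j).
  by rewrite ltNge; apply/negP => /min; rewrite ltnn.
exists (bnode b0 j); split; first exact: vb0.
  by apply: le_trans (fsize_child (vb0 j.+1)) _; rewrite ler_pM2l.
move=> b vb Vb; rewrite size_bnode; apply: contrapT => nn.
have := far_fdist vb0 vb nn; apply/negP; rewrite -ltNge; apply: le_lt_trans hj.
by rewrite ler_pM2l //; exact: hV.
Qed.

Lemma strip_anc w rho k : rho \in strip w -> (k <= size w)%N ->
  anc k rho \in strip (drop (size w - k) w).
Proof.
move=> hr hk; have : anc k rho \in strip (unzip1 (anc k rho)) := tvalid_anc lay k (lay_valid lay hr).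
by rewrite {2}/anc /unzip1 map_drop -/(unzip1 rho) (lay_unzip lay hr) (size_strip lay hr).
Qed.

(** Ancestors on the layer of [pi] lie in the strip of a suffix of the word. At most [B] suffixes
    come near [pi], each with [n ^ (N - size pi)] completions. *)
Lemma count_hit (N : nat) pi : tvalid pi -> (size pi <= N)%N ->
  (#|[set t : N.-tuple 'I_n | `[< exists2 rho, rho \in strip t & near1 (anc (size pi) rho) pi >]]%SET|
    <= B * n ^ (N - size pi))%N.
Proof.
move=> vp sp; set V := [set v : (size pi).-tuple 'I_n | `[< exists2 rho, rho \in strip v & near1 rho pi >]]%SET.
apply: leq_trans (_ : (#|V| * n ^ (N - size pi) <= _)%N); last first.
  by rewrite leq_mul2r near_count ?orbT.
rewrite -sum_nat_const.
have ub (I J : finType) (A : {set I}) (F : I -> {set J}) :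
    (#|(\bigcup_(v in A) F v)%SET| <= \sum_(v in A) #|F v|)%N.
  elim/big_ind2: _ => [|S a S' a' h h'|//]; first by rewrite cards0.
  by rewrite cardsU; apply: leq_trans (leq_subr _ _) _; exact: leq_add.
apply: leq_trans (_ : (#|(\bigcup_(v in V) [set t : N.-tuple 'I_n | drop (N - size pi) t == v :> seq 'I_n])%SET| <= _)%N).
  apply/subset_leq_card/fintype.subsetP => w; rewrite inE => /asboolP[rho hr nr].
  have sd : size (drop (N - size pi) w) == size pi by rewrite size_drop size_tuple subKn.
  apply/bigcupP; exists (Tuple sd); last by rewrite inE.
  rewrite inE; apply/asboolP; exists (anc (size pi) rho) => //=.
  by have := strip_anc hr (k := size pi); rewrite size_tuple; apply.
apply: leq_trans (ub _ _ _ _) _ => /=.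
apply: leq_sum => v _; have := @card_drop_tuple 'I_n N v.
by rewrite size_tuple card_ord => ->.
Qed.

(** Consecutive nodes of the strip are close to a common selected node, so [chain_bound] applies to
    their image points; the two ends of the strip have separated at the root. *)
Lemma chain_sum (N : nat) (L : seq T) (S : pred T) (D : T -> R) w :
  (0 < size w)%N -> size w = N -> uniq L ->
  (forall pi, pi \in L -> [/\ tvalid pi, (size pi <= N)%N & 2 * K2 * fsize pi <= D pi]) ->
  (forall pi, tvalid pi -> (size pi <= N)%N -> topmost S pi -> pi \in L) ->
  (forall rho, tvalid rho -> size rho = N ->
     exists pi, [/\ tvalid pi, S pi, (size pi <= N)%N & near0 (anc (size pi) rho) pi]) ->
  fsize [::] / (2 * K2) <=
    \sum_(pi <- L | `[< exists2 rho, rho \in strip w & near1 (anc (size pi) rho) pi >]) D pi.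
Proof.
move=> w0 sw uL hL topL cov; have K22 : 0 < 2 * K2 by rewrite mulr_gt0.
pose hit pi := `[< exists2 rho, rho \in strip w & near1 (anc (size pi) rho) pi >].
pose x rho := f (z (pq rho).1).
pose E pi y := exists rho, [/\ rho \in strip w, y = x rho & near1 (anc (size pi) rho) pi].
have vw rho : rho \in strip w -> tvalid rho by move=> hr; exact: (lay_valid lay hr).
have szw rho : rho \in strip w -> size rho = N by move=> /(size_strip lay) ->.
have bq rho : rho \in strip w -> bvalid (pq rho).1 /\ bnode (pq rho).1 (size w) = rho.
  by move=> hr; have [? ? e1 _ _] := pqP (vw _ hr); rewrite sw -(szw _ hr).
have step rho rho' : rho \in strip w -> rho' \in strip w -> nb rho rho' ->
    exists pi, [/\ pi \in [seq pi <- L | hit pi], E pi (x rho) & E pi (x rho')].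
  move=> hr hr' hnb; have [p0 [vp0 Sp0 sp0 np0]] := cov rho (vw _ hr) (szw _ hr).
  (* Only topmost selected nodes are suffix-free; by [near_step] both neighbours stay close to the
     topmost ancestor. *)
  have [j hj tj] := topmost_ex Sp0.
  have sj : size (anc j p0) = j by rewrite size_anc.
  have ss : size rho = size rho' by rewrite !szw.
  have sr : (size p0 <= size rho)%N by rewrite (szw _ hr).
  have n1 := near_step (vw _ hr) (vw _ hr) vp0 erefl (or_introl erefl) sr np0 hj.
  have n2 := near_step (vw _ hr) (vw _ hr') vp0 ss (or_intror hnb) sr np0 hj.
  exists (anc j p0); split.
  - rewrite mem_filter topL ?sj ?(leq_trans hj) // ?andbT; last exact: (tvalid_anc lay).
    by apply/asboolP; exists rho; rewrite ?sj.
  - by exists rho; rewrite ?sj.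
  - by exists rho'; rewrite ?sj.
rewrite -big_filter -/(hit).
case ew : (strip w) (strip_nb w) => [|rho0 L'] srt.
  have := lay; case=> s0 sS ha; exfalso.
  elim: (w) ew => [|i w' ih]; first by rewrite s0.
  rewrite sS; case: (strip w') ih (fun pi => ha w' i pi) => [|q Q] ih hq; first by move=> _; exact: ih.
  by have := hq q (mem_head _ _); rewrite /=; case: (arity i q) => [|k] /=.
have pth : path (fun y y' => `[< exists j, [/\ j \in [seq pi <- L | hit pi], E j y & E j y'] >])
    (x rho0) (map x L').
  rewrite path_map; apply: (sub_in_path (P := [in strip w]) (e := nb)) srt.
    by move=> r r' hr hr' /(step _ _ hr hr')[pi hpi]; apply/asboolP; exists pi.
  by rewrite ew; apply/allP.
have := @chain_bound R Y _ [seq pi <- L | hit pi] E D _ _ _ _ _ pth.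
rewrite last_map => cb; apply: le_trans (cb _ _ _); first 1 last.
- exact: filter_uniq.
- move=> pi; rewrite mem_filter => /andP[_ /hL[vp _ h]]; apply: le_trans h.
  by rewrite mulr_ge0 ?(ltW K22) // mdist_ge0.
- move=> pi y y'; rewrite mem_filter => /andP[_ /hL[vp sp h]] [r [hr -> nr]] [r' [hr' -> nr']].
  apply: le_trans h; apply: (same_fdist vp).
  + by case: (bq _ hr).
  + by case: (bq _ hr').
  + by have [_ e1] := bq _ hr; rewrite -(anc_bnode _ (k := size w)) ?sw // -sw e1.
  + by have [_ e1] := bq _ hr'; rewrite -(anc_bnode _ (k := size w)) ?sw // -sw e1.
rewrite ler_pdivrMr // mulrC.
have h0 : rho0 \in strip w by rewrite ew mem_head.
have hl : last rho0 L' \in strip w by rewrite ew mem_last.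
have [v0 e0] := bq _ h0; have [vl el] := bq _ hl.
apply: (fsize_root (w := w)) => //; first by case: (w) w0.
  by rewrite e0 ew.
by rewrite el ew.
Qed.

(** [idx] names the set of the cover from which a selected node arose; its injectivity bounds the
    sum over nodes by the sum over the cover. The factor [n ^ (N - size pi)] of [count_hit], divided
    by the number [n ^ N] of words, is the weight of [pi]. *)
Lemma final_estimate (N : nat) (L : seq T) (S : pred T) (idx : T -> nat) (e : nat -> R) (C b d eps : R) :
  (0 < N)%N -> uniq L -> suffix_free L -> 0 <= C -> 0 <= b -> n%:R = H%:R `^ b -> 0 < d ->
  (forall i, 0 < e i) -> {in L &, injective idx} ->
  (forall M, \sum_(0 <= i < M) e i `^ (1 + b) <= eps) ->
  (forall pi, pi \in L -> [/\ tvalid pi, (size pi <= N)%N & 2 * K2 * fsize pi <= C * e (idx pi)]) ->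
  (forall pi, tvalid pi -> (size pi <= N)%N -> topmost S pi -> pi \in L) ->
  (forall rho, tvalid rho -> size rho = N ->
     exists pi, [/\ tvalid pi, S pi, (size pi <= N)%N & near0 (anc (size pi) rho) pi]) ->
  fsize [::] / (2 * K2) <= B%:R * C * (d + d `^ (- b) * eps).
Proof.
move=> N0 uL sf C0 b0 en d0 ep inj heps hL topL cov.
have nR : (0 : R) < n%:R by rewrite ltr0n.
have HR : (0 : R) < H%:R by rewrite ltr0n ltnW.
set c := fsize [::] / (2 * K2).
have key (t : N.-tuple 'I_n) : c <= \sum_(pi <- L | `[< exists2 rho, rho \in strip t & near1 (anc (size pi) rho) pi >])
     C * e (idx pi).
  by apply: (@chain_sum N L S) => //; rewrite size_tuple.
have : \sum_(t : N.-tuple 'I_n) c <= \sum_(t : N.-tuple 'I_n)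
    \sum_(pi <- L) (`[< exists2 rho, rho \in strip t & near1 (anc (size pi) rho) pi >] : nat)%:R * (C * e (idx pi)).
  apply: ler_sum => t _; apply: le_trans (key t) _; rewrite big_mkcond /=.
  by apply: ler_sum => pi _; case: ifP => _; rewrite ?mul1r ?mul0r.
rewrite sumr_const card_tuple card_ord exchange_big /= => hc.
have hc2 : c *+ n ^ N <= \sum_(pi <- L) (B * n ^ (N - size pi))%:R * (C * e (idx pi)).
  apply: le_trans hc _; rewrite big_seq_cond [leRHS]big_seq_cond; apply: ler_sum => pi /andP[hp _].
  have [vp sp _] := hL _ hp; rewrite -mulr_suml ler_wpM2r //; first by rewrite mulr_ge0 // ltW.
  rewrite -natr_sum ler_nat; apply: leq_trans _ (count_hit vp sp).
  by rewrite -sum1dep_card [leqRHS]big_mkcond; apply: leq_sum => t _; case: asboolP.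
have {hc2} hc3 : c <= \sum_(pi <- L) B%:R * C * (n%:R ^- size pi * e (idx pi)).
  rewrite -(ler_pM2r (x := n%:R ^+ N)) ?exprn_gt0 // mulr_suml -natrX mulr_natr.
  apply: le_trans hc2 _; rewrite big_seq_cond [leRHS]big_seq_cond; apply: ler_sum => pi /andP[hp _].
  have [_ sp _] := hL _ hp; rewrite le_eqVlt; apply/orP; left; apply/eqP.
  rewrite natrM natrX -{2}(subnK sp) natrX exprD.
  have : (n%:R : R) ^+ size pi != 0 by rewrite expf_neq0 // gt_eqF.
  by move=> ?; field.
apply: le_trans hc3 _; rewrite -mulr_sumr ler_wpM2l ?mulr_ge0 ?ler0n //.
apply: (le_trans (y := \sum_(pi <- L) (d * (n%:R * H%:R) ^- size pi + d `^ (- b) * e (idx pi) `^ (1 + b)))).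
  by apply: ler_sum => pi _; exact: weight_dichotomy.
rewrite big_split /= -!mulr_sumr; apply: lerD.
  rewrite -[leRHS]mulr1 ler_pM2l // -natrM.
  have q0 : (0 : R) < (n * H)%:R by rewrite natrM mulr_gt0.
  rewrite -(ler_pM2r (x := (n * H)%:R ^+ N)) ?exprn_gt0 // mul1r mulr_suml.
  have := kraft_tree lay uL sf (fun pi hp => let: And3 h1 h2 _ := hL pi hp in conj h1 h2).
  rewrite -(ler_nat R) natr_sum natrX; apply: le_trans.
  rewrite big_seq_cond [leRHS]big_seq_cond; apply: ler_sum => pi /andP[hp _].
  have [_ sp _] := hL _ hp; rewrite le_eqVlt; apply/orP; left; apply/eqP.
  rewrite natrX -{1}(subnK sp) exprD mulrCA mulVf ?mulr1 // expf_neq0 // gt_eqF //.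
rewrite ler_wpM2l ?powR_ge0 //.
pose M := (\max_(pi <- L) idx pi).+1.
apply: le_trans (heps M); rewrite -(big_map idx xpredT (fun i => e i `^ (1 + b))).
apply: sum_uniq_le.
- by rewrite map_inj_in_uniq.
- by move=> i /mapP[pi hp ->]; rewrite ltnS; exact: leq_bigmax_seq.
- by move=> i; exact: powR_ge0.
Qed.

End Fixed.

Theorem no_small_cover (b : R) : 0 <= b -> n%:R = H%:R `^ b ->
  exists eta eps : R, [/\ 0 < eta, 0 < eps & forall (U : nat -> set Y) (e : nat -> R),
    (forall y, exists i, U i y) -> (forall i, 0 < e i < eta) ->
    (forall i y y', U i y -> U i y' -> mdist y y' <= e i) ->
    (forall M, \sum_(0 <= i < M) e i `^ (1 + b) <= eps) -> False].
Proof.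
move=> b0 en; have [K2 K21 qsK2] := qs_tree; have [pq pqP] := spread_choice.
have K20 : 0 < K2 by exact: lt_le_trans K21.
have K22 : 0 < 2 * K2 by rewrite mulr_gt0.
pose fs := fsize pq; pose c := fs [::] / (2 * K2).
have c0 : 0 < c by rewrite divr_gt0 //; exact: (fsize_gt0 pqP (tvalid0 lay)).
(* One factor [2 * K2] comes from [chain_sum], the other two from [select_node]. *)
pose C := 2 * K2 * (2 * K2 * (2 * K2)); have C0 : 0 < C by rewrite !mulr_gt0.
pose A := (B.+1)%:R * C; have A0 : 0 < A by rewrite mulr_gt0.
(* With this [d] and the following [eps] both terms of [final_estimate] equal [d], and
   [2 * B * C * d] is below [c = 4 * A * d]. *)
pose d := c / (4 * A); have d0 : 0 < d by rewrite divr_gt0 // mulr_gt0.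
pose eps := d / d `^ (- b); have eps0 : 0 < eps by rewrite divr_gt0 // powR_gt0.
(* For [e i < c] the root has size above [2 * K2 * e i], as [select_node] requires. *)
exists c, eps; split=> // U e cU he hU hs.
have e0 i : 0 < e i by case/andP: (he i).
pose ok i := exists2 b0, bvalid b0 & U i (f (z b0)).
have /choice[g hg] : forall i, exists pi, ok i -> [/\ tvalid pi, fs pi <= 2 * K2 * (2 * K2 * e i) &
    forall b, bvalid b -> U i (f (z b)) -> near0 (bnode b (size pi)) pi].
  move=> i; have [[b1 vb1 hb1]|nok] := pselect (ok i); last by exists [::].
  have hei : 2 * K2 * e i < fs [::].
    by rewrite mulrC -ltr_pdivlMr //; case/andP: (he i).
  by have [pi hpi] := select_node K21 qsK2 pqP vb1 hb1 (e0 i) hei (hU i); exists pi.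
pose S pi := `[< exists2 i, ok i & g i = pi >].
pose Cov rho := exists pi, [/\ tvalid pi, S pi, (size pi <= size rho)%N & near0 (anc (size pi) rho) pi].
have mono pi e' : tvalid (e' ++ pi) -> Cov pi -> Cov (e' ++ pi).
  move=> _ [p [vp Sp sp np]]; exists p; rewrite anc_cat // size_cat; split=> //.
  exact: leq_trans sp (leq_addl _ _).
have covb b1 : bvalid b1 -> exists k, Cov (bnode b1 k).
  move=> vb; have [i hi] := cU (f (z b1)).
  have oki : ok i by exists b1.
  have [v1 _ h3] := hg i oki; exists (size (g i)); exists (g i); split=> //.
  - by apply/asboolP; exists i.
  - by rewrite size_bnode.
  - by rewrite anc_bnode //; exact: h3.
have [N0 hN0] := konig lay mono covb.
(* The ends of a strip separate only if its word is nonempty, hence the successor. *)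
pose N := N0.+1.
have cov rho : tvalid rho -> size rho = N ->
     exists pi, [/\ tvalid pi, S pi, (size pi <= N)%N & near0 (anc (size pi) rho) pi].
  case: rho => [//|x rho] vr [sr].
  have := mono _ [:: x] vr (hN0 _ (tvalid_catr lay (e := [:: x]) vr) sr).
  by case=> p [h1 h2 h3 h4]; exists p; rewrite /N -sr.
have /choice[idx hidx] : forall pi, exists i, S pi -> ok i /\ g i = pi.
  move=> pi; case: (boolP (S pi)) => [/asboolP[i h1 h2]|_]; first by exists i.
  by exists 0%N.
pose L := undup [seq pi <- all_nodes strip N | topmost S pi].
have LP pi : pi \in L -> [/\ tvalid pi, (size pi <= N)%N & topmost S pi].
  by rewrite mem_undup mem_filter => /andP[tp /(all_nodesP lay)[]].
have LS pi : pi \in L -> S pi by move=> /LP[_ _ /andP[]].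
suff : fs [::] / (2 * K2) <= B%:R * C * (d + d `^ (- b) * eps).
  apply/negP; rewrite -ltNge -/fs -/c.
  have -> : d `^ (- b) * eps = d by rewrite /eps mulrCA divff ?mulr1 // gt_eqF // powR_gt0.
  have -> : c = A * (4 * d) by rewrite /d; field; rewrite gt_eqF.
  have x0 : 0 < C * (d + d) by rewrite mulr_gt0 // addr_gt0.
  have -> : A * (4 * d) = (B%:R + 1) * 2 * (C * (d + d)) by rewrite /A -natr1; ring.
  have -> : B%:R * C * (d + d) = B%:R * (C * (d + d)) by ring.
  have B0 : (0 : R) <= B%:R by rewrite ler0n.
  by rewrite ltr_pM2r //; lra.
apply: (@final_estimate K2 pq K21 qsK2 pqP N L S idx e C b d eps).
- by [].
- exact: undup_uniq.
- by move=> x y /LP[_ _ tx] /LP[_ _ ty] j; exact: (topmost_suffix_free tx ty).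
- exact: ltW.
- by [].
- by [].
- by [].
- by [].
- by move=> x y /LS/hidx[_ h1] /LS/hidx[_ h2] ei; rewrite -h1 -h2 ei.
- by [].
- move=> pi hp; have [v1 s1 _] := LP _ hp; have [h1 h2] := hidx _ (LS _ hp); split=> //.
  have [_ h3 _] := hg _ h1; rewrite h2 in h3.
  by rewrite /C -[leRHS]mulrA ler_pM2l // -[leRHS]mulrA.
- by move=> pi vp sp tp; rewrite mem_undup mem_filter tp mem_all_nodes.
- exact: cov.
Qed.

End ConfdimTree.

(** * Hausdorff dimension and the visual metric *)

Section HausdorffLower.
Variables (R : realType) (Y : metricType R).

Lemma diam_mdist (A : set Y) (x y : Y) : A x -> A y -> ((mdist x y)%:E <= diam A)%E.
Proof. by move=> Ax Ay; apply: ereal_sup_ubound; right; exists (x, y). Qed.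

Lemma diam_ge0 (A : set Y) : (0 <= diam A)%E.
Proof. by apply: ereal_sup_ubound; left. Qed.

(** A cover may contain sets of diameter 0 while [e] must be positive; each diameter is therefore
    raised to at least [r i], at a total cost of at most [eps / 2]. *)
Lemma hausdorff_dim_ge (s0 : R) :
  (exists eta eps : R, [/\ 0 < eta, 0 < eps & forall (U : nat -> set Y) (e : nat -> R),
    (forall y, exists i, U i y) -> (forall i, 0 < e i < eta) ->
    (forall i y y', U i y -> U i y' -> mdist y y' <= e i) ->
    (forall M, \sum_(0 <= i < M) e i `^ s0 <= eps) -> False]) ->
  (s0%:E <= hausdorff_dim Y)%E.
Proof.
move=> [eta [eps [eta0 eps0 nc]]]; apply: le_ereal_inf_tmp => _ [s [sp hs] <-].
rewrite lee_fin leNgt; apply/negP => ss0.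
(* Scales are kept below 1 so that lowering the exponent from [s0] to [s] can only enlarge the
   powers. *)
pose de := Num.min 1 (eta / 2).
have de0 : 0 < de by rewrite lt_min ltr01 divr_gt0.
have de1 : de <= 1 by rewrite ge_min lexx.
have deta : de < eta by rewrite gt_min; apply/orP; right; rewrite ltr_pdivrMr // ltr_pMr // ltr1n.
have pre : (hausdorff_premeasure s de [set: Y] <= 0)%E.
  by rewrite -hs; apply: ereal_sup_ubound; exists de.
have e20 : 0 < eps / 2 by rewrite divr_gt0.
have : (hausdorff_premeasure s de [set: Y] < (eps / 2)%:E)%E.
  by apply: le_lt_trans pre _; rewrite lte_fin.
move=> /ereal_inf_lt[_ [U [cU dU] <-] sumU].
pose d i := fine (diam (U i)).
have dE i : diam (U i) = (d i)%:E.
  rewrite fineK // ge0_fin_numE ?diam_ge0 //; apply: le_lt_trans (dU i) _; exact: ltry.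
have d0 i : 0 <= d i by rewrite -lee_fin -dE diam_ge0.
have dle i : d i <= de by rewrite -lee_fin -dE.
pose q i : R := eps / 2 * 2^-1 ^+ i.+1.
have q0 i : 0 < q i by rewrite mulr_gt0 // exprn_gt0 // invr_gt0.
pose r i := Num.min de (q i `^ s^-1).
have r0 i : 0 < r i by rewrite lt_min de0 powR_gt0.
pose e i := Num.max (d i) (r i).
have e0 i : 0 < e i by rewrite lt_max r0 orbT.
have ele i : e i <= de by rewrite ge_max dle ge_min lexx.
apply: (nc U e).
- by move=> y; have [i _ hi] := cU y I; exists i.
- by move=> i; rewrite e0 (le_lt_trans (ele i)).
- by move=> i y y' h h'; rewrite le_max -lee_fin -dE diam_mdist.
move=> M.
have hterm i : e i `^ s0 <= d i `^ s + q i.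
  apply: (le_trans (y := e i `^ s)).
    by apply: ger_powR; [rewrite e0 (le_trans (ele i))|exact: ltW].
  have rs : r i `^ s <= q i.
    have -> : q i = (q i `^ s^-1) `^ s by rewrite -powRrM mulVf ?powRr1 ?gt_eqF // ltW.
    apply: ge0_ler_powR; rewrite ?nnegrE ?powR_ge0 ?(ltW sp) ?(ltW (r0 i)) //.
    by rewrite ge_min lexx orbT.
  rewrite /e; case: (leP (d i) (r i)) => _.
    by apply: le_trans rs _; rewrite lerDr powR_ge0.
  by rewrite lerDl ltW.
apply: le_trans (ler_sum _ (fun i _ => hterm i)) _.
rewrite big_split /= (splitr eps); apply: lerD.
  rewrite -lee_fin -sumEFin; apply: le_trans (ltW sumU).
  apply: le_trans (nneseries_lim_ge (m := 0) (P := xpredT) M _); last by move=> i _ _; exact: poweR_ge0.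
  by apply: lee_sum => i _; rewrite dE poweR_EFin.
have -> : \sum_(0 <= i < M) q i = eps / 2 * (1 - 2^-1 ^+ M).
  elim: M => [|M ih]; first by rewrite big_geq // expr0 subrr mulr0.
  by rewrite big_nat_recr //= ih /q exprS; field.
by rewrite ler_piMr ?(ltW e20) // gerBl exprn_ge0 // invr_ge0.
Qed.

End HausdorffLower.

(** * Geodesic rays, boundary products and visual metrics *)

Section RacgBoundary.
Variables (R : realType) (G : sgraph).
Hypothesis g5 : girth_ge5 G.
Local Notation W := (racg G).
Local Notation d := (word_dist R (racg_gens G)).
Local Notation bdry := (gromov_boundary d).
Implicit Types (x y c : nat -> W).

Definition isray x := x 0%N = 1%g /\ forall i j, (i <= j)%N -> dn (x i) (x j) = (j - i)%N.

Lemma isray_len x i : isray x -> len (x i) = i.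
Proof. by case=> x0 h; rewrite -dn1 -x0 h // subn0. Qed.

Lemma isray_geodesic x : isray x -> geodesic_ray d x.
Proof.
case=> _ h i j; rewrite word_distE; case: (leqP i j) => [ij|/ltnW ji].
  by rewrite h // natrB // distrC ger0_norm // subr_ge0 ler_nat.
by rewrite dnC h // natrB // ger0_norm // subr_ge0 ler_nat.
Qed.

Lemma isray_gp x i j : isray x -> (i <= j)%N -> gp (x i) (x j) = i.
Proof.
move=> hx ij; have := gpE (x i) (x j); rewrite !isray_len // hx.2 //; lia.
Qed.

Lemma gp_le_len (g h : W) : (gp g h <= len g)%N.
Proof. have := gpE g h; have := dn_tri g 1%g h; rewrite (dnC g) !dn1; lia. Qed.

Lemma isray_gp_mono x y i j i' j' : isray x -> isray y -> (i <= i')%N -> (j <= j')%N ->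
  (gp (x i) (y j) <= gp (x i') (y j'))%N.
Proof.
have mono x' y' k k' g : isray x' -> (k <= k')%N -> (gp (x' k) g <= gp (x' k') g)%N.
  move=> hx kk; have := gpE (x' k) g; have := gpE (x' k') g.
  have := dn_tri (x' k) (x' k') g; rewrite (dnC (x' k') (x' k)) !isray_len // hx.2 //; lia.
move=> hx hy ii jj; apply: leq_trans (mono _ _ _ _ _ hx ii) _ => //.
by rewrite gpC [leqRHS]gpC; exact: (mono y x).
Qed.

Definition bpoint x (hx : isray x) : bdry :=
  SigSub (mem_set (ex_intro2 _ _ x (isray_geodesic hx) erefl :
     bdry [set c' | geodesic_ray d c' /\ asymptotic d x c'])).

Lemma bpointP x (hx : isray x) c : set_val (bpoint hx) c <-> geodesic_ray d c /\ asymptotic d x c.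
Proof. by []. Qed.

Lemma asymptotic_dn x c : asymptotic d x c <-> exists D, forall i, (dn (x i) (c i) <= D)%N.
Proof.
split=> [[K hK]|[D hD]]; last by exists D%:R => i; rewrite word_distE ler_nat.
exists (Num.truncn K) => i; have := hK i; rewrite word_distE => h.
by rewrite -(natrK (R := R) (dn (x i) (c i))); apply: le_truncn.
Qed.

Lemma asymptotic_sym x c : asymptotic d x c -> asymptotic d c x.
Proof. by rewrite !asymptotic_dn => -[D h]; exists D => i; rewrite dnC. Qed.

Lemma asymptotic_trans x c y : asymptotic d x c -> asymptotic d c y -> asymptotic d x y.
Proof.
rewrite !asymptotic_dn => -[D h] [D' h']; exists (D + D')%N => i.
by apply: leq_trans (dn_tri (c i) _ _) _; exact: leq_add.
Qed.

Lemma asymptotic_refl x : asymptotic d x x.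
Proof. by rewrite asymptotic_dn; exists 0%N => i; rewrite dngg. Qed.

Lemma bpoint_eq x y (hx : isray x) (hy : isray y) :
  bpoint hx = bpoint hy <-> asymptotic d x y.
Proof.
split=> [e|axy].
  have : set_val (bpoint hx) y by rewrite e; apply/bpointP; split; [exact: isray_geodesic|exact: asymptotic_refl].
  by case/bpointP.
apply: val_inj => /=; apply/seteqP; split=> c [gc ac]; split=> //.
  exact: asymptotic_trans (asymptotic_sym axy) ac.
exact: asymptotic_trans axy ac.
Qed.

(** Passing from [x t] to [y t] through far points [x T] and [y T] uses the four-point condition
    twice; the product is at least [t - 2] and the distance at most 4. *)
Lemma unbounded_asymptotic x y : isray x -> isray y ->
  (forall s, exists t, (s < gp (x t) (y t))%N) -> asymptotic d x y.
Proof.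
move=> hx hy hu; rewrite asymptotic_dn; exists 4 => t.
have [T hT] := hu t; have tT : (t <= T)%N.
  by have := gp_le_len (x T) (y T); rewrite isray_len //; lia.
have h1 := gp_hyp g5 (x t) (x T) (y T); have h2 := gp_hyp g5 (x t) (y T) (y t).
rewrite isray_gp // in h1; rewrite (gpC (y T)) isray_gp // in h2.
have := gpE (x t) (y t); rewrite !isray_len //; lia.
Qed.

Lemma asymptotic_unbounded x y : isray x -> isray y -> asymptotic d x y ->
  forall s, exists t, (s < gp (x t) (y t))%N.
Proof.
move=> hx hy; rewrite asymptotic_dn => -[D hD] s; exists (s + D).+1.
have := gpE (x (s + D).+1) (y (s + D).+1); rewrite !isray_len //; have := hD (s + D).+1; lia.
Qed.

Lemma asymptotic_gp x c t : isray x -> asymptotic d x c ->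
  exists i0, forall i, (i0 <= i)%N -> (t <= (gp (x t) (c i)).+1)%N.
Proof.
move=> hx; rewrite asymptotic_dn => -[D hD]; exists (t + D)%N => i hi.
have := gp_hyp g5 (x t) (x i) (c i); rewrite isray_gp //; last by lia.
have := gpE (x i) (c i); have := hD i; have := dn_tri (c i) 1%g (x i).
rewrite !dn1 (dnC (c i) (x i)) isray_len //; lia.
Qed.

Local Notation prod := (boundary_product (R := R) (d := d) 1%g).

(** Far points of any representing rays have product at least [t - 1] with [x t] and [y t]
    respectively. Two four-point inequalities cost 2, and the margin 3 ensures that the minima are
    not these large terms. *)
Lemma product_upper x y (hx : isray x) (hy : isray y) t :
  (gp (x t) (y t) + 3 < t)%N ->
  (prod (bpoint hx) (bpoint hy) <= (gp (x t) (y t) + 2)%:R%:E)%E.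
Proof.
move=> ht; apply: ge_ereal_sup => _ [c [c' [/bpointP[_ ac] [/bpointP[_ ac'] ->]]]].
have [i0 hi0] := asymptotic_gp t hx ac; have [j0 hj0] := asymptotic_gp t hy ac'.
rewrite /limf_einf leeNl; apply: le_ereal_inf_tmp => _ [V FV <-].
have F2 : filter_prod \oo \oo [set ij : nat * nat | (i0 <= ij.1)%N /\ (j0 <= ij.2)%N].
  exists ([set i | (i0 <= i)%N], [set j | (j0 <= j)%N]); first by split; exact: nbhs_infty_ge.
  by move=> [i j] [].
have [[i j] [Vij [/= hi hj]]] := filter_ex (filterI FV F2).
apply: le_ereal_sup_tmp; exists (- (gromov_product d 1%g (c i) (c' j))%:E)%E; first by exists (i, j).
rewrite -EFinN lee_fin lerN2 gromov_productE ler_nat.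
have h1 := gp_hyp g5 (x t) (c i) (c' j); have h2 := gp_hyp g5 (x t) (c' j) (y t).
have := hi0 i hi; have := hj0 j hj; rewrite (gpC (y t)); lia.
Qed.

(** Products along two rays from the identity are monotone, so the lower limit for [x] and [y]
    themselves is at least the value at [t]. *)
Lemma product_lower x y (hx : isray x) (hy : isray y) t :
  ((gp (x t) (y t))%:R%:E <= prod (bpoint hx) (bpoint hy))%E.
Proof.
apply: le_ereal_sup_tmp; exists (limf_einf (fun ij : nat * nat =>
  (gromov_product d 1%g (x ij.1) (y ij.2))%:E) (filter_prod \oo \oo)).
  by exists x, y; split; [|split=> //]; apply/bpointP; split;
    [exact: isray_geodesic|exact: asymptotic_refl|exact: isray_geodesic|exact: asymptotic_refl].
rewrite /limf_einf leeNr; apply: ge_ereal_inf.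
eexists; first (exists [set ij : nat * nat | (t <= ij.1)%N /\ (t <= ij.2)%N]; last reflexivity).
  exists ([set i | (t <= i)%N], [set j | (t <= j)%N]); first by split; exact: nbhs_infty_ge.
  by move=> [i j] [].
apply: ge_ereal_sup => _ [[i j] [/= hi hj] <-].
rewrite lee_fin lerN2 gromov_productE ler_nat; exact: isray_gp_mono.
Qed.

Lemma product_fine x y (hx : isray x) (hy : isray y) : bpoint hx <> bpoint hy ->
  exists s, [/\ forall t, (gp (x t) (y t) <= s)%N,
    prod (bpoint hx) (bpoint hy) \is a fin_num & fine (prod (bpoint hx) (bpoint hy)) <= (s + 2)%:R].
Proof.
move=> nxy; have /existsNP[s hs] : ~ forall s, exists t, (s < gp (x t) (y t))%N.
  by move=> hu; apply: nxy; apply/bpoint_eq; exact: unbounded_asymptotic.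
have {}hs t : (gp (x t) (y t) <= s)%N.
  by rewrite leqNgt; apply/negP => ht; apply: hs; exists t.
have h1 := product_lower hx hy 0.
have h2 : (prod (bpoint hx) (bpoint hy) <= (s + 2)%:R%:E)%E.
  apply: le_trans (product_upper hx hy (t := s + 4) _) _; first by have := hs (s + 4)%N; lia.
  by rewrite lee_fin ler_nat leq_add2r.
have fin : prod (bpoint hx) (bpoint hy) \is a fin_num.
  by rewrite fin_real // (lt_le_trans _ h1) ?ltNyr //= (le_lt_trans h2) // ltry.
by exists s; split=> //; rewrite -lee_fin fineK.
Qed.

Section Visual.
Variables (rho : bdry -> bdry -> R) (a C : R).
Hypotheses (rho_metric : is_metric rho) (a1 : 1 < a) (C0 : 0 < C).
Hypothesis vis : forall xi eta, xi <> eta ->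
  C^-1 * a `^ (- fine (prod xi eta)) <= rho xi eta <= C * a `^ (- fine (prod xi eta)).

Let a0 : 0 < a. Proof. exact: lt_trans a1. Qed.

Lemma visual_upper x y (hx : isray x) (hy : isray y) t L : (L <= gp (x t) (y t))%N ->
  rho (bpoint hx) (bpoint hy) <= C * a ^- L.
Proof.
move=> hL; have [e|ne] := pselect (bpoint hx = bpoint hy).
  by rewrite e; case: rho_metric => -> _ _ _; rewrite mulr_ge0 ?invr_ge0 ?exprn_ge0 // ltW.
have /andP[_ h] := vis ne; apply: le_trans h _; rewrite ler_pM2l //.
rewrite -powR_invn ?(ltW a0) //; apply: ler_powR; first exact: ltW.
have [s [_ fin _]] := product_fine ne.
rewrite lerN2 -lee_fin fineK //; apply: le_trans (product_lower hx hy t).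
by rewrite lee_fin ler_nat.
Qed.

Lemma visual_lower x y (hx : isray x) (hy : isray y) L :
  (forall t, gp (x t) (y t) <= L)%N -> C^-1 * a ^- (L + 2) <= rho (bpoint hx) (bpoint hy).
Proof.
move=> hL; have ne : bpoint hx <> bpoint hy.
  move=> /bpoint_eq /(asymptotic_unbounded hx hy) /(_ L) [t].
  by rewrite ltnNge hL.
have /andP[h _] := vis ne; apply: le_trans h; rewrite ler_pM2l ?invr_gt0 //.
rewrite -powR_invn ?(ltW a0) //; apply: ler_powR; first exact: ltW.
have [s [_ fin _]] := product_fine ne; rewrite lerN2 -lee_fin fineK //.
apply: le_trans (product_upper hx hy (t := L + 4) _) _; first by have := hL (L + 4)%N; lia.
by rewrite lee_fin ler_nat leq_add2r.
Qed.

End Visual.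

End RacgBoundary.

(** * The round tree in the boundary *)

Section Assembly.
Variables (G : sgraph) (n m : nat).
Hypotheses (n0 : (0 < n)%N) (hG : branching G n m).
Local Notation T := (seq ('I_n * nat)).
Local Notation branch := (nat -> 'I_n * nat).
Implicit Types (pi : T) (b : branch) (w : seq 'I_n).
Variables (u0 v0 : G).
Hypothesis uv0 : adj u0 v0.

(** The root is the identity chamber with an empty list of cliques; an arbitrary edge serves as its
    path of mirrors. *)
Let st0 : seq (seq G) * (G * seq G) := ([::], (u0, [:: v0])).
Local Notation strip := (@strip G n m st0).
Local Notation arity := (@arity G n m st0).
Local Notation cliques := (@cliques G n m st0).
Local Notation tvalid := (tvalid strip).
Local Notation bvalid := (bvalid strip).
Local Notation foata := (foata (@adj G)).

Let g5 : girth_ge5 G := branch_girth n0 hG.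

Lemma good_st0 : good_state st0.
Proof.
split=> //; first by left.
  by rewrite /= inE andbT; apply/eqP => e; move: uv0; rewrite e adj_irr.
by rewrite /= uv0.
Qed.

Lemma tree_layered : layered arity strip (3 * m - 7).
Proof.
split=> // [i w|w i pi hp]; first exact: strip_cons.
have := arity_bound n0 hG good_st0 i (strip_valid hp); lia.
Qed.

Definition chamber pi : racg G := gof (cliques pi).
Definition clen pi := len (chamber pi).

Lemma node_foata pi : tvalid pi -> foata (cliques pi).
Proof. move=> h; exact: (cliques_foata n0 hG good_st0 h). Qed.

Lemma size_cliques pi : size (cliques pi) = size pi.
Proof. by have [ec [<- e]] := cliques_cat m st0 pi [::]; rewrite cats0 in e; rewrite e size_cat addn0. Qed.

Lemma clen_cons x pi : tvalid (x :: pi) -> (clen pi < clen (x :: pi) <= clen pi + 2)%N.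
Proof.
move=> vx; have vp : tvalid pi := tvalid_catr tree_layered (e := [:: x]) vx.
rewrite /clen /chamber !(len_gof (node_foata _)) //.
have := node_foata vx; case: x vx => i a vx; rewrite cliques_cons /= size_cat => /and3P[cc _ _].
by case: (head _ _) cc => // s [|t [|//]] /= _; lia.
Qed.

Lemma clen_ge pi : tvalid pi -> (size pi <= clen pi)%N.
Proof.
move=> vp; rewrite /clen /chamber len_gof ?node_foata // -size_cliques.
by have /andP[] := size_foata (node_foata vp).
Qed.

Definition wordof b k := rev (flatten (cliques (bnode b k))).

Lemma wordof_cat b j k : (j <= k)%N -> exists s, wordof b k = wordof b j ++ s.
Proof.
move=> /(bnode_cat b)[e he]; rewrite /wordof he.
by have [ec [_ ->]] := cliques_cat m st0 e (bnode b j); rewrite flatten_cat rev_cat; eexists.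
Qed.

(** Each clique contributes a letter, so the first [t] letters of the branch are settled by layer
    [t]. *)
Definition ray b t : racg G := el (take t (wordof b t)).

Lemma wordof_size b k : bvalid b -> (k <= size (wordof b k))%N /\ size (wordof b k) = clen (bnode b k).
Proof.
move=> vb; have e : size (wordof b k) = clen (bnode b k).
  by rewrite /clen /chamber len_gof ?node_foata // size_rev.
by split=> //; rewrite e -{1}(size_bnode b k) clen_ge.
Qed.

Lemma rayE b t k : bvalid b -> (t <= k)%N -> ray b t = el (take t (wordof b k)).
Proof.
move=> vb /(wordof_cat b)[s ->]; have [h _] := wordof_size t vb.
by rewrite takel_cat.
Qed.

Lemma wordof_red b k : bvalid b -> reduced (@adj G) (wordof b k).
Proof. by move=> vb; apply/red_rev/foata_reduced/node_foata => //; exact: adj_irr. Qed.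

Lemma ray_isray b : bvalid b -> isray (ray b).
Proof.
move=> vb; split; first by rewrite /ray take0 el_nil.
move=> i j ij; rewrite (rayE vb ij) /ray.
have [hj _] := wordof_size j vb; have rj := wordof_red j vb.
rewrite -[X in dn _ (el X)](cat_take_drop i) take_takel // el_cat.
rewrite -{1}(mulg1 (el _)) dn_mul dn1 len_el_red ?size_drop ?size_takel //.
apply: (@reduced_catr _ _ (take i (wordof b j))).
have -> : take i (wordof b j) = take i (take j (wordof b j)) by rewrite take_takel.
rewrite cat_take_drop.
by apply: (@reduced_catl _ _ _ (drop j (wordof b j))); rewrite cat_take_drop.
Qed.

Lemma ray_chamber b k : bvalid b -> ray b (clen (bnode b k)) = chamber (bnode b k).
Proof.
move=> vb; have [h e] := wordof_size k vb.
rewrite (@rayE b _ (clen (bnode b k))) //.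
have [|s ->] := @wordof_cat b k (clen (bnode b k)); first by rewrite -e.
by rewrite -e take_size_cat.
Qed.

Lemma gp_ray_le b b' t t' k : bvalid b -> bvalid b' -> (t <= k)%N -> (t' <= k)%N ->
  (gp (ray b t) (ray b' t') <= gp (chamber (bnode b k)) (chamber (bnode b' k)))%N.
Proof.
move=> vb vb' tk tk'; rewrite -!ray_chamber //.
have [h1 e1] := wordof_size k vb; have [h2 e2] := wordof_size k vb'.
apply: isray_gp_mono; try exact: ray_isray; first by rewrite -e1 (leq_trans tk).
by rewrite -e2 (leq_trans tk').
Qed.

Lemma gp_ray_ge b b' k : bvalid b -> bvalid b' ->
  exists t, (gp (chamber (bnode b k)) (chamber (bnode b' k)) <= gp (ray b t) (ray b' t))%N.
Proof.
move=> vb vb'; exists (maxn (clen (bnode b k)) (clen (bnode b' k))).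
rewrite -!ray_chamber //; apply: isray_gp_mono; try exact: ray_isray.
  exact: leq_maxl.
exact: leq_maxr.
Qed.

Lemma chamber_fellow C pi pi' k : tvalid pi -> tvalid pi' -> (k <= size pi)%N -> (k <= size pi')%N ->
  (minn (clen (anc k pi)) (clen (anc k pi')) <= gp (chamber pi) (chamber pi') + C)%N ->
  (dn (chamber (anc k pi)) (chamber (anc k pi')) <= fellow_const C)%N.
Proof.
move=> vp vp' h h'.
have [ec [_ e1]] := cliques_cat m st0 (take (size pi - k) pi) (anc k pi).
have [ec' [_ e2]] := cliques_cat m st0 (take (size pi' - k) pi') (anc k pi').
rewrite cat_take_drop in e1; rewrite cat_take_drop in e2.
rewrite /clen /chamber e1 e2; apply: foata_fellow => //; rewrite -?e1 -?e2 ?node_foata //.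
by rewrite !size_cliques !size_anc.
Qed.

Lemma clen_anc pi k : tvalid pi -> (clen (anc k pi) <= clen pi)%N.
Proof.
have key e p : tvalid (e ++ p) -> (clen p <= clen (e ++ p))%N.
  elim: e => //= x e ih vx.
  apply: leq_trans (ih (tvalid_catr tree_layered (e := [:: x]) vx)) _.
  by have /andP[/ltnW] := clen_cons vx.
by move=> vp; have := key (take (size pi - k) pi) (anc k pi); rewrite cat_take_drop; exact.
Qed.

(** Close chambers have a Gromov product near their lengths, so [chamber_fellow] keeps their
    ancestors close. *)
Lemma chamber_anc_near D pi pi' k : tvalid pi -> tvalid pi' -> size pi = size pi' -> (k <= size pi)%N ->
  (dn (chamber pi) (chamber pi') <= D)%N ->
  (dn (chamber (anc k pi)) (chamber (anc k pi')) <= fellow_const D)%N.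
Proof.
move=> vp vp' es hk hd; apply: chamber_fellow => //; first by rewrite -es.
have := gpE (chamber pi) (chamber pi'); rewrite -/(clen pi) -/(clen pi').
have := clen_anc k vp; have := clen_anc k vp'; lia.
Qed.

Lemma diverge_gp b b' i pi t : bvalid b -> bvalid b' -> tvalid pi ->
  bnode b (size pi).+1 = (i, 0%N) :: pi -> bnode b' (size pi).+1 = (i, (arity i pi).-1) :: pi ->
  (gp (ray b t) (ray b' t) <= clen pi)%N.
Proof.
move=> vb vb' vp e1 e2; pose k := maxn t (size pi).+1.
have tk : (t <= k)%N by exact: leq_maxl.
apply: leq_trans (gp_ray_le vb vb' tk tk) _.
have sk : ((size pi).+1 <= k)%N by exact: leq_maxr.
have [e he] := bnode_cat b sk; have [e' he'] := bnode_cat b' sk.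
rewrite e1 in he; rewrite e2 in he'.
have [ec [_ h1]] := cliques_cat m st0 e ((i, 0%N) :: pi).
have [ec' [_ h2]] := cliques_cat m st0 e' ((i, (arity i pi).-1) :: pi).
have c1 := cliques_cons m st0 i 0 pi; have c2 := cliques_cons m st0 i (arity i pi).-1 pi.
have vk := vb k; have vk' := vb' k; rewrite he in vk; rewrite he' in vk'.
have f1 := node_foata vk; have f2 := node_foata vk'.
rewrite /clen /chamber he he' h1 h2 c1 c2; rewrite h1 c1 in f1; rewrite h2 c2 in f2.
rewrite gp_diverge // => x hx hx'.
apply: (extreme_disj (x := x) n0 hG good_st0 (i := i) vp); by rewrite ?c1 ?c2.
Qed.

(** On a given layer the group element determines the node and with it the vertical word, and the
    chambers within distance [D] are reached by words of length at most [D]. *)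
Lemma ball_count D pi (hp : tvalid pi) :
  (#|[set v : (size pi).-tuple 'I_n |
      `[< exists2 rho, rho \in strip v & (dn (chamber rho) (chamber pi) <= D)%N >]]%SET|
    <= #|{: D.-bseq G}|)%N.
Proof.
set V := [set v : _ | _]%SET.
have /choice[r hr] : forall v : (size pi).-tuple 'I_n, exists rho, v \in V ->
    rho \in strip v /\ (dn (chamber rho) (chamber pi) <= D)%N.
  move=> v; have [|] := boolP (v \in V); last by exists [::].
  by rewrite inE => /asboolP[rho h1 h2]; exists rho.
pose h v : D.-bseq G := insub_bseq D (nfg ((chamber pi)^-1 * chamber (r v))%g).
have hv v : v \in V -> h v = nfg ((chamber pi)^-1 * chamber (r v))%g :> seq G.
  move=> /hr[_ hd]; rewrite /h /insub_bseq val_insubd ifT //.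
  by rewrite dnC in hd; exact: hd.
rewrite -(card_in_imset (f := h)); first exact: max_card.
move=> v v' vV v'V /(congr1 val) /= e; rewrite !hv // in e.
have [s1 _] := hr _ vV; have [s2 _] := hr _ v'V.
have eg : chamber (r v) = chamber (r v').
  by apply: (mulgI (chamber pi)^-1%g); rewrite -(elK (_ * chamber (r v))%g) e elK.
have v1 := lay_valid tree_layered s1; have v2 := lay_valid tree_layered s2.
have es : size (r v) = size (r v').
  by rewrite (size_strip tree_layered s1) (size_strip tree_layered s2) !size_tuple.
have er : r v = r v'.
  apply: (cliques_inj n0 hG good_st0 v1 v2 es).
  by apply: gof_inj eg; rewrite ?node_foata // !size_cliques.
have q1 := lay_unzip tree_layered s1; have q2 := lay_unzip tree_layered s2.
by apply: val_inj; rewrite er in q1; exact: etrans (esym q1) q2.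
Qed.

(** The last entry of a vertical word is its first step, so the ends of a strip descend from the
    first and the last child of the root. *)
Lemma strip_ends i w : exists e e', head [::] (strip (rcons w i)) = e ++ [:: (i, 0%N)] /\
  last [::] (strip (rcons w i)) = e' ++ [:: (i, (arity i [::]).-1)].
Proof.
elim: w => [|j w [e [e' [h1 h2]]]].
  exists [::], [::]; split; first by rewrite (head_strip n0 hG good_st0).
  by rewrite (last_strip n0 hG good_st0).
rewrite rcons_cons (head_strip n0 hG good_st0) (last_strip n0 hG good_st0) h1 h2.
by exists ((j, 0%N) :: e); eexists (_ :: e').
Qed.

(** * Verification of the estimates for the tree of chambers *)

Section Estimate.
Variables (R : realType).
Local Notation d := (word_dist R (racg_gens G)).
Local Notation bdry := (gromov_boundary d).
Variables (rho : bdry -> bdry -> R) (rho_metric : is_metric rho) (a C : R).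
Hypotheses (m5 : (5 <= m)%N) (a1 : 1 < a) (C0 : 0 < C).
Hypothesis vis : forall xi eta, xi <> eta ->
  C^-1 * a `^ (- fine (boundary_product 1%g xi eta)) <= rho xi eta
    <= C * a `^ (- fine (boundary_product 1%g xi eta)).

Let a0 : 0 < a. Proof. exact: lt_trans a1. Qed.
Let i0 : 'I_n := Ordinal n0.

Lemma base_branch : exists b, bvalid b.
Proof. by have [b vb _] := branch_through tree_layered i0 (tvalid0 tree_layered); exists b. Qed.

(** Outside the valid branches the value is a default, the point of a fixed branch. *)
Definition zpoint b : metrized rho_metric :=
  if pselect (bvalid b) is left h then bpoint R (ray_isray h)
  else bpoint R (ray_isray (projT2 (cid base_branch))).

Lemma zpointE b (h : bvalid b) : zpoint b = bpoint R (ray_isray h).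
Proof. by rewrite /zpoint; case: pselect => // h'; rewrite (Prop_irrelevance h h'). Qed.

Lemma mdist_upper b b' t L : bvalid b -> bvalid b' -> (L <= gp (ray b t) (ray b' t))%N ->
  mdist (zpoint b) (zpoint b') <= C * a ^- L.
Proof.
by move=> vb vb' hL; rewrite !zpointE; exact: (visual_upper g5 rho_metric a1 C0 vis _ _ hL).
Qed.

Lemma mdist_lower b b' L : bvalid b -> bvalid b' -> (forall t, gp (ray b t) (ray b' t) <= L)%N ->
  a ^- L <= C * a ^+ 2 * mdist (zpoint b) (zpoint b').
Proof.
move=> vb vb' hL; rewrite !zpointE; have := visual_lower g5 a1 C0 vis (ray_isray vb) (ray_isray vb') hL.
set r := rho _ _ => h; change (a ^- L <= C * a ^+ 2 * r).
have -> : a ^- L = C * a ^+ 2 * (C^-1 * a ^- (L + 2)).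
  have aL : a ^+ L != 0 by rewrite expf_neq0 // gt_eqF.
  have a2 : a != 0 by rewrite gt_eqF.
  have Cn : C != 0 by rewrite gt_eqF.
  by rewrite exprD; field; rewrite aL a2.
by rewrite ler_pM2l // mulr_gt0 // exprn_gt0.
Qed.

Lemma confdim_ge : (1 <= 3 * m - 7)%N ->
  ((1 + ln n%:R / ln (3 * m - 7)%:R)%:E <= confdim (metrized rho_metric))%E.
Proof.
move=> _; set H := (3 * m - 7)%N; have H1 : (1 < H)%N by rewrite /H; lia.
set beta := ln n%:R / ln H%:R.
have lnH : 0 < ln (H%:R : R) by rewrite ln_gt0 // ltr1n.
have b0 : 0 <= beta by rewrite divr_ge0 ?(ltW lnH) // ln_ge0 // ler1n.
have HR : (0 : R) < H%:R by rewrite ltr0n ltnW.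
have en : (n%:R : R) = H%:R `^ beta.
  by rewrite /powR gt_eqF // /beta divfK ?gt_eqF // lnK // posrE ltr0n.
apply: le_ereal_inf_tmp => _ [Y [f [hf ->]]]; apply: hausdorff_dim_ge.
(* [k0] bounds the distance on a layer before separation. In [k1], [fellow_const 1] accounts for the
   neighbour on the strip and [fellow_const k0] for going from the layer of [pi] up to that of an
   ancestor. *)
pose k0 := fellow_const 0; pose k1 := (fellow_const 1 + fellow_const k0)%N.
pose sz pi : R := a ^- clen pi.
pose near0 pi pi' := (dn (chamber pi) (chamber pi') <= k0)%N : Prop.
pose near1 pi pi' := (dn (chamber pi) (chamber pi') <= k1)%N : Prop.
pose nb : rel T := fun pi pi' => (dn (chamber pi) (chamber pi') <= 1)%N.
(* The summands serve, in turn, [1 <= K], the upper distance bound, the lower distance bounds, and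
   the step to a child, which adds at most two letters. *)
pose K := 1 + C * a ^+ k1 + C * a ^+ 2 + a ^+ 2.
have p1 : 0 < C * a ^+ k1 by rewrite mulr_gt0 // exprn_gt0.
have p2 : 0 < C * a ^+ 2 by rewrite mulr_gt0 // exprn_gt0.
have p3 : 0 < a ^+ 2 by rewrite exprn_gt0.
have sz0 pi : 0 < sz pi by rewrite invr_gt0 exprn_gt0.
have low L r : 0 <= r -> a ^- L <= C * a ^+ 2 * r -> a ^- L <= K * r.
  by move=> r0 h; apply: le_trans h _; rewrite ler_wpM2r // /K; lra.
apply: (@no_small_cover R n H n0 H1 arity strip tree_layered _ Y f hf zpoint sz near0 near1 nb K
  #|{: k1.-bseq G}|) => //.
- by rewrite /K; lra.
- by move=> pi; rewrite /near1 dngg.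
- move=> b b' k vb vb' hd; have [t ht] := gp_ray_ge k vb vb'.
  have hL : (clen (bnode b' k) - k1 <= gp (ray b t) (ray b' t))%N.
    apply: leq_trans ht; have := gpE (chamber (bnode b k)) (chamber (bnode b' k)).
    have := dn_tri (chamber (bnode b k)) 1%g (chamber (bnode b' k)).
    move: hd; rewrite /near1 !dn1 -/(clen _) -/(clen _); clear; lia.
  apply: le_trans (mdist_upper vb vb' hL) _.
  apply: (le_trans (y := C * a ^+ k1 * sz (bnode b' k))); last first.
    by rewrite ler_wpM2r // ?(ltW (sz0 _)) // /K; lra.
  rewrite -mulrA ler_pM2l // /sz.
  rewrite ler_pdivlMr ?exprn_gt0 // mulrC ler_pdivrMr ?exprn_gt0 // -exprD.
  by rewrite ler_weXn2l ?(ltW a1) //; clear; lia.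
- move=> b b' k vb vb' nn; apply: low; first exact: mdist_ge0.
  apply: mdist_lower => // t.
  have nk : ~~ (dn (chamber (bnode b' k)) (chamber (bnode b k)) <= k0)%N by apply/negP.
  pose N := maxn t k; apply: leq_trans (gp_ray_le vb vb' (leq_maxl t k) (leq_maxl t k)) _.
  have kN : (k <= N)%N := leq_maxr t k.
  rewrite leqNgt; apply: contra nk => hlt; rewrite dnC.
  have := @chamber_fellow 0 (bnode b N) (bnode b' N) k (vb N) (vb' N).
  rewrite !size_bnode !anc_bnode // => /(_ kN kN); apply; rewrite addn0.
  by apply: leq_trans (ltnW hlt); exact: geq_minl.
- move=> pi vp; have [ar0 arH] := andP (tvalid_arity tree_layered i0 vp).
  have vl : tvalid ((i0, 0%N) :: pi) by rewrite (tvalid_cons tree_layered) vp ar0.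
  have vr : tvalid ((i0, (arity i0 pi).-1) :: pi).
    by rewrite (tvalid_cons tree_layered) vp ltn_predL.
  have [b vb [e1 _]] := branch_through tree_layered i0 vl.
  have [b' vb' [e2 _]] := branch_through tree_layered i0 vr.
  exists b, b'; split=> //.
  + by move: e1 => /= [_ ->].
  + by move: e2 => /= [_ ->].
  + by apply: low (mdist_ge0 _ _) _; apply: mdist_lower => // t; exact: (diverge_gp t vb vb' vp e1 e2).
- move=> x pi vx; have /andP[_ h] := clen_cons vx.
  apply: (le_trans (y := a ^+ 2 * sz (x :: pi))); last first.
    by rewrite ler_wpM2r ?(ltW (sz0 _)) // /K; lra.
  rewrite /sz ler_pdivlMr ?exprn_gt0 // mulrC ler_pdivrMr ?exprn_gt0 // -exprD.
  by rewrite ler_weXn2l ?(ltW a1) //; clear -h; lia.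
- move=> b e vb e0.
  have [k hk] : exists k, a ^- k < e.
    have ai : `|a^-1| < 1 by rewrite gtr0_norm ?invr_gt0 // invf_lt1.
    have /cvgr0Pnorm_lt/(_ e e0)[k _ hk] := cvg_expr ai; exists k.
    by have := hk k (leqnn k); rewrite /= gtr0_norm exprVn // invr_gt0 exprn_gt0.
  exists k => j kj; apply: le_lt_trans hk; rewrite /sz lef_pV2 ?posrE ?exprn_gt0 //.
  rewrite ler_weXn2l ?(ltW a1) // (leq_trans kj) // -{1}(size_bnode b j).
  exact: clen_ge (vb j).
- by move=> w; exact: (strip_near n0 hG good_st0 w).
- move=> r r' pi k vr vr' vp es hrr hs hn hk.
  have h1 : (dn (chamber (anc k r)) (chamber (anc k pi)) <= fellow_const k0)%N.
    rewrite -(anc_anc hk hs); apply: chamber_anc_near => //.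
    + exact: (tvalid_anc tree_layered _ vr).
    + by rewrite size_anc.
    + by rewrite size_anc.
  have h2 : (dn (chamber (anc k r')) (chamber (anc k r)) <= fellow_const 1)%N.
    rewrite dnC; apply: chamber_anc_near => //; first exact: leq_trans hs.
    by case: hrr => [->|//]; rewrite dngg.
  by apply: leq_trans (dn_tri (chamber (anc k r)) _ _) _; exact: leq_add.
- by move=> pi vp; exact: ball_count.
- case/lastP=> // w i b b' _ vb vb' e1 e2; apply: low; first exact: mdist_ge0.
  have [e [e' [h1 h2]]] := strip_ends i w.
  have s1 : (1 <= size (rcons w i))%N by rewrite size_rcons.
  apply: mdist_lower => // t; apply: (diverge_gp (i := i) t vb vb' (tvalid0 tree_layered)).
    by rewrite -(anc_bnode b s1) e1 h1 anc_cat.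
  by rewrite -(anc_bnode b' s1) e2 h2 anc_cat.
Qed.

End Estimate.
End Assembly.

Theorem theorem4p8 (R : realType) (n m : nat) (hn : (1 <= n)%N) (hm : (5 <= m)%N)
    (G : sgraph) (hG : branching G n m) :
  hyperbolic_group R (racg G) /\
  forall (rho : gromov_boundary (word_dist R (racg_gens G)) ->
                gromov_boundary (word_dist R (racg_gens G)) -> R)
         (rho_metric : is_metric rho),
    is_visual 1%g rho ->
    ((1 + ln n%:R / ln (3 * m%:R - 7))%:E <= confdim (metrized rho_metric))%E.
Proof.
have g5 := branch_girth hn hG; split.
  by exists (racg_gens G); split; [exact: racg_generates|exact: racg_hyperbolic].
move=> rho rho_metric [a [C [a1 C0 vis]]].
have [u _] : exists u : G, u \in [set: G]%SET.
  by apply/set0Pn; rewrite -card_gt0 cardsT vertex_nonempty.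
have [v uv] : exists v : G, adj u v.
  have /set0Pn[v] : Lk u != finset.set0 by rewrite -card_gt0 (leq_trans _ (hG.1 u)).
  by rewrite inE; exists v.
have -> : 3 * m%:R - 7 = (3 * m - 7)%:R :> R by rewrite natrB ?natrM //; lia.
apply: (confdim_ge hn hG uv rho_metric hm a1 C0 vis); lia.
Qed.
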